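(* Let $\mathcal{G}=(V,E)$ be a Borel multi-graph of bounded maximum degree and let $\nu$ be an $F_{\mathcal{E}}$-invariant Borel probability measure on $E$. Then $\chi_\nu(\mathcal{E})\le\Delta(\mathcal{G})+\pi(\mathcal{G})$.
   Context: A Borel multi-graph $\mathcal{G}=(V,E)$ with multiplicity at most $\pi$: $V$ is a standard Borel space and $E\subseteq[V]^2\times[\pi]$ is Borel ($[V]^2$ the unordered pairs of distinct points); $(\{x,y\},k)\in E$ are the parallel edges between $x$ and $y$. $\Delta(\mathcal{G})$ is the maximum degree (number of edges at a vertex with multiplicity), assumed finite, and $\pi(\mathcal{G})$ the maximum multiplicity. $E$ carries the standard Borel structure inherited from $[V]^2\times[\pi]$. The line graph $\mathcal{E}=(E,I_\mathcal{G})$ is the Borel graph on $E$ in which distinct edges $e,f$ are adjacent iff they share an endpoint (in particular parallel edges are adjacent). $F_{\mathcal{E}}$ is the equivalence relation on $E$ whose classes are the connected components of $\mathcal{E}$. A Borel probability measure $\nu$ on $E$ is $F_{\mathcal{E}}$-invariant if $\nu(A)=\nu(B)$ whenever $A,B\subseteq E$ are Borel and there is a Borel bijection $\phi:A\to B$ with $(e,\phi(e))\in F_{\mathcal{E}}$ for all $e\in A$. $\chi_\nu(\mathcal{E})$ is the smallest $k$ such that there is a Borel set $C\subseteq E$ with $\nu(E\setminus C)=0$ and a Borel map $c:C\to[k]$ with $c(e)\ne c(f)$ for all adjacent $e,f\in C$. *)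

(* Defs.v *)
From Stdlib Require Export Relation_Operators.
From HB Require Import structures.
From mathcomp Require Export all_boot all_order all_algebra.
From mathcomp Require Export all_classical all_reals all_analysis.

Set Implicit Arguments.
Unset Strict Implicit.
Unset Printing Implicit Defensive.

Import Order.TTheory GRing.Theory Num.Theory.

Local Open Scope classical_set_scope.
Local Open Scope ring_scope.

(* A measurable space is standard Borel when it is isomorphic to a Polish space
   equipped with its Borel sigma-algebra. *)
Definition standard_borel (R : realType) d (V : measurableType d) : Prop :=
  exists (T : completePseudoMetricType R) (f : V -> T),
    [/\ hausdorff_space T, @second_countable T, bijective f
      & @measurable d V = preimage_set_system setT f <<s @open T >>].

(* Unordered pairs, as sets [set x; y]. The degenerate pairs [set x; x] are kept
   because measurable types must be inhabited, even over a one-point V; they are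
   excluded from edge sets through [proper_upair]. *)
Definition upair (V : Type) : Type :=
  {e : set V | exists x y : V, e = [set x; y]}.

Definition mk_upair (V : Type) (p : V * V) : upair V :=
  exist _ [set p.1; p.2] (ex_intro _ p.1 (ex_intro _ p.2 erefl)).

Definition proper_upair (V : Type) (e : upair V) : Prop :=
  exists x y : V, x <> y /\ sval e = [set x; y].

Definition upair_display : measure_display -> measure_display.
Proof. exact. Qed.

HB.instance Definition _ (V : Type) := gen_eqMixin (upair V).
HB.instance Definition _ (V : Type) := gen_choiceMixin (upair V).

Section upair_measurable.
Context d (V : measurableType d).

HB.instance Definition _ := isPointed.Build (upair V)
  (mk_upair (point, point)).

(* Quotient structure of V * V: a set of unordered pairs is Borel iff the set of
   ordered pairs lying over it is. *)
Definition upair_measurable : set (set (upair V)) :=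
  image_set_system setT (@mk_upair V) (@measurable _ (V * V)%type).

Let upair_measurable0 : upair_measurable set0.
Proof.
by rewrite /upair_measurable /image_set_system /= preimage_set0 setI0.
Qed.

Let upair_measurableC (A : set (upair V)) :
  upair_measurable A -> upair_measurable (~` A).
Proof.
rewrite /upair_measurable /image_set_system /= !setTI preimage_setC => mA.
exact: measurableC.
Qed.

Let upair_measurable_bigcup (F : (set (upair V))^nat) :
  (forall i, upair_measurable (F i)) -> upair_measurable (\bigcup_i F i).
Proof.
rewrite /upair_measurable /image_set_system /= setTI preimage_bigcup => mF.
by apply: bigcupT_measurable => i; have := mF i; rewrite setTI.
Qed.

HB.instance Definition _ := @isMeasurable.Build (upair_display d) (upair V)
  upair_measurable upair_measurable0 upair_measurableC upair_measurable_bigcup.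

End upair_measurable.

(* [(e, k)] is the [k]-th parallel edge on the pair [e]; the index set of
   parallel edges is {0, ..., mult_bound - 1}. *)
Record borel_multigraph d (V : measurableType d) := BorelMultigraph {
  edges : set (upair V * nat);
  mult_bound : nat;
  edges_measurable : measurable edges;
  edges_proper : forall e, edges e -> proper_upair e.1;
  edges_index : forall e, edges e -> (e.2 < mult_bound)%N }.

Section multigraph.
Context (R : realType) d (V : measurableType d) (G : borel_multigraph V).

Definition degree (x : V) : \bar R :=
  counting [set e | edges G e /\ sval e.1 x].

Definition max_degree : \bar R := ereal_sup (range degree).

Definition multiplicity (p : upair V) : \bar R :=
  counting [set k | edges G (p, k)].

Definition max_multiplicity : \bar R := ereal_sup (range multiplicity).

Definition line_adj (e f : upair V * nat) : Prop :=
  [/\ edges G e, edges G f, e <> f & exists x : V, sval e.1 x /\ sval f.1 x].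

Definition line_connected (e f : upair V * nat) : Prop :=
  [/\ edges G e, edges G f & clos_refl_trans _ line_adj e f].

(* Below, a Borel measure on the edge set of G is represented by a measure [nu]
   on [upair V * nat] that vanishes outside G. *)
Definition line_invariant (nu : set (upair V * nat) -> \bar R) : Prop :=
  forall (A B : set (upair V * nat)) (phi : upair V * nat -> upair V * nat),
    measurable A -> measurable B -> A `<=` edges G -> B `<=` edges G ->
    measurable_fun A phi -> set_bij A B phi ->
    (forall e, A e -> line_connected e (phi e)) ->
    nu A = nu B.

Definition ae_edge_colorable (nu : set (upair V * nat) -> \bar R) (k : nat) :
    Prop :=
  exists (C : set (upair V * nat)) (c : upair V * nat -> nat),
    [/\ measurable C, C `<=` edges G, nu (edges G `\` C) = 0%E,
        measurable_fun C c
      & (forall e, C e -> (c e < k)%N) /\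
        (forall e f, C e -> C f -> line_adj e f -> c e <> c f)].

(* The smallest number of colors; it is +oo if no finite number suffices. *)
Definition ae_chromatic_index (nu : set (upair V * nat) -> \bar R) : \bar R :=
  ereal_inf [set (k%:R)%:E | k in [set k : nat | ae_edge_colorable nu k]].

End multigraph.

(* Main.v *)
(* Color with k = Delta + pi colors. Vizing's argument removes an uncolored edge (a
   hole) e at x by rotating a fan of edges at x and exchanging two colors along an
   alternating path. If that path is long, one may stop after any of its first L edges,
   which moves the hole there, and start again with a second fan, avoiding the two
   colors of the first path. Hence either e can be colored by changing O(L) edges, or
   the second paths reach at least c L^2 edges. An alternating path can be traced back
   to its ends, so a given edge is reached from at most M holes, where M does not
   depend on L. By invariance of the measure (mass transport), if no hole can be
   removed by changing O(L) edges, then the holes have measure u = O(L^-2).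

   Hence, as long as u > 0, there is a set of positive measure of holes, far away from
   each other, that can be removed by recoloring O(u^(-1/2)) edges each: sqrt u drops
   by at least a constant times the measure of the set of recolored edges. As in
   Ekeland's variational principle, a sequence of such improvements, each at least half
   as good as possible, converges almost everywhere to a coloring with u = 0.

   The Lusin-Novikov theorem is avoided: by inner regularity the edge set is
   sigma-compact up to a null set, and projections of sigma-compact sets are Borel. *)

Require Import Defs.
From mathcomp Require Import all_boot all_order all_algebra.
From mathcomp Require Import all_classical all_reals all_analysis.
From mathcomp Require Import measurable_realfun zify lra.
From mathcomp Require finmap.

Set Implicit Arguments.
Unset Strict Implicit.
Unset Printing Implicit Defensive.

(** The exponent 2 is what makes the total cost finite. With single paths of length L one would only
    get u = O(1/L), so lowering u by t would cost about t/u recolored edges; the integral of 1/u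
    diverges at 0, and nothing would force the colorings to converge. Cutting the first path at
    about L places, with a second path of L edges from each, brings the cost down to t u^(-1/2),
    which is integrable, with primitive sqrt u up to a factor. The obstacle is that the first step
    may disturb the second: places from which a second path could come back near x are discarded,
    and tracing paths back to their ends bounds their number independently of L. A local correction
    is encoded by a radius and a finite list of instructions (name of an edge near the hole, new
    color). There are only countably many codes, so if the correctable holes are not null, one code
    corrects a non-null set of them. All this happens in a Borel subgraph, built from compact sets,
    that misses only a null set of edges. *)

Definition rcomp A B C (R : A -> B -> Prop) (S : B -> C -> Prop) x z :=
  exists2 y, R x y & S y z.

(** A covering list instead of a cardinality: no finiteness has to be established first, and bounds
    multiply under composition. *)
Definition bounded_preim (A : eqType) B m (R : A -> B -> Prop) :=
  forall y, exists2 s : seq A, size s <= m & forall x, R x y -> x \in s.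

Lemma bounded_preim_comp (A B : eqType) C m n (R : A -> B -> Prop) (S : B -> C -> Prop) :
  bounded_preim m R -> bounded_preim n S -> bounded_preim (m * n) (rcomp R S).
Proof.
move=> bR bS z; have [s sn Ss] := bS z.
pose F y := projT1 (cid2 (bR y)).
have Fm y : size (F y) <= m by rewrite /F; case: cid2.
have FR x y : R x y -> x \in F y by rewrite /F; case: cid2 => l /= _; apply.
exists (flatten [seq F y | y <- s]); last first.
  by move=> x [y Rxy /Ss ys]; apply/flatten_mapP; exists y => //; exact: FR.
apply: (@leq_trans (m * size s)); last by rewrite leq_mul2l sn orbT.
elim: s {sn Ss} => //= y s IH; rewrite size_cat mulnS; exact: leq_add.
Qed.

Lemma size_fibers (A B : eqType) (F : A -> B) m (s : seq A) :
  (forall y, count (fun x => F x == y) s <= m) -> size s <= size (undup (map F s)) * m.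
Proof.
move=> H; pose Y := undup (map F s).
have -> : size s = \sum_(y <- Y) \sum_(x <- s) (F x == y).
  rewrite exchange_big /= -sum1_size big_seq [RHS]big_seq; apply: eq_bigr => x xs.
  have hY : F x \in Y by rewrite mem_undup map_f.
  rewrite (bigD1_seq _ hY (undup_uniq _)) /= eqxx big1 // => y /eqP yx.
  by case: eqP => // e1; case: yx.
have -> : size Y * m = \sum_(y <- Y) m by rewrite big_const_seq count_predT iter_addn_0 mulnC.
by apply: leq_sum => y _; rewrite -big_mkcond /= sum1_count.
Qed.

(** * Alternating paths and Vizing fans *)

Section Multigraph.
Local Open Scope nat_scope.
Variables (V E : choiceType) (p1 p2 : E -> V) (star : V -> seq E).
Variables (D mu : nat).

Definition other (f : E) (v : V) := if v == p1 f then p2 f else p1 f.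

(** Only the members of some star are edges; [p1] and [p2] are unconstrained elsewhere. A subgraph
    is thus obtained by shrinking the lists [star v] alone. *)
Record star_spec : Prop := StarSpec {
  star_uniq : forall v, uniq (star v);
  star_end : forall v f, f \in star v -> v = p1 f \/ v = p2 f;
  star_p1 : forall v f, f \in star v -> f \in star (p1 f);
  star_p2 : forall v f, f \in star v -> f \in star (p2 f);
  star_neq : forall v f, f \in star v -> p1 f != p2 f;
  star_size : forall v, size (star v) <= D;
  star_mult : forall v w, count (fun f => other f v == w) (star v) <= mu }.

Hypothesis G : star_spec.

Lemma other_star v f : f \in star v -> f \in star (other f v).
Proof.
by move=> fv; rewrite /other; case: ifP => _; [exact: star_p2 fv|exact: star_p1 fv].
Qed.

Lemma other_neq v f : f \in star v -> other f v != v.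
Proof.
move=> fv; rewrite /other; case: ifPn => [/eqP ->|]; last by rewrite eq_sym.
by rewrite eq_sym (star_neq G fv).
Qed.

Lemma otherK v f : f \in star v -> other f (other f v) = v.
Proof.
move=> fv; have := star_neq G fv; rewrite /other.
case: (eqVneq v (p1 f)) => [->|n1]; first by rewrite eq_sym => /negPf ->.
by rewrite eqxx; case: (star_end G fv) n1 => [->|->//]; rewrite eqxx.
Qed.

Lemma star_other v w f : f \in star v -> f \in star w -> w = v \/ w = other f v.
Proof.
move=> fv fw; rewrite /other.
case: (star_end G fv) (star_end G fw) (star_neq G fv) => -> [] ->; rewrite ?eqxx; auto.
by rewrite eq_sym => /negPf ->; right.
Qed.

Definition nbr x y := exists2 f, f \in star x & other f x = y.

Lemma nbr_sym x y : nbr x y -> nbr y x.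
Proof.
by move=> [f fx <-]; exists f; [exact: other_star|exact: otherK].
Qed.

Lemma nbrP x y : nbr x y -> y \in [seq other f x | f <- star x].
Proof. by move=> [f fx <-]; apply: map_f. Qed.

Local Notation k := (D + mu).
Implicit Types (c d : E -> nat) (v u w x y z : V) (f g h e : E) (a b : nat).

(* The colors are the numbers [< k]; an edge with [k <= c f] is uncolored, and is
   called a hole. *)
Definition proper_coloring c := forall v f g,
  f \in star v -> g \in star v -> c f = c g -> c f < k -> f = g.

Definition miss c v a := a \notin [seq c f | f <- star v].

Lemma missP c v a : reflect (forall f, f \in star v -> c f <> a) (miss c v a).
Proof.
apply: (iffP idP) => [m f fv cf|m].
  by move/negP: m; apply; rewrite -cf; apply: map_f.
by apply/negP => /mapP[f fv cf]; apply: (m f fv).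
Qed.

Definition free c v := [seq a <- iota 0 k | miss c v a].

(** At most [D] of the [D + mu] colors occur at a vertex. The fan argument plays these [mu] missing
    colors against the at most [mu] parallel edges between two vertices. *)
Lemma size_free c v : mu <= size (free c v).
Proof.
have : size (free c v) + count (predC (miss c v)) (iota 0 k) = k.
  by rewrite size_filter count_predC size_iota.
have : count (predC (miss c v)) (iota 0 k) <= size (star v).
  rewrite -size_filter -(size_map c); apply: uniq_leq_size.
    by rewrite filter_uniq ?iota_uniq.
  by move=> a; rewrite mem_filter /= negbK => /andP[].
have := star_size G v; lia.
Qed.

Lemma mem_free c v a : (a \in free c v) = (a < k) && miss c v a.
Proof. by rewrite mem_filter mem_iota /= andbC. Qed.

Definition edge_at c a v : option E := ohead [seq f <- star v | c f == a].

Lemma edge_atP c a v f : edge_at c a v = Some f -> f \in star v /\ c f = a.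
Proof.
rewrite /edge_at; case E1: [seq _ <- _ | _] => [//|h s] /= [<-].
have : h \in [seq f <- star v | c f == a] by rewrite E1 mem_head.
by rewrite mem_filter => /andP[/eqP -> ->].
Qed.

Lemma edge_atN c a v : edge_at c a v = None <-> miss c v a.
Proof.
rewrite /edge_at; case E1: [seq _ <- _ | _] => [|h s] /=; split => //.
- move=> _; apply/missP => f fv cf.
  have : f \in [seq f <- star v | c f == a] by rewrite mem_filter cf eqxx.
  by rewrite E1.
- have : h \in [seq f <- star v | c f == a] by rewrite E1 mem_head.
  rewrite mem_filter => /andP[/eqP cf hv] /missP /(_ h hv).
  by rewrite cf.
Qed.

Lemma edge_at_some c a v f : proper_coloring c -> a < k -> f \in star v ->
  c f = a -> edge_at c a v = Some f.
Proof.
move=> pc ak fv cf; case E1: (edge_at c a v) => [g|].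
  have [gv cg] := edge_atP E1; congr Some; apply: (pc v) => //; lia.
by move/edge_atN: E1 => /missP /(_ f fv).
Qed.

Lemma eq_edge_at c d a v : (forall f, f \in star v -> (c f == a) = (d f == a)) ->
  edge_at c a v = edge_at d a v.
Proof. by move=> cd; rewrite /edge_at (eq_in_filter cd). Qed.

Definition step c a v : option V := omap (fun f => other f v) (edge_at c a v).

(** The value is [None] once the path has ended, so a value at [n] and none at [n.+1] identify the
    last vertex. *)
Fixpoint walk c a b n v : option V :=
  if n is m.+1 then obind (walk c b a m) (step c a v) else Some v.

Definition alt a b n := if odd n then b else a.

Lemma altS a b n : alt a b n.+1 = alt b a n.
Proof. by rewrite /alt /=; case: odd. Qed.

Lemma altSS a b n : alt a b n.+2 = alt a b n.
Proof. by rewrite !altS. Qed.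

Lemma alt_lt a b n q : a < q -> b < q -> alt a b n < q.
Proof. by rewrite /alt; case: odd. Qed.

Lemma alt_or a b n : (alt a b n = a /\ alt a b n.+1 = b) \/ (alt a b n = b /\ alt a b n.+1 = a).
Proof. by rewrite /alt /=; case: odd; [right|left]. Qed.

Lemma alt_alt a b n m : alt (alt a b n) (alt a b n.+1) m = alt a b (n + m).
Proof. by rewrite /alt /= oddD; case: (odd n); case: (odd m). Qed.

Lemma walkD c a b n m v : walk c a b (n + m) v =
  obind (walk c (alt a b n) (alt a b n.+1) m) (walk c a b n v).
Proof.
elim: n a b v => [|n IH] a b v //=.
case: (step c a v) => //= w.
by rewrite IH !altS.
Qed.

Lemma walkSr c a b n v :
  walk c a b n.+1 v = obind (step c (alt a b n)) (walk c a b n v).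
Proof.
rewrite -addn1 walkD; case: walk => //= w; by case: step.
Qed.

Lemma walk_prefix c a b n m v w : walk c a b m v = Some w -> n <= m ->
  exists u, walk c a b n v = Some u.
Proof.
move=> E1 nm; move: E1; rewrite -(subnKC nm) walkD.
by case: walk => //= u _; exists u.
Qed.

Lemma step_sym c a v w : proper_coloring c -> a < k ->
  step c a v = Some w -> step c a w = Some v.
Proof.
rewrite /step => pc ak; case E1: (edge_at c a v) => [f|//] /= [<-].
have [fv cf] := edge_atP E1.
by rewrite (edge_at_some pc ak (other_star fv) cf) /= otherK.
Qed.

Lemma step_neq c a v w : step c a v = Some w -> w <> v.
Proof.
rewrite /step; case E1: (edge_at c a v) => [f|//] /= [<-].
by have [fv _] := edge_atP E1; apply/eqP/other_neq.
Qed.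

Lemma stepN c a v : step c a v = None <-> miss c v a.
Proof. by rewrite -edge_atN /step; case: edge_at. Qed.

(** * Alternating walks in a proper coloring *)

Section Walks.
Variables (c : E -> nat) (pc : proper_coloring c).

Lemma walk_rev a b n v w : a < k -> b < k -> walk c a b n v = Some w ->
  walk c (alt a b n.-1) (alt a b n) n w = Some v.
Proof.
move=> ak bk; elim: n w => [w [->]//|n IH w].
rewrite walkSr; case E1: walk => [u|//] /= E2.
rewrite (step_sym pc (alt_lt _ ak bk) E2) /=.
by case: n IH E1 E2 => [|n] IH E1 E2; [case: E1 => ->|rewrite altSS; apply: IH].
Qed.

(** As [b] is missing at [v], the component of [v] in the colors [a] and [b] is a path with end [v],
    not a cycle, so no vertex is visited twice. *)
Lemma walk_inj a b n m v w : a < k -> b < k -> miss c v b ->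
  walk c a b n v = Some w -> walk c a b m v = Some w -> n = m.
Proof.
move=> ak bk mb; wlog nm : n m / n <= m.
  move=> W; case/orP: (leq_total n m) => nm H1 H2; first exact: W.
  by apply/esym; apply: W.
have altk i : alt a b i < k by apply: alt_lt.
have [l] := ubnP m; elim: l n m nm w => // l IH n m nm w nml.
rewrite leq_eqVlt in nm; case/orP: nm => [/eqP //|nm].
case: m nm nml => // m nm nml E1 E2; exfalso.
have := E2; rewrite walkSr; case E3: walk => [u|//] /= E4.
(* The return to [w] uses either the color of the earlier arrival, so that the two predecessors
   coincide (at the start this color would be [b]), or the color of the earlier departure, so that
   the vertex after the first visit repeats before the second. *)
have [par|par] := boolP (odd (m - n)).
  have am : alt a b n = alt a b m.+1 by rewrite /alt; congr (if _ then _ else _); lia.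
  case: n nm nml E1 par am => [|n] nm nml E1 par am.
    case: E1 E4 => <- /(step_sym pc (altk _)).
    rewrite (_ : alt a b m = b); last by rewrite /alt; case: ifP => //; lia.
    by move/stepN: mb => ->.
  have := E1; rewrite walkSr; case E5: walk => [u'|//] /= E6.
  have am' : alt a b n = alt a b m by rewrite /alt; congr (if _ then _ else _); lia.
  have uu : u' = u.
    have := step_sym pc (altk _) E4; rewrite -am' (step_sym pc (altk _) E6).
    by case.
  have : n = m; last by lia.
  by apply: (IH n m _ u); rewrite ?E3 ?E5 ?uu //; lia.
have am : alt a b n = alt a b m by rewrite /alt; congr (if _ then _ else _); lia.
have E5 : walk c a b n.+1 v = Some u.
  by rewrite walkSr E1 /= am; apply: step_sym E4.
have [nm1|nm1] := ltnP n m.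
  by have := IH n.+1 m _ u _ E5 E3; lia.
have nm2 : n = m by lia.
by move: E3 E4; rewrite -nm2 E1 => -[<-] /step_neq.
Qed.

Lemma dead_uniq a b n m v w w' : walk c a b n v = Some w ->
  walk c a b m v = Some w' -> walk c a b n.+1 v = None ->
  walk c a b m.+1 v = None -> w = w'.
Proof.
move=> E1 E2 E3 E4; suff nm : n = m by move: E1 E2; rewrite nm => -> [].
apply/eqP; rewrite eqn_leq; apply/andP; split; rewrite leqNgt; apply/negP => lt.
  by have [u] := walk_prefix E1 lt; rewrite E4.
by have [u] := walk_prefix E2 lt; rewrite E3.
Qed.

Lemma walk_rev_dead a b n v w : a < k -> b < k -> miss c v b ->
  walk c a b n v = Some w ->
  walk c (alt a b n.-1) (alt a b n) n.+1 w = None \/ n = 0.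
Proof.
move=> ak bk mb; case: n => [|n E1]; first by right.
left; rewrite walkSr (walk_rev ak bk E1) /=.
rewrite /= alt_alt addnS altS (_ : alt b a _ = b); first by apply/stepN.
by rewrite /alt addnn odd_double.
Qed.

(** A walk that starts where [b] is missing starts at an end of its path, so its reversal from [v]
    must stop there. For each ordered pair of colors the walk from [v] has at most one last vertex;
    this gives a bound independent of [n]. *)
Lemma ends_finite v : exists2 s : seq V, size s <= k * k &
  forall y a b n, a < k -> b < k -> miss c y b -> walk c a b n y = Some v -> y \in s.
Proof.
pose P a b y := exists2 n, walk c a b n v = Some y & walk c a b n.+1 v = None.
have Pu a b y y' : P a b y -> P a b y' -> y = y'.
  by move=> [n E1 E2] [m E3 E4]; apply: dead_uniq E1 E3 E2 E4.
pose F ab := if pselect (exists y, P ab.1 ab.2 y) is left H then Some (projT1 (cid H)) else None.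
exists (pmap F [seq (a, b) | a <- iota 0 k, b <- iota 0 k]).
  by rewrite size_pmap (leq_trans (count_size _ _)) ?size_allpairs ?size_iota.
move=> y a b n ak bk mb E1.
have [a' [b' [a'k b'k H]]] : exists a' b', [/\ a' < k, b' < k & P a' b' y].
  have [E2|n0] := walk_rev_dead ak bk mb E1.
    exists (alt a b n.-1), (alt a b n); split; try exact: alt_lt.
    by exists n => //; apply: walk_rev.
  (* A walk of length 0 has no last color to reverse; with the colors exchanged it is at its end at
     once, because [b] is missing. *)
  move: E1; rewrite n0 => -[yv]; exists b, a; split => //; exists 0; rewrite -?yv //=.
  by move/stepN: mb => ->.
rewrite mem_pmap; apply/mapP; exists (a', b').
  by apply/allpairsP; exists (a', b'); rewrite !mem_iota /=.
rewrite /F /=; case: pselect => [H'|[]]; last by exists y.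
by congr Some; apply: Pu H (projT2 (cid H')).
Qed.

(** Both starting points are ends of the same path, which has only two: the second is the first one
    or the far end of the walk from [z]. *)
Lemma walk_meet a b a' b' n m z y v : a < k -> b < k ->
  (a' = a /\ b' = b) \/ (a' = b /\ b' = a) ->
  miss c z b -> walk c a b n z = Some v ->
  miss c y b' -> walk c a' b' m y = Some v ->
  y = z \/ exists i, walk c a b i z = Some y.
Proof.
move=> ak bk ab mz Ez my Ey.
have a'k : a' < k by case: ab => -[-> _].
have b'k : b' < k by case: ab => -[_ ->].
case: m Ey => [[->]|m Ey]; first by right; exists n.
have [Er Dr] : walk c (alt a' b' m) (alt a' b' m.+1) m.+1 v = Some y /\
    walk c (alt a' b' m) (alt a' b' m.+1) m.+2 v = None.
  split; first exact: walk_rev a'k b'k Ey.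
  by case: (walk_rev_dead a'k b'k my Ey).
have ab' : (alt a' b' m = a /\ alt a' b' m.+1 = b) \/ (alt a' b' m = b /\ alt a' b' m.+1 = a).
  by case: (alt_or a' b' m) ab => -[-> ->] [] [-> ->]; auto.
case: n Ez => [[zv]|n Ez].
  case: ab' Er => -[-> ->] Er; first by right; exists m.+1; rewrite zv.
  by move: Er; rewrite -zv /=; move/stepN: mz => ->.
have [Fr Cr] : walk c (alt a b n) (alt a b n.+1) n.+1 v = Some z /\
    walk c (alt a b n) (alt a b n.+1) n.+2 v = None.
  split; first exact: walk_rev ak bk Ez.
  by case: (walk_rev_dead ak bk mz Ez).
have [[q1 q2]|[q1 q2]] : (alt a' b' m = alt a b n /\ alt a' b' m.+1 = alt a b n.+1) \/
    (alt a' b' m = alt a b n.+1 /\ alt a' b' m.+1 = alt a b n).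
  by case: (alt_or a b n) ab' => -[-> ->] [] [-> ->]; auto.
  left; move: Er Dr; rewrite q1 q2 => Er Dr; exact: dead_uniq Er Fr Dr Cr.
right; exists (n.+1 + m.+1); rewrite walkD Ez altSS -q1 -q2; exact: Er.
Qed.

End Walks.

(** Induction on the fan: the hole [g] takes the color of the next edge [h], which is missing at the
    far end of [g], and [h] becomes the hole; the last edge takes [ga]. *)
Lemma shift_fan u ga p g d : proper_coloring d -> k <= d g -> uniq (g :: p) ->
  {subset g :: p <= star u} ->
  path (fun f h => (d h < k) && miss d (other f u) (d h)) g p ->
  ga < k -> miss d u ga -> miss d (other (last g p) u) ga ->
  exists d', [/\ proper_coloring d', forall f, f \notin g :: p -> d' f = d f
    & forall f, f \in g :: p -> d' f < k].
Proof.
move=> + + + + + gak; elim: p g d => [|h p IH] g d pd dg.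
  move=> _ sub _ mu1 mz; exists (fun f => if f == g then ga else d f).
  have gu : g \in star u by apply: sub; rewrite mem_head.
  split; first last.
  - by move=> f; rewrite inE => ->.
  - by move=> f; rewrite inE => /negPf ->.
  have gm v : g \in star v -> miss d v ga.
    by move=> /(star_other gu)[] ->.
  move=> v f f' fv f'v; case: eqP => [fg|fg]; case: eqP => [f'g|f'g].
  - by rewrite fg f'g.
  - by move=> e1 _; move: fv; rewrite fg => /gm /missP /(_ _ f'v) [].
  - by move=> e1 _; move: f'v; rewrite f'g => /gm /missP /(_ _ fv) [].
  - exact: (pd v).
move=> /[dup] un /= /andP[]; rewrite inE negb_or => /andP[gh gp] /andP[hp up] sub.
move=> /andP[/andP[hk mh] pp] mu1 mz.
have gu : g \in star u by apply: sub; rewrite mem_head.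
have hu : h \in star u by apply: sub; rewrite !inE eqxx orbT.
pose d1 f := if f == g then d h else if f == h then k else d f.
have d1m v a : a < k -> miss d v a -> (g \in star v -> a != d h) -> miss d1 v a.
  move=> ak /missP m gv; apply/missP => f fv; rewrite /d1.
  case: eqP => [fg|_]; first by move=> e1; move: gv; rewrite -fg fv e1 eqxx => /(_ isT).
  case: eqP => [_|_]; [by move=> e1; rewrite e1 ltnn in ak|exact: m].
have hga : ga != d h by apply/eqP => e1; move/missP: mu1 => /(_ h hu); rewrite e1.
have pd1 : proper_coloring d1.
  have gm v f : g \in star v -> f \in star v -> d f = d h -> f = h.
    move=> /(star_other gu)[] -> fv e1; first by apply: (pd u); rewrite ?e1.
    by move/missP: mh => /(_ f fv).
  move=> v f f' fv f'v; rewrite /d1; case: eqP => [e1|fg].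
    case: eqP => [->//|f'g]; case: eqP => [e2|f'h]; first by move=> ->; rewrite ltnn.
    by move=> e2 _; case: f'h; apply: (gm v) => //; rewrite -?e1.
  case: (f =P h) => [e1|fh].
    case: eqP => [e2 ->|f'g]; first by rewrite ltnn.
    by case: eqP => [->//|f'h] -> ; rewrite ltnn.
  case: eqP => [e1 e2|f'g]; first by case: fh; apply: (gm v) => //; rewrite -e1.
  by case: eqP => [e1 ->|f'h]; [rewrite ltnn|exact: (pd v)].
have [||||||d' [pd' d'1 d'2]] // := IH h d1 pd1.
- by rewrite /d1 eqxx eq_sym (negPf gh).
- by rewrite /= hp.
- by move=> f fp; apply: sub; rewrite inE fp orbT.
- apply/(pathP h) => i ilt; have /andP[fk fm] := pathP h pp i ilt.
  have fp : nth h p i \in p by rewrite mem_nth.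
  have fu : nth h p i \in star u by apply: sub; rewrite !inE fp !orbT.
  have d1f : d1 (nth h p i) = d (nth h p i).
    rewrite /d1; case: eqP => [e1|_]; first by rewrite -e1 fp in gp.
    by case: eqP => // e1; rewrite -e1 fp in hp.
  rewrite d1f fk /=; apply: d1m => // _; apply/eqP => e1.
  by move: hp; rewrite -(pd u _ _ fu hu e1 fk) fp.
- by apply: d1m.
- by apply: d1m.
exists d'; split => // f.
  rewrite inE negb_or => /andP[fg fhp]; rewrite d'1 // /d1 (negPf fg).
  by move: fhp; rewrite inE negb_or => /andP[/negPf -> _].
rewrite inE => /orP[/eqP ->|fp]; last exact: d'2.
by rewrite d'1 /d1 ?eqxx // inE negb_or gh.
Qed.

(** * Exchanging colors along an initial segment of a path *)

Fixpoint trail c a b n v : seq E :=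
  if n is m.+1 then
    if edge_at c a v is Some f then f :: trail c b a m (other f v) else [::]
  else [::].

Definition next_edge c a b n v := obind (edge_at c (alt a b n)) (walk c a b n v).

Lemma size_trail c a b n v : size (trail c a b n v) <= n.
Proof.
elim: n a b v => //= n IH a b v; case: edge_at => //= f; exact: IH.
Qed.

Lemma trailP c a b n v f :
  f \in trail c a b n v <-> exists2 i, i < n & next_edge c a b i v = Some f.
Proof.
rewrite /next_edge; elim: n a b v => [|n IH] a b v /=; first by split=> // -[].
rewrite /step; case E1: edge_at => [g|] /=; last first.
  by split => // -[[|i] _] /=; rewrite ?E1 //= /step E1.
rewrite inE; split.
  case/orP => [/eqP ->|/IH[i ilt Ei]]; first by exists 0; rewrite //= E1.
  by exists i.+1; rewrite //= /step E1 /= altS.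
case=> -[|i] ilt /=; first by rewrite E1 => -[->]; rewrite eqxx.
rewrite /step E1 /= altS => Ei; apply/orP; right; apply/IH; by exists i.
Qed.

(* Exchanges the colors of the first [n] edges of the path and uncolors the next
   one, if there is one. *)
Definition flip c a b n v f :=
  if f \in trail c a b n v then (if c f == a then b else a)
  else if next_edge c a b n v == Some f then k else c f.

Section Flip.
Variables (c : E -> nat) (pc : proper_coloring c) (a b : nat) (ak : a < k) (bk : b < k).
Variables (z : V) (mz : miss c z b).

Lemma next_edgeP i f : next_edge c a b i z = Some f ->
  exists2 w, walk c a b i z = Some w &
    [/\ f \in star w, c f = alt a b i & walk c a b i.+1 z = Some (other f w)].
Proof.
rewrite /next_edge walkSr; case: walk => [w|//] /= E1; exists w => //.
by have [fw cf] := edge_atP E1; split => //; rewrite /step E1.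
Qed.

Lemma next_edge_walk i f u : next_edge c a b i z = Some f -> f \in star u ->
  walk c a b i z = Some u \/ walk c a b i.+1 z = Some u.
Proof.
by move=> /next_edgeP[w Ew [fw _ Ew']] /(star_other fw)[] ->; auto.
Qed.

Lemma trail_color n f : f \in trail c a b n z -> c f = a \/ c f = b.
Proof.
move=> /trailP[i _ /next_edgeP[w _ [_ -> _]]].
by case: (alt_or a b i) => -[-> _]; auto.
Qed.

(** The other edge of color [a] or [b] at an endpoint of [f] is the preceding or the following edge
    of the path, and the preceding one is exchanged too. At [z] there is no preceding edge, since
    [b] is missing. *)
Lemma trail_next n f g u : f \in trail c a b n z -> f \in star u ->
  g \in star u -> c g = a \/ c g = b -> c g <> c f ->
  g \in trail c a b n z \/ next_edge c a b n z = Some g.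
Proof.
move=> /trailP[i ilt Ei] fu gu cg cgf.
have [w Ew [fw cf Ew']] := next_edgeP Ei.
have {cgf}cg : c g = alt a b i.+1.
  by case: (alt_or a b i) cg cgf => -[e1 e2] [] ->; rewrite cf e1 e2.
have gk : c g < k by rewrite cg; apply: alt_lt.
have [uw|uw] := star_other fw fu; subst u.
  case: i ilt Ei Ew Ew' cf cg => [|i] ilt Ei Ew Ew' cf cg.
    by move: Ew gu => [<-] gu; move/missP: mz => /(_ g gu); rewrite cg.
  left; apply/trailP; exists i; first by lia.
  rewrite altSS in cg; rewrite /next_edge.
  have := Ew; rewrite walkSr; case: (walk c a b i z) => [w'|//] /= /(step_sym pc (alt_lt _ ak bk)).
  move=> E2; have : step c (alt a b i) w' = Some w by apply: step_sym E2 => //; apply: alt_lt.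
  rewrite /step; case E3: edge_at => [g'|//] /= [E4].
  have [g'w' cg'] := edge_atP E3; congr Some; apply: (pc (v := w)); rewrite ?cg' ?cg //.
  - by rewrite -E4; apply: other_star.
  - exact: alt_lt.
have Eg : next_edge c a b i.+1 z = Some g.
  rewrite /next_edge Ew' /=; apply: edge_at_some => //; exact: alt_lt.
move: ilt; rewrite leq_eqVlt => /orP[/eqP <-|ilt]; first by right.
by left; apply/trailP; exists i.+1.
Qed.

(** A conflict needs an exchanged edge next to an unexchanged one of color [a] or [b]; this only
    occurs where the exchange stops, and the edge there is uncolored. *)
Lemma flip_proper n : proper_coloring (flip c a b n z).
Proof.
have key v f g : f \in star v -> g \in star v -> f \in trail c a b n z ->
    g \notin trail c a b n z -> next_edge c a b n z <> Some g ->
    (if c f == a then b else a) = c g -> f = g.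
  move=> fv gv fT gT gn e1.
  have cg : c g = a \/ c g = b by rewrite -e1; case: ifP; auto.
  case: (eqVneq (c g) (c f)) => [e2|/eqP e2].
    apply: (pc fv gv) => //; by case: (trail_color fT) => ->.
  by case: (trail_next fT fv gv cg e2) => //; rewrite (negPf gT).
move=> v f g fv gv; rewrite /flip.
have [fT|fT] := boolP (f \in trail c a b n z);
  have [gT|gT] := boolP (g \in trail c a b n z).
- move=> e1 _; apply: (pc fv gv); last by case: (trail_color fT) => ->.
  move: e1; case: (trail_color fT) (trail_color gT) => -> [] ->; rewrite ?eqxx //.
  + by case: eqP => // _ ->.
  + by case: eqP => // _ ->.
- case: (next_edge _ _ _ _ _ =P Some g) => [_ ->|gn e1 _]; first by rewrite ltnn.
  exact: (key v).
- case: (next_edge _ _ _ _ _ =P Some f) => [_ ->|fn e1 _]; first by rewrite ltnn.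
  by apply/esym; apply: (key v) => //; apply/esym.
- case: (next_edge _ _ _ _ _ =P Some f) => [_ ->|fn]; first by rewrite ltnn.
  case: (next_edge _ _ _ _ _ =P Some g) => [_ ->|gn]; first by rewrite ltnn.
  exact: (pc fv gv).
Qed.

Lemma flip_off n f u : (forall i, walk c a b i z <> Some u) -> f \in star u ->
  flip c a b n z f = c f.
Proof.
move=> nw fu; rewrite /flip; case: ifPn => [/trailP[i _ /next_edge_walk]|_].
  by move=> /(_ _ fu)[] /nw.
by case: eqP => // /next_edge_walk /(_ fu)[] /nw.
Qed.

(** [b] was missing at [z], and the edge of color [a] at [z], if any, now has color [b], or is
    uncolored when [n] is 0. *)
Lemma flip_start n : miss (flip c a b n z) z a.
Proof.
apply/missP => f fz; rewrite /flip; case: ifPn => fT.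
  case: eqP => [ca ba|ca _]; first by move/missP: mz => /(_ f fz); rewrite ca ba.
  by case: (trail_color fT) => // cb; move/missP: mz => /(_ f fz).
case: eqP => [_ ka|fn ca]; first by move: ak; rewrite ka ltnn.
have Ef : next_edge c a b 0 z = Some f by apply: edge_at_some.
case: n fT fn => [//|m] /negP[]; apply/trailP; by exists 0.
Qed.

Lemma flip_miss n u q : miss c u q -> q < k ->
  (q = a \/ q = b -> forall i, walk c a b i z <> Some u) ->
  miss (flip c a b n z) u q.
Proof.
move=> mq qk nw; apply/missP => f fu.
case: (pselect (q = a \/ q = b)) => [/nw nq|nq].
  by rewrite (flip_off n nq fu); move/missP: mq; apply.
rewrite /flip; case: ifPn => fT; first by case: ifP => _ e1; case: nq; auto.
case: eqP => [_ e1|_]; first by rewrite e1 ltnn in qk.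
by move/missP: mq; apply.
Qed.

End Flip.

(** * Fans *)

Definition fan c u f h := [&& h \in star u, c h < k & miss c (other f u) (c h)].

Definition off_walk c a b z x := forall i, walk c a b i z <> Some x.

(** Guards the fan against an exchange: where the fan relies on [a] being missing at the far end of
    [f], that vertex must satisfy [Q], which will say that the exchanged path avoids it. *)
Definition fan_off c u (Q : V -> Prop) a f h := (c h == a) ==> `[< Q (other f u) >].

Lemma fan_star c u g p : g \in star u -> path (fan c u) g p ->
  {subset g :: p <= star u}.
Proof.
elim: p g => [|h p IH] g gu /=; first by move=> _ f; rewrite inE => /eqP ->.
move=> /andP[/andP[hu _] pp] f; rewrite inE => /orP[/eqP ->//|]; exact: IH.
Qed.

(** The exchange makes [a] missing at the last fan vertex as well as at [u], so the fan can be
    shifted. Only fan edges of color [b] need care, as no edge at [u] has color [a]. The hole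
    disappears if the path has at most [n] edges, and otherwise moves to its edge of index [n]. *)
Lemma move_hole c u g p a b n : proper_coloring c -> g \in star u -> k <= c g ->
  uniq (g :: p) -> path (fan c u) g p -> a < k -> b < k -> miss c u a ->
  miss c (other (last g p) u) b -> off_walk c a b (other (last g p) u) u ->
  path (fan_off c u (off_walk c a b (other (last g p) u)) b) g p ->
  exists d, [/\ proper_coloring d,
    forall f, f \notin g :: p -> d f = flip c a b n (other (last g p) u) f
    & forall f, f \in g :: p -> d f < k].
Proof.
move=> pc gu cg un pf ak bk mu1 mz nu po; set z := other _ _ in mz nu po *.
have sub := fan_star gu pf.
have su f : f \in star u -> flip c a b n z f = c f by exact: flip_off.
apply: (shift_fan (u := u) (ga := a)) => //.
- exact: flip_proper.
- by rewrite su.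
- apply/(pathP g) => i ilt.
  have /and3P[hu hk hm] := pathP g pf i ilt; have := pathP g po i ilt.
  move: (nth g p i) (nth g (g :: p) i) hu hk hm => h f hu hk hm.
  rewrite /fan_off su // hk => /implyP off /=.
  apply: flip_miss => // -[e1|/eqP /off /asboolP]; last by [].
  by move/missP: mu1 => /(_ h hu).
- apply/missP => f fu; rewrite su //; move/missP: mu1; exact.
- exact: flip_start.
Qed.

(** A path enters a vertex missing [q] by the other color and would have to leave it by [q], so it
    ends there. *)
Lemma arrive c a b n z w q : proper_coloring c -> a < k -> b < k ->
  walk c a b n.+1 z = Some w -> miss c w q -> q = a \/ q = b ->
  alt a b n.+1 = q /\ alt a b n <> q.
Proof.
move=> pc ak bk; rewrite walkSr; case: walk => [u|//] /= /(step_sym pc (alt_lt _ ak bk)) E1 mq.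
have nq : alt a b n <> q by move=> e1; move/stepN: mq; rewrite -e1 E1.
by case: (alt_or a b n) nq => -[-> ->] nq []; auto => e1; case: nq.
Qed.

(* [F] is a set of forbidden colors: it is empty for the fan at a hole, and consists
   of the two colors of the first path for the fan at the end of a first path. *)
Lemma vizing_fan c u g (F : seq nat) ga : proper_coloring c -> g \in star u ->
  k <= c g -> ga < k -> miss c u ga -> ga \notin F ->
  mu <= size [seq a <- free c (other g u) | a \notin F] ->
  exists p, [/\ uniq (g :: p), path (fan c u) g p, all (fun h => c h \notin F) p &
    (other (last g p) u <> other g u /\
       exists2 a, a \in F & a < k /\ miss c (other (last g p) u) a) \/
    exists a b, [/\ a < k /\ b < k, a \notin F /\ b \notin F,
      miss c u a /\ miss c (other (last g p) u) b,
      off_walk c a b (other (last g p) u) u &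
      path (fan_off c u (off_walk c a b (other (last g p) u)) b) g p]].
Proof.
move=> pc gu cg gak mga gaF szg.
pose e f h := fan c u f h && (c h \notin F).
have eF f p : path e f p -> path (fan c u) f p /\ all (fun h => c h \notin F) p.
  elim: p f => //= h p IH f /andP[/andP[-> ->] /IH[-> ->]] //.
(* All edges reachable from [g] by fans whose further edges avoid the colors in [F]; each is also
   reached by a fan without repetition. *)
pose T := [seq h <- star u | `[< exists2 p, path e g p & last g p = h >]].
have TP h : h \in T -> exists2 p, uniq (g :: p) & path e g p /\ last g p = h.
  rewrite mem_filter => /andP[/asboolP[p pp lp] hu].
  by case/shortenP: pp lp => p' pp' up' _ lp; exists p'.
have Tu h : h \in T -> h \in star u by rewrite mem_filter => /andP[].
have gT : g \in T by rewrite mem_filter gu andbT; apply/asboolP; exists [::].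
have Te h h' : h \in T -> e h h' -> h' \in T.
  move=> /TP[p _ [pp lp]] ehh'; have /andP[/and3P[h'u _ _] _] := ehh'.
  rewrite mem_filter h'u andbT; apply/asboolP; exists (rcons p h'); last by rewrite last_rcons.
  by rewrite rcons_path pp lp.
have [[h hT [hg [a aF am]]]|H1] := pselect (exists2 h, h \in T &
    other h u <> other g u /\ exists2 a, a \in F & a < k /\ miss c (other h u) a).
  have [p up [pp lp]] := TP h hT; have [pf pF] := eF _ _ pp.
  by exists p; split => //; left; rewrite lp; split => //; exists a.
(* A color missing at both ends of a fan edge needs no exchange: with both path colors equal to [a],
   the path is empty. *)
have [[h hT [a [ak aF] [mu1 mh]]]|H0] := pselect (exists2 h, h \in T &
    exists2 a, a < k /\ a \notin F & miss c u a /\ miss c (other h u) a).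
  have [p up [pp lp]] := TP h hT; have [pf pF] := eF _ _ pp.
  exists p; split => //; right; exists a, a; rewrite lp; split => //.
    move=> [|i] /=; first by move=> [] /eqP; apply/negP/other_neq/Tu.
    by move/stepN: mh => ->.
  apply: sub_path pf => f h' /and3P[h'u _ _]; apply/implyP => /eqP e1.
  by move/missP: mu1 => /(_ h' h'u).
have [[h hT [h' h'T [hh' [a [ak aF] [mh mh']]]]]|H2] := pselect (exists2 h, h \in T &
    exists2 h', h' \in T & other h u <> other h' u /\
    exists2 a, a < k /\ a \notin F & miss c (other h u) a /\ miss c (other h' u) a).
  (* For two fan vertices missing a common color [x], reached by fans [p] and [q] of
     minimal total length, the path from one of them does not return to [u]. *)
  pose P n := exists p q (x : nat), [/\ uniq (g :: p) /\ path e g p, uniq (g :: q) /\ path e g q,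
    other (last g p) u <> other (last g q) u,
    [/\ x < k, x \notin F, miss c (other (last g p) u) x & miss c (other (last g q) u) x]
    & size p + size q = n].
  have exP : exists n, `[< P n >].
    have [p up [pp lp]] := TP h hT; have [q uq [pq lq]] := TP h' h'T.
    by exists (size p + size q); apply/asboolP; exists p, q, a; rewrite lp lq.
  case: (ex_minnP exP) => n /asboolP[p0 [q0 [x0 H0pq]]] nmin.
  have {nmin}nmin p q (x : nat) : uniq (g :: p) -> path e g p -> uniq (g :: q) -> path e g q ->
      other (last g p) u <> other (last g q) u -> x < k -> x \notin F ->
      miss c (other (last g p) u) x -> miss c (other (last g q) u) x ->
      n <= size p + size q.
    by move=> *; apply: nmin; apply/asboolP; exists p, q, x.
  (* The order by length matters: replacing the longer fan [p] by a proper prefix of [q] must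
     decrease the total length. *)
  have [p [q [x [[[up pp] [uq pq] pqn [xk xF mp mq] sn] qp]]]] :
      exists p q (x : nat), [/\ uniq (g :: p) /\ path e g p, uniq (g :: q) /\ path e g q,
      other (last g p) u <> other (last g q) u,
      [/\ x < k, x \notin F, miss c (other (last g p) u) x & miss c (other (last g q) u) x]
      & size p + size q = n] /\ size q <= size p.
    case/orP: (leq_total (size q0) (size p0)) => sz; first by exists p0, q0, x0.
    exists q0, p0, x0; split => //; case: H0pq => ? ? n1 [? ? ? ?] sn.
    by split => //; rewrite 1?addnC // => /esym.
  have pre r i : uniq (g :: r) -> path e g r -> i < size r ->
      [/\ uniq (g :: take i r), path e g (take i r), last g (take i r) = nth g (g :: r) i,
        size (take i r) = i & nth g (g :: r) i \in T].
    move=> ur pr ir.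
    have pt : path e g (take i r) by apply: take_path.
    have lt : last g (take i r) = nth g (g :: r) i.
      by rewrite (last_nth g) size_take ir; case: i ir {pt} => //= i ir; rewrite nth_take.
    have ut : uniq (g :: take i r).
      move: ur => /= /andP[gr ur]; rewrite take_uniq // andbT.
      by apply: contra gr; apply: mem_take.
    split => //; first by rewrite size_take ir.
    have := fan_star gu (eF _ _ pt).1; rewrite mem_filter => -> //.
      by rewrite andbT; apply/asboolP; exists (take i r).
    by rewrite -lt mem_last.
  (* If the path from the end of [q] avoids [u], then [q] works: an edge of color [x] in [q] would
     follow a vertex missing [x], which gives a pair of fans of smaller total length. *)
  have [nq|] := pselect (off_walk c ga x (other (last g q) u) u).
    exists q; have [qf qF] := eF _ _ pq; split => //; right; exists ga, x; split => //.
    apply/(pathP g) => i ir; have /and3P[_ _ hm] := pathP g qf i ir.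
    apply/implyP => /eqP e1; exfalso; move: hm; rewrite e1 => hm.
    have [ut pt lt st _] := pre q i uq pq ir.
    have [e2|e2] := pselect (other (last g p) u = other (nth g (g :: q) i) u).
      have := nmin (take i q) q x ut pt uq pq; rewrite lt -e2 => /(_ pqn xk xF mp mq).
      by rewrite st; move: ir sn qp; clear; lia.
    have := nmin p (take i q) x up pp ut pt; rewrite lt => /(_ e2 xk xF mp hm).
    by rewrite st; move: ir sn qp; clear; lia.
  move=> /existsNP[i /contrapT Ei].
  have uz r : r \in T -> other r u <> u by move=> rT; apply/eqP/other_neq/Tu.
  have rT r : uniq (g :: r) -> path e g r -> last g r \in T.
    move=> ur pr; rewrite mem_filter; apply/andP; split.
      by apply/asboolP; exists r.
    by apply: (fan_star gu (eF _ _ pr).1); exact: mem_last.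
  (* A path from [z] that reaches [u] ends there, since [ga] is missing at [u]. So [z] is the other
     end of the path from [u], which at most one vertex can be: if the path from the end of [q]
     reaches [u], the one from the end of [p] does not. *)
  have enduz z : miss c z x -> z <> u -> forall j, walk c ga x j z = Some u ->
      walk c x ga j u = Some z /\ walk c x ga j.+1 u = None.
    move=> mz zu [[]//|j] Ej; have [e1 e2] := arrive pc gak xk Ej mga (or_introl erefl).
    have e3 : alt ga x j = x by case: (alt_or ga x j) e1 e2 => -[-> ->].
    have := walk_rev pc gak xk Ej; have := walk_rev_dead pc gak xk mz Ej.
    by rewrite e1 /= e3; case.
  have [Er Dr] := enduz _ mq (uz _ (rT q uq pq)) _ Ei.
  exists p; have [pf pF] := eF _ _ pp; split => //; right; exists ga, x; split => //.
    move=> j Ej; have [Er' Dr'] := enduz _ mp (uz _ (rT p up pp)) _ Ej.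
    by apply: pqn; apply: dead_uniq Er' Er Dr' Dr.
  apply/(pathP g) => j jr; have /and3P[_ _ hm] := pathP g pf j jr.
  apply/implyP => /eqP e1; move: hm; rewrite e1 => hm.
  have [ut pt lt st _] := pre p j up pp jr.
  (* By minimality, a vertex preceding an edge of color [x] in [p] is the end of [q]. Its path has
     [u] as its other end, so the path from the end of [p] is a different one and avoids it. *)
  have [e2|e2] := pselect (other (nth g (g :: p) j) u = other (last g q) u); last first.
    have := nmin (take j p) q x ut pt uq pq; rewrite lt => /(_ e2 xk xF hm mq).
    by rewrite st; move: jr sn qp; clear; lia.
  apply/asboolP; rewrite e2 => -[|l] El; first by case: El.
  have [a1 a2] := arrive pc gak xk El mq (or_intror erefl).
  have a3 : alt ga x l = ga by case: (alt_or ga x l) a1 a2 => -[-> ->].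
  have := walk_rev pc gak xk El; have := walk_rev_dead pc gak xk mp El.
  rewrite a1 -pred_Sn a3 => -[Dl|//] El'.
  case: i Ei Er Dr => [[] /(uz _ (rT q uq pq))//|i] Ei Er Dr.
  have [b1 b2] := arrive pc gak xk Ei mga (or_introl erefl).
  have Di : walk c ga x i.+2 (other (last g q) u) = None.
    by rewrite walkSr Ei /= b1; apply/stepN.
  apply: (uz _ (rT p up pp)); exact: dead_uniq El' Ei Dl Di.
(* Otherwise the missing colors at the fan vertices [Y] are distinct, so that there
   are at least [mu * size Y] of them, each on a fan edge other than [g]; but there
   are at most [mu * size Y] fan edges. *)
exfalso.
pose MF y := [seq a <- free c y | a \notin F].
pose Y := undup [seq other h u | h <- T].
have MFP y a : a \in MF y -> [/\ a < k, miss c y a & a \notin F].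
  by rewrite mem_filter mem_free => /andP[aF /andP[ak am]].
have YP y : y \in Y -> exists2 h, h \in T & y = other h u.
  by rewrite mem_undup => /mapP[h hT ->]; exists h.
have szMF y : y \in Y -> mu <= size (MF y).
  (* At a fan vertex other than the far end of [g] no color of [F] is missing, or the first
     alternative would have held. *)
  move=> /YP[h hT ->]; case: (eqVneq (other h u) (other g u)) => [->//|/eqP hg].
  rewrite (leq_trans (size_free c (other h u))) // /MF (@eq_in_filter _ _ predT) ?filter_predT //.
  move=> a; rewrite mem_free => /andP[ak am]; apply/negP => aF; apply: H1.
  by exists h => //; split => //; exists a.
have lo : \sum_(y <- Y) mu <= \sum_(y <- Y) \sum_(h <- T) (c h \in MF y).
  rewrite big_seq [leqRHS]big_seq; apply: leq_sum => y yY.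
  apply: leq_trans (szMF y yY) _.
  rewrite -big_mkcond /= sum1_count -size_filter -(size_map c); apply: uniq_leq_size.
    by rewrite !filter_uniq ?iota_uniq.
  move=> a aM; have [ak am aF] := MFP _ _ aM; have [h' h'T yh'] := YP _ yY.
  have /negP : ~ miss c u a.
    by move=> mua; apply: H0; exists h' => //; exists a => //; rewrite -yh'.
  rewrite negbK => /mapP[h hu ca]; rewrite ca; apply: map_f.
  rewrite mem_filter -ca aM; apply: (Te h') => //.
  by rewrite /e /fan hu -ca ak -yh' am.
have up : \sum_(y <- Y) \sum_(h <- T) (c h \in MF y) <= \sum_(h <- T) (h != g).
  rewrite exchange_big /=; rewrite big_seq [leqRHS]big_seq; apply: leq_sum => h hT.
  rewrite -big_mkcond /= sum1_count -size_filter; case: eqP => [->|_].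
    rewrite (@eq_in_filter _ _ pred0) ?filter_pred0 // => y _ /=.
    by apply/negP => /MFP[]; rewrite ltnNge cg.
  rewrite leqNgt; apply/negP => sz.
  have uY : uniq [seq y <- Y | c h \in MF y] by rewrite filter_uniq ?undup_uniq.
  case E1: [seq _ <- _ | _] sz uY => [//|y1 [//|y2 s']] _.
  rewrite /= inE negb_or => /andP[/andP[/eqP y12 _] _].
  have : y1 \in [seq y <- Y | c h \in MF y] by rewrite E1 mem_head.
  rewrite mem_filter => /andP[/MFP[ak m1 aF] /YP[h1 h1T e1]].
  have : y2 \in [seq y <- Y | c h \in MF y] by rewrite E1 !inE eqxx orbT.
  rewrite mem_filter => /andP[/MFP[_ m2 _] /YP[h2 h2T e2]].
  by apply: H2; exists h1 => //; exists h2 => //; rewrite -e1 -e2; split => //; exists (c h).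
have sT : size T <= \sum_(y <- Y) mu.
  rewrite big_const_seq count_predT iter_addn_0 mulnC; apply: size_fibers => y.
  apply: leq_trans (star_mult G u y); rewrite count_filter.
  by apply: sub_count => h /andP[].
have : \sum_(h <- T) (h != g) < size T.
  rewrite -big_mkcond /= sum1_count -(count_predC (fun h => h != g) T) -[ltnLHS]addn0 ltn_add2l.
  by rewrite -has_count; apply/hasP; exists g => //=; rewrite eqxx.
by rewrite ltnNge (leq_trans sT (leq_trans lo up)).
Qed.

Lemma flip_lt c a b n z f : a < k -> b < k ->
  c f < k -> next_edge c a b n z <> Some f -> flip c a b n z f < k.
Proof.
by move=> ak bk cf nf; rewrite /flip; case: ifP => _; [case: ifP|case: eqP].
Qed.

Lemma flip_trail c a b n z f : f \notin trail c a b n z ->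
  next_edge c a b n z <> Some f -> flip c a b n z f = c f.
Proof. by move=> /negPf fT nf; rewrite /flip fT; case: eqP. Qed.

Lemma flip_other c a b n z f (q : nat) : proper_coloring c -> a < k -> b < k ->
  q < k -> q <> a -> q <> b -> (flip c a b n z f == q) = (c f == q).
Proof.
move=> pc ak bk qk /eqP qa /eqP qb; rewrite /flip; case: ifPn => [fT|_].
  case: (trail_color fT) => ->; rewrite ?eqxx ![_ == q]eq_sym ?(negPf qa) ?(negPf qb) //.
  by case: ifP; rewrite ?(negPf qa) ?(negPf qb).
case: (next_edge _ _ _ _ _ =P Some f) => // /next_edgeP[w _ [_ -> _]].
rewrite [RHS]eq_sym [LHS]eq_sym (_ : q == k = false); last by apply/eqP => e1; rewrite e1 ltnn in qk.
by case: (alt_or a b n) => -[-> _]; rewrite ?(negPf qa) ?(negPf qb).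
Qed.

Lemma next_edge_inj c a b z n m f : proper_coloring c -> a < k -> b < k ->
  miss c z b -> next_edge c a b n z = Some f -> next_edge c a b m z = Some f -> n = m.
Proof.
move=> pc ak bk mz En Em.
have [v Ev [fv _ Ev']] := next_edgeP En; have [w Ew [fw _ Ew']] := next_edgeP Em.
have inj := walk_inj pc ak bk mz.
case: (next_edge_walk Em fv) => E1; first exact: inj Ev E1.
have nm := inj _ _ _ Ev E1.
case: (next_edge_walk En fw) => E2; first by apply/esym; exact: inj Ew E2.
have := inj _ _ _ Ew E2; lia.
Qed.

Lemma next_edge_some c a b i z w : walk c a b i.+1 z = Some w ->
  exists f, next_edge c a b i z = Some f.
Proof.
rewrite walkSr /next_edge; case: walk => [v|//] /=; rewrite /step.
by case: edge_at => [f|//] _; exists f.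
Qed.

Lemma next_edge_color c a b i z f : next_edge c a b i z = Some f -> c f = alt a b i.
Proof. by move=> /next_edgeP[w _ []]. Qed.

Lemma next_edge_star c a b i z f v : next_edge c a b i z = Some f ->
  walk c a b i z = Some v \/ walk c a b i.+1 z = Some v -> f \in star v.
Proof.
move=> /next_edgeP[w -> [fw _ ->]] [] [<-] //; exact: other_star.
Qed.

Lemma eq_walk c d a b z n :
  (forall i v, walk c a b i z = Some v ->
     edge_at d a v = edge_at c a v /\ edge_at d b v = edge_at c b v) ->
  walk d a b n z = walk c a b n z.
Proof.
move=> H; elim: n => // n IH; rewrite !walkSr IH.
case E1: (walk c a b n z) => [v|//] /=; rewrite /step.
by have [e1 e2] := H _ _ E1; case: (alt_or a b n) => -[-> _]; rewrite ?e1 ?e2.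
Qed.

Hypothesis mu_gt0 : 0 < mu.

Definition augments c e m := exists d s, [/\ proper_coloring d, d e < k,
  forall f, c f < k -> d f < k, size s <= m & forall f, f \notin s -> d f = c f].

(* The last hypothesis keeps the second path away from the fan at [x]. It also keeps
   it off the first path: the two paths either use disjoint pairs of colors or are
   different components of the same pair of colors. *)
Lemma second_fan c x e p a b t y u L : proper_coloring c -> e \in star x ->
  k <= c e -> uniq (e :: p) -> path (fan c x) e p -> a < k -> b < k ->
  miss c x a -> y = other (last e p) x -> miss c y b -> off_walk c a b y x ->
  path (fan_off c x (off_walk c a b y) b) e p ->
  0 < t -> walk c a b t y = Some u -> (exists v, walk c a b t.+2 y = Some v) ->
  (forall z r a b n, nbr u z -> r = x \/ nbr x r -> a < k -> b < k ->
     miss c z b -> walk c a b n z <> Some r) ->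
  augments c e (D + D + t + L) \/
  exists z a b v, [/\ nbr u z, a < k, b < k, miss c z b & walk c a b L z = Some v].
Proof.
move=> pc ex ce up pf ak bk mx yE my nyx po t0 Eu [w2 Ew2] good.
have pc_inj := walk_inj pc ak bk my.
have Su := fan_star ex pf.
have nxy : nbr x y by exists (last e p) => //; apply: Su; exact: mem_last.
have [w Ew] := walk_prefix Ew2 (leqnSn _).
have [g Eg] := next_edge_some Ew; have [h Eh] := next_edge_some Ew2.
(* Consecutive edges [g'], [g], [h] of the first path: [g'] and [g] meet at [u], [g] and [h] at [w].
   The exchange will stop just before [g], which becomes the new hole. *)
case: t => [//|t] in t0 Eu Ew2 Ew Eg Eh *.
have [g' Eg'] := next_edge_some Eu.
have g'u := next_edge_star Eg' (or_intror Eu).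
have gu := next_edge_star Eg (or_introl Eu).
have gw := next_edge_star Eg (or_intror Ew).
have hw := next_edge_star Eh (or_introl Ew).
have [[cg' cg] ch] := (next_edge_color Eg', next_edge_color Eg, next_edge_color Eh).
have wE : w = other g u.
  by have [v Ev [_ _]] := next_edgeP Eg; rewrite Ew; move: Ev; rewrite Eu => -[<-] [].
have altk i : alt a b i < k by exact: alt_lt.
have ab : a <> b.
  move=> e1; have [v Ev] := walk_prefix Eu (isT : 0 < t.+1).
  by move: Ev; rewrite /= e1; move/stepN: my => ->.
have altab i : alt a b i <> alt a b i.+1.
  by case: (alt_or a b i) => -[-> ->] // /esym.
have alt2 i (q : nat) : q = a \/ q = b -> q = alt a b i \/ q = alt a b i.+1.
  by case: (alt_or a b i) => -[-> ->] []; auto.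
have gT : g \notin trail c a b t.+1 y.
  apply/negP => /trailP[i ilt Ei].
  by rewrite (next_edge_inj pc ak bk my Eg Ei) ltnn in ilt.
have MH := move_hole t.+1 pc ex ce up pf ak bk mx; rewrite -yE in MH.
have {MH}[c1 [pc1 c1off c1on]] := MH my nyx po.
(* Edges of the first fan join [x] to its neighbors, so at a far vertex only the exchange changes
   colors. *)
pose far v := v <> x /\ ~ nbr x v.
have farS v f : far v -> f \in star v -> f \notin e :: p.
  move=> [vx nv] fv; apply/negP => /Su fx; case: (star_other fx fv) => // vE.
  by apply: nv; exists f.
have c1far v f : far v -> f \in star v -> c1 f = flip c a b t.+1 y f.
  by move=> fv fs; apply: c1off; exact: farS fs.
have someb z : exists2 q, q < k & miss c z q.
  have := size_free c z; case E1: (free c z) => [|q l]; first by rewrite leqNgt mu_gt0.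
  move=> _; have : q \in free c z by rewrite E1 mem_head.
  by rewrite mem_free => /andP[]; exists q.
have nux : ~ nbr u x.
  by move=> nx; apply: (good x x a a 0) => //; left.
have faru : far u.
  split=> [ux|/nbr_sym //]; by apply: (nyx t.+1); rewrite Eu ux.
have farz z : nbr u z -> far z.
  move=> nz; split=> [zx|xz]; first by rewrite zx in nz.
  by have [q qk mq] := someb z; apply: (good z z q q 0) => //; right.
have near_y : ~ far y by case.
have farw z q r n v : nbr u z -> q < k -> r < k -> miss c z r ->
    walk c q r n z = Some v -> far v.
  move=> nz qk rk mr Ev; split=> [vx|nv].
    by apply: (good z v q r n) => //; left.
  by apply: (good z v q r n) => //; right.
have c1q v f (q : nat) : far v -> f \in star v -> q < k -> q <> a -> q <> b ->
    (c1 f == q) = (c f == q).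
  by move=> fv fs *; rewrite (c1far v) //; apply: flip_other.
have c1m v (q : nat) : far v -> q < k -> q <> a -> q <> b -> miss c1 v q <-> miss c v q.
  move=> fv qk qa qb; split => /missP m; apply/missP => f fs /eqP.
    by rewrite -(c1q v) // => /eqP; apply: m.
  by rewrite (c1q v) // => /eqP; apply: m.
have c1g : k <= c1 g.
  by rewrite (c1far u) // /flip (negPf gT) Eg eqxx.
pose ka := alt a b t; pose la := alt a b t.+1.
have kala : ka <> la by exact: altab.
have mka : miss c1 u ka.
  apply/missP => f fu; rewrite (c1far u) // /flip.
  case: ifPn => [fT|fT].
    have [->|cf _] := alt2 t _ (trail_color fT).
      by rewrite /ka; case: (alt_or a b t) => -[-> _]; [rewrite eqxx => /esym|case: eqP => // /esym].
    suff fg : f = g by move: gT; rewrite -fg fT.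
    by apply: (pc u f g fu gu); rewrite cf ?cg //; exact: altk.
  rewrite Eg; case: eqP => [_ e1|_ cf]; first by have := altk t; rewrite -/ka -e1 ltnn.
  have fg' : f = g' by apply: (pc u f g' fu g'u); rewrite cf ?cg' //; exact: altk.
  by case/negP: fT; rewrite fg'; apply/trailP; exists t.
have present v (q r : nat) f f' : f \in star v -> f' \in star v -> c f = alt a b q ->
    c f' = alt a b q.+1 -> r < k -> miss c v r -> r <> a /\ r <> b.
  move=> fv f'v cf cf' rk /missP m.
  suff no : ~ (r = a \/ r = b) by split=> ra; apply: no; auto.
  by move=> /(alt2 q)[] e1; [apply: (m f)|apply: (m f')]; rewrite ?cf ?cf'.
have [ga gak mga] := someb u.
have [ga1 ga2] := present u t ga g' g g'u gu cg' cg gak mga.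
have nuw : nbr u w by exists g.
(* Under [c], both path colors are present at [w], on [g] and on [h], so all [mu] missing colors lie
   outside the forbidden set. This is why the path has to continue past [w]. *)
have szw : mu <= size [seq q <- free c1 (other g u) | q \notin [:: a; b]].
  rewrite -wE; apply: leq_trans (size_free c w) _; apply: uniq_leq_size.
    by rewrite filter_uniq ?iota_uniq.
  move=> q; rewrite mem_free => /andP[qk mq].
  have [q1 q2] := present w t.+1 q g h gw hw cg ch qk mq.
  rewrite mem_filter mem_free qk !inE negb_or; apply/and3P; split => //.
    by apply/andP; split; apply/eqP.
  by apply/c1m => //; apply: farz.
have gaF : ga \notin [:: a; b].
  by rewrite !inE negb_or; apply/andP; split; apply/eqP.
have mga1 : miss c1 u ga by apply/c1m.
have [p' [up' pf' pF' AB]] := vizing_fan pc1 gu c1g gak mga1 gaF szw.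
set z := other (last g p') u in AB.
have nuz : nbr u z by exists (last g p') => //; apply: (fan_star gu pf'); exact: mem_last.
have farzz := farz z nuz.
have {AB}[a2 [b2 [[a2k b2k] [ma2 mb2] ow po2 [mb2c ew]]]] : exists a2 b2,
    [/\ a2 < k /\ b2 < k, miss c1 u a2 /\ miss c1 z b2, off_walk c1 a2 b2 z u,
    path (fan_off c1 u (off_walk c1 a2 b2 z) b2) g p' &
    miss c z b2 /\ forall i, walk c1 a2 b2 i z = walk c a2 b2 i z].
  case: AB => [[zw [q qF [qk mq]]]|[a2 [b2 [[a2k b2k] [a2F b2F] [ma2 mb2] ow po2]]]]; last first.
    move: a2F b2F; rewrite !inE !negb_or => /andP[/eqP a2a /eqP a2b] /andP[/eqP b2a /eqP b2b].
    have mb2c : miss c z b2 by exact: (c1m z b2 farzz b2k b2a b2b).1 mb2.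
    exists a2, b2; split => //; split => // i; apply: eq_walk => j v Ev.
    have fv := farw _ _ _ _ _ nuz a2k b2k mb2c Ev.
    by split; apply: eq_edge_at => f fs; apply: (c1q v).
  (* A forbidden color [q] is missing at [z]. It is paired with [ka], which the exchange has freed
     at [u], so that both colors are those of the first path. *)
  have {}qF : q = a \/ q = b by move: qF; rewrite !inE => /orP[/eqP|/eqP]; auto.
  (* [z] is none of these vertices: [y] is too close to [x], the inner vertices of the exchanged
     part still carry both colors, [u] is not its own neighbor, and [z] differs from [w]. *)
  have offP i : i <= t.+2 -> walk c a b i y <> Some z.
    move=> it Ei; case: i it Ei => [|i] it Ei; first by case: Ei => yz; rewrite -yz in farzz.
    have [i1|i1] := ltnP i t.
      have [f Ef] := next_edge_some Ei.
      have it2 : i.+2 <= t.+2 by rewrite !ltnS ltnW.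
      have [v' Ev'] := walk_prefix Ew it2.
      have [f' Ef'] := next_edge_some Ev'.
      have swap j h' : next_edge c a b j y = Some h' -> j < t.+1 ->
          flip c a b t.+1 y h' = alt a b j.+1.
        move=> Ej jt; rewrite /flip ifT; last by apply/trailP; exists j.
        rewrite (next_edge_color Ej); case: (alt_or a b j) => -[-> ->]; first by rewrite eqxx.
        by case: eqP => // /esym.
      have fz := next_edge_star Ef (or_intror Ei); have f'z := next_edge_star Ef' (or_introl Ei).
      move/missP: mq => mq.
      have [q1|q1] := alt2 i q qF.
        by apply: (mq f' f'z); rewrite (c1far z) // (swap i.+1) // altSS.
      by apply: (mq f fz); rewrite (c1far z) // (swap i) // ltnS ltnW.
    have [i2|i2] : i = t \/ i = t.+1 by move: it i1; clear; lia.
      move: Ei Eu; rewrite i2 => -> [zu]; move: nuz; rewrite zu => -[f fu].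
      by apply/eqP/other_neq.
    by move: Ei Ew; rewrite i2 wE => -> [].
  have c1z v f : (forall i, i <= t.+2 -> walk c a b i y <> Some v) -> far v ->
      f \in star v -> c1 f = c f.
    move=> nv fv fs; rewrite (c1far v) // flip_trail //.
      apply/negP => /trailP[i ilt /next_edge_walk /(_ fs)[]]; apply: nv; move: ilt; clear; lia.
    by move=> /next_edge_walk /(_ fs)[]; apply: nv.
  have mqc : miss c z q.
    by apply/missP => f fz; rewrite -(c1z z) //; move/missP: mq; apply.
  have kak : ka < k by exact: altk.
  (* By [walk_meet], a path from [z] that meets the first path would start at or reach [y], which is
     next to [x]; [good] excludes this. *)
  have offw i v : walk c ka q i z = Some v -> forall j, j <= t.+2 -> walk c a b j y <> Some v.
    move=> Ei j jt Ej; have [qka|qla] := alt2 t q qF.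
      case: i Ei => [[zv]|i /=]; first by apply: (offP j) => //; rewrite Ej zv.
      by move: mqc; rewrite qka -/ka => /stepN ->.
    have kq : (a = ka /\ b = q) \/ (a = q /\ b = ka).
      by rewrite qla /ka; case: (alt_or a b t) => -[-> ->]; auto.
    have [yz|[l El]] := walk_meet pc kak qk kq mqc Ei my Ej.
      by rewrite -yz in farzz.
    by apply: near_y; apply: farw El.
  have ew i : walk c1 ka q i z = walk c ka q i z.
    apply: eq_walk => j v Ev.
    have fv := farw _ _ _ _ _ nuz kak qk mqc Ev.
    by split; apply: eq_edge_at => f fs; rewrite (c1z v) //; apply: offw Ev.
  exists ka, q; split => //.
    by move=> i; rewrite ew => /offw /(_ t.+1 (leqnSn _)).
  apply/(pathP g) => i ilt; apply/implyP => /eqP cq.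
  by move/allP: pF' => /(_ _ (mem_nth g ilt)); rewrite cq !inE; case: qF => ->; rewrite eqxx ?orbT.
have [dead|[v Ev]] : walk c a2 b2 L z = None \/ exists v, walk c a2 b2 L z = Some v.
  by case: walk => [v|]; [right; exists v|left].
  left.
  have [d [pd doff don]] := move_hole L pc1 gu c1g up' pf' a2k b2k ma2 mb2 ow po2.
  have nL : next_edge c1 a2 b2 L z = None by rewrite /next_edge ew dead.
  have dlt f : f = g \/ c1 f < k -> d f < k.
    have [fp|fp] := boolP (f \in g :: p'); first by move=> _; exact: don.
    case=> [fg|cf]; first by move: fp; rewrite fg mem_head.
    by rewrite doff //; apply: flip_lt => //; rewrite nL.
  exists d, ((e :: p) ++ trail c a b t.+1 y ++ (g :: p') ++ trail c1 a2 b2 L z); split => //.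
  - by apply: dlt; right; apply: c1on; rewrite mem_head.
  - move=> f cf; apply: dlt; case: (eqVneq f g) => [|/eqP fg]; [by left|right].
    have [fp|fp] := boolP (f \in e :: p); first exact: c1on.
    by rewrite c1off //; apply: flip_lt => //; rewrite Eg => -[] /esym.
  - rewrite !size_cat.
    have s1 : size (e :: p) <= D by apply: leq_trans (star_size G x); exact: uniq_leq_size.
    have s2 : size (g :: p') <= D.
      by apply: leq_trans (star_size G u); exact: uniq_leq_size up' (fan_star gu pf').
    rewrite (_ : D + D + t.+1 + L = D + (t.+1 + (D + L))); last by clear; lia.
    by rewrite !leq_add // size_trail.
  - move=> f; rewrite mem_cat negb_or => /andP[f1]; rewrite mem_cat negb_or => /andP[f2].
    rewrite mem_cat negb_or => /andP[f3 f4].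
    rewrite doff // flip_trail ?nL // c1off // flip_trail // Eg => -[gf].
    by move: f3; rewrite gf mem_head.
by right; exists z, a2, b2, v.
Qed.

(** * Tracing a hole back from the edges it reaches *)

Definition alt_path c L y u := exists a b n,
  [/\ a < k, b < k, n <= L, miss c y b & walk c a b n y = Some u].

Definition incident e x := e \in star x.

(* Contains all pairs of a hole [e] and an edge [f] that a two-step chain started at
   [e] may reach. Fans are not mentioned: only the ends of the two alternating paths
   matter for tracing [e] back from [f]. *)
Definition linked c L : E -> E -> Prop :=
  rcomp incident (rcomp nbr (rcomp (alt_path c L)
    (rcomp nbr (rcomp (alt_path c L) (fun x f => incident f x))))).

Lemma bounded_incident : bounded_preim D incident.
Proof. by move=> x; exists (star x) => //; exact: star_size. Qed.

Lemma bounded_endpoint : bounded_preim 2 (fun x f => incident f x).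
Proof.
move=> f; exists [:: p1 f; p2 f] => // x /(star_end G)[] ->; rewrite !inE eqxx ?orbT //.
Qed.

Lemma bounded_nbr : bounded_preim D nbr.
Proof.
move=> y; exists [seq other f y | f <- star y]; first by rewrite size_map star_size.
by move=> x /nbr_sym /nbrP.
Qed.

Lemma bounded_alt_path c L : proper_coloring c -> bounded_preim (k * k) (alt_path c L).
Proof.
move=> pc u; have [s sk H] := ends_finite pc u; exists s => // y [a [b [n [ak bk _ my E1]]]].
exact: H E1.
Qed.

(** One factor per relation in [linked]; the last one counts the endpoints of an edge. The length
    [L] does not enter. *)
Definition multiplicity_bound := D * (D * (k * k * (D * (k * k * 2)))).

Lemma bounded_linked c L : proper_coloring c -> bounded_preim multiplicity_bound (linked c L).
Proof.
move=> pc; apply: (bounded_preim_comp bounded_incident).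
apply: (bounded_preim_comp bounded_nbr); apply: (bounded_preim_comp (bounded_alt_path L pc)).
apply: (bounded_preim_comp bounded_nbr); apply: (bounded_preim_comp (bounded_alt_path L pc)).
exact: bounded_endpoint.
Qed.

(** All but boundedly many of the first [L.-1] places on the first path yield a second path with [L]
    edges, and an edge lies on boundedly many of these: order [L ^ 2] linked edges. *)
Lemma augment_or_linked c e L : proper_coloring c -> e \in star (p1 e) -> k <= c e ->
  augments c e (D + D + L + L).+1 \/
  exists s, [/\ uniq s, forall f, f \in s -> linked c L e f
    & (L.-1 - D * (k * k * D.+1)) * L <= size s * (D * (k * k * 2))].
Proof.
set x := p1 e => pc ex ce.
have : 0 < size (free c x) by apply: leq_trans mu_gt0 (size_free c x).
case E1: (free c x) => [//|ga l] _.
have : ga \in free c x by rewrite E1 mem_head.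
rewrite mem_free => /andP[gak mga] {E1 l}.
have szx : mu <= size [seq q <- free c (other e x) | q \notin [::]].
  by rewrite (@eq_filter _ _ predT) // filter_predT size_free.
have [p [up pf _ [[_ [?]]//|[a [b [[ak bk] _ [mx my] nyx po]]]]]] :=
  @vizing_fan c x e [::] ga pc ex ce gak mga isT szx.
have {ga gak mga szx}Su := fan_star ex pf.
set y := other (last e p) x in my nyx po.
have nxy : nbr x y by exists (last e p) => //; apply: Su; exact: mem_last.
case Ey: (walk c a b L.+1 y) => [v|]; last first.
  left; have [d [pd doff don]] := move_hole L.+1 pc ex ce up pf ak bk mx my nyx po.
  have nL : next_edge c a b L.+1 y = None by rewrite /next_edge Ey.
  exists d, ((e :: p) ++ trail c a b L.+1 y); split => //.
  - by apply: don; rewrite mem_head.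
  - move=> f cf; have [fp|fp] := boolP (f \in e :: p); first exact: don.
    by rewrite doff // flip_lt // nL.
  - rewrite size_cat; have s1 : size (e :: p) <= D.
      exact: leq_trans (uniq_leq_size up Su) (star_size G x).
    by apply: leq_trans (leq_add s1 (size_trail _ _ _ _ _)) _; clear; lia.
  - move=> f; rewrite mem_cat negb_or => /andP[f1 f2].
    by rewrite doff // flip_trail ?nL.
pose w t := odflt x (walk c a b t y).
have wE t : t <= L.+1 -> walk c a b t y = Some (w t).
  by move=> tL; have [u Eu] := walk_prefix Ey tL; rewrite /w Eu.
have w_inj t t' : t <= L.+1 -> t' <= L.+1 -> w t = w t' -> t = t'.
  move=> /wE Et /wE Et' wt; apply: (walk_inj pc ak bk my Et); by rewrite Et' wt.
pose near r x' := x' = r \/ nbr x' r.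
(* The vertices [u] to discard: some path from a neighbor of [u] reaches [x] or a neighbor of [x].
   Read backwards from [x], this gives the factors [D.+1], [k * k] and [D]. *)
have [B szB BP] : exists2 B : seq V, size B <= D * (k * k * D.+1) &
    forall u, rcomp nbr (rcomp (fun z r => exists n, alt_path c n z r) (fun r x' => near r x')) u x -> u \in B.
  apply: (bounded_preim_comp bounded_nbr (bounded_preim_comp _ _)).
    move=> u; have [s sk H] := ends_finite pc u.
    exists s => // z [_ [a' [b' [n [a'k b'k _ mz E1]]]]]; exact: H E1.
  move=> x'; exists (x' :: [seq other f x' | f <- star x']).
    by rewrite /= size_map ltnS star_size.
  by move=> r [->|/nbrP]; rewrite inE ?eqxx // => ->; rewrite orbT.
(* A cut at [t] requires the first path to reach step [t.+2], which is at most [L.+1]; hence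
   [t < L]. *)
pose ts := [seq t <- iota 1 L.-1 | w t \notin B].
have tsP t : t \in ts -> [/\ 0 < t, t < L & w t \notin B].
  rewrite mem_filter mem_iota => /and3P[wB t0 tL]; split => //; move: t0 tL; clear; lia.
have sz_ts : L.-1 - D * (k * k * D.+1) <= size ts.
  rewrite leq_subLR; apply: leq_trans (leq_add szB (leqnn _)).
  rewrite -[leqLHS](size_iota 1) -(count_predC (fun t => w t \notin B) (iota 1 L.-1)).
  rewrite addnC -(size_filter (fun t => w t \notin B)) leq_add2r -size_filter -(size_map w).
  apply: uniq_leq_size; last first.
    by move=> u /mapP[t]; rewrite mem_filter /= negbK => /andP[wB _] ->.
  rewrite map_inj_in_uniq ?filter_uniq ?iota_uniq // => t t'.
  by rewrite !mem_filter !mem_iota => /and3P[_ _ tL] /and3P[_ _ t'L]; apply: w_inj; move: tL t'L; clear; lia.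
have uts : uniq ts by rewrite filter_uniq ?iota_uniq.
have [|noaug] := pselect (augments c e (D + D + L + L).+1); [by left|right].
have /choice [Z ZP] : forall t, exists zab : V * nat * nat, t \in ts ->
    [/\ nbr (w t) zab.1.1, zab.1.2 < k, zab.2 < k, miss c zab.1.1 zab.2 &
      exists v, walk c zab.1.2 zab.2 L zab.1.1 = Some v].
  move=> t; have [|] := boolP (t \in ts); last by exists (x, 0, 0).
  move=> /tsP[t0 tL wB].
  have tL1 : t <= L.+1 by move: tL; clear; lia.
  have t2 : exists v, walk c a b t.+2 y = Some v by apply: walk_prefix Ey _; rewrite ltnS.
  have good z r a' b' n : nbr (w t) z -> r = x \/ nbr x r -> a' < k -> b' < k ->
      miss c z b' -> walk c a' b' n z <> Some r.
    move=> nz nr a'k b'k mz En; move/negP: wB; apply; apply: BP.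
    exists z => //; exists r; first by exists n, a', b', n.
    by case: nr => [->|nr]; [left|right].
  have [|[z [a' [b' [v' [nz a'k b'k mz Ez]]]]]] := second_fan L pc ex ce up pf ak bk mx
      (erefl y) my nyx po t0 (wE t tL1) t2 good; last first.
    by exists (z, a', b') => _; split => //; exists v'.
  move=> [d [s [pd de cd sz ds]]]; case: noaug; exists d, s; split => //.
  by apply: leq_trans sz _; move: tL; clear; lia.
pose ed (tn : nat * nat) := odflt e (next_edge c (Z tn.1).1.2 (Z tn.1).2 tn.2 (Z tn.1).1.1).
pose s0 := [seq (t, n) | t <- ts, n <- iota 0 L].
have s0P tn : tn \in s0 -> tn.1 \in ts /\ tn.2 < L.
  by move=> /allpairsP[[t n] /= [tts]]; rewrite mem_iota => /= nL ->.
have s0E tn : tn \in s0 ->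
    next_edge c (Z tn.1).1.2 (Z tn.1).2 tn.2 (Z tn.1).1.1 = Some (ed tn).
  move=> /s0P[/ZP[_ _ _ _ [v' Ev']] nL].
  have [w' /next_edge_some[f Ef]] := walk_prefix Ev' nL.
  by rewrite /ed Ef.
have rel1 tn : tn \in s0 ->
    rcomp nbr (rcomp (alt_path c L) (fun x f => incident f x)) (w tn.1) (ed tn).
  move=> /[dup] /s0E /next_edgeP[v' Ev' [fv' _ _]] /s0P[/ZP[nz ak' bk' mz _] nL].
  exists (Z tn.1).1.1 => //; exists v' => //; exists (Z tn.1).1.2, (Z tn.1).2, tn.2.
  by split => //; exact: ltnW.
exists (undup (map ed s0)); split; first exact: undup_uniq.
  move=> f; rewrite mem_undup => /mapP[tn tns ->].
  have [/tsP[t0 tL _] _] := s0P _ tns.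
  exists x => //; exists y => //; exists (w tn.1); last exact: rel1.
  exists a, b, tn.1; split => //; first exact: ltnW.
  by apply: wE; move: tL; clear; lia.
apply: leq_trans (size_fibers (m := D * (k * k * 2)) (F := ed) _).
  by rewrite size_allpairs size_iota leq_mul2r sz_ts orbT.
(* An edge has 2 endpoints, each reached from at most [k * k] starting points, with at most [D]
   neighbors [w t] each; and [t] determines the path, hence the index of [f] on it. *)
move=> f.
have [U szU UP] := bounded_preim_comp bounded_nbr
  (bounded_preim_comp (bounded_alt_path L pc) bounded_endpoint) f.
apply: leq_trans szU; rewrite -size_filter -(size_map (fun tn => w tn.1)).
apply: uniq_leq_size; last first.
  move=> u /mapP[tn]; rewrite mem_filter => /andP[/eqP edf tns] ->; apply: UP; rewrite -edf; exact: rel1.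
rewrite map_inj_in_uniq; last first.
  move=> [t n] [t' n']; rewrite !mem_filter => /andP[/eqP e1 tns] /andP[/eqP e2 tns'] /= wt.
  have [/[dup] /tsP[_ tL _] tts _] := s0P _ tns; have [/tsP[_ t'L _] _] := s0P _ tns'.
  have tt' : t = t' by apply: w_inj wt; [move: tL|move: t'L]; clear; move=> /=; lia.
  move: (s0E _ tns) (s0E _ tns'); rewrite e1 e2 /= -tt' => E1 E2.
  have [_ ak' bk' mz _] := ZP t tts.
  by rewrite (next_edge_inj pc ak' bk' mz E1 E2).
rewrite filter_uniq // allpairs_uniq ?iota_uniq // => -[t n] [t' n'] _ _ /= [-> ->] //.
Qed.

End Multigraph.

(** * Borel relations with countable sections *)

Section MeasurableProp.
Local Open Scope classical_set_scope.
Context d (T : measurableType d).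
Implicit Types P Q : T -> Prop.

Lemma measurable_and P Q : measurable [set x | P x] -> measurable [set x | Q x] ->
  measurable [set x | P x /\ Q x].
Proof. by move=> mP mQ; exact: measurableI mP mQ. Qed.

Lemma measurable_not P : measurable [set x | P x] -> measurable [set x | ~ P x].
Proof. by move=> mP; exact: measurableC mP. Qed.

Lemma measurable_imp P Q : measurable [set x | P x] -> measurable [set x | Q x] ->
  measurable [set x | P x -> Q x].
Proof.
move=> mP mQ; rewrite (_ : [set _ | _] = [set x | ~ P x \/ Q x]).
  exact: measurableU (measurable_not mP) mQ.
apply/seteqP; split => x /=; last by case.
by have [Px H|] := pselect (P x); [right; exact: H|left].
Qed.

Lemma measurable_exists (I : countType) (P : I -> T -> Prop) :
  (forall i, measurable [set x | P i x]) -> measurable [set x | exists i, P i x].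
Proof.
move=> mP.
rewrite (_ : [set _ | _] =
  \bigcup_n [set x | if unpickle n is Some i then P i x else False]); last first.
  apply/seteqP; split => x /=.
    by move=> [i Pi]; exists (pickle i) => //=; rewrite pickleK.
  by move=> [n _] /=; case: unpickle => // i Pi; exists i.
apply: bigcupT_measurable => n; case: unpickle => [i|]; first exact: mP.
by rewrite (_ : [set _ | _] = set0) //.
Qed.

Lemma measurable_forall (I : countType) (P : I -> T -> Prop) :
  (forall i, measurable [set x | P i x]) -> measurable [set x | forall i, P i x].
Proof.
move=> mP; rewrite (_ : [set _ | _] = [set x | ~ exists i, ~ P i x]).
  by apply: measurable_not; apply: measurable_exists => i; apply: measurable_not.
by apply/seteqP; split => x /=; rewrite -forallNP => H i; have := H i; rewrite notK.
Qed.

Lemma measurable_cstP (Q : Prop) : measurable [set x : T | Q].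
Proof.
have [q|q] := pselect Q.
  by rewrite (_ : [set _ | _] = setT) //; apply/seteqP; split.
by rewrite (_ : [set _ | _] = set0) //; apply/seteqP; split.
Qed.

Lemma measurable_preim d' (S : measurableType d') (f : T -> S) (Y : set S) :
  measurable_fun setT f -> measurable Y -> measurable [set x | Y (f x)].
Proof. by move=> mf mY; have := mf measurableT Y mY; rewrite setTI. Qed.

Lemma measurable_preim_fun d' (S : measurableType d') (f : T -> S) :
  (forall Y, measurable Y -> measurable [set x | Y (f x)]) -> measurable_fun setT f.
Proof. by move=> H _ Y mY; rewrite setTI; exact: H. Qed.

End MeasurableProp.

(** Separating a point from finitely many others at once later isolates an edge within a finite
    ball. *)
Definition countably_separating d (T : measurableType d) (U : nat -> set T) :=
  (forall n, measurable (U n)) /\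
  forall (x : T) (s : seq T), x \notin s -> exists2 n, U n x & forall y, y \in s -> ~ U n y.

Section CountablySeparating.
Local Open Scope classical_set_scope.
Context d d' (T : measurableType d) (S : measurableType d') (U : nat -> set S).
Hypothesis sU : countably_separating U.

Lemma measurable_eq_fun (f g : T -> S) : measurable_fun setT f -> measurable_fun setT g ->
  measurable [set x | f x = g x].
Proof.
move=> mf mg; rewrite (_ : [set _ | _] = [set x | ~ exists n, U n (f x) /\ ~ U n (g x)]).
  apply/measurable_not/measurable_exists => n; apply: measurable_and.
    by apply: measurable_preim => //; case: sU.
  by apply/measurable_not/measurable_preim => //; case: sU.
apply/seteqP; split => x /=; first by move=> -> [n []].
move=> H; apply/eqP/negP => fg; apply: H.
have [|n Un Vn] := sU.2 (f x) [:: g x]; first by rewrite inE; exact/negP.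
by exists n; split => //; apply: Vn; rewrite inE.
Qed.

End CountablySeparating.

Lemma measurable_fixed d (T : measurableType d) (U : nat -> set T) (f : T -> T) :
  countably_separating U -> measurable_fun setT f -> measurable [set x | f x = x]%classic.
Proof.
move=> sU mf; have := measurable_eq_fun sU mf (@measurable_id _ T setT); exact.
Qed.

(* A substitute for the Lusin-Novikov theorem: [Rl] is covered by the graphs of
   countably many Borel partial functions contained in it. *)
Definition named d d' (A : measurableType d) (B : measurableType d') (Rl : A -> B -> Prop) :=
  exists (dom : nat -> set A) (h : nat -> A -> B),
  [/\ forall i, measurable (dom i), forall i, measurable_fun setT (h i)
    & forall x y, Rl x y <-> exists i, dom i x /\ h i x = y].

Section Named.
Local Open Scope classical_set_scope.
Context d1 d2 (A : measurableType d1) (B : measurableType d2).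

Lemma named_ext (R S : A -> B -> Prop) : (forall x y, R x y <-> S x y) -> named R -> named S.
Proof.
move=> RS [dom [h [md mh H]]]; exists dom, h; split => // x y.
by rewrite -RS.
Qed.

Lemma named_countable (I : countType) (dom : I -> set A) (h : I -> A -> B) :
  (forall i, measurable (dom i)) -> (forall i, measurable_fun setT (h i)) ->
  named (fun x y => exists i, dom i x /\ h i x = y).
Proof.
move=> md mh; exists (fun n => if unpickle n is Some i then dom i else set0),
  (fun n => if unpickle n is Some i then h i else cst point); split.
- by move=> n; case: unpickle.
- by move=> n; case: unpickle => // i; exact: mh.
- move=> x y; split => [[i [di hi]]|[n]]; first by exists (pickle i); rewrite pickleK.
  by case: unpickle => [i|[]//] [di hi]; exists i.
Qed.

Lemma named_exists (I : countType) (R : I -> A -> B -> Prop) :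
  (forall i, named (R i)) -> named (fun x y => exists i, R i x y).
Proof.
move=> /choice[dom] /choice[h H].
apply: named_ext (@named_countable (I * nat)%type (fun p => dom p.1 p.2) (fun p => h p.1 p.2) _ _).
- move=> x y; split => [[[i n] /= [di hi]]|[i Ri]].
    by exists i; have [_ _ ->] := H i; exists n.
  by have [_ _ Hi] := H i; have [n Hn] := (Hi x y).1 Ri; exists (i, n).
- by move=> [i n]; have [mi _ _] := H i; exact: mi.
- by move=> [i n]; have [_ mi _] := H i; exact: mi.
Qed.

Lemma named_fun (h : A -> B) : measurable_fun setT h -> named (fun x y => h x = y).
Proof.
move=> mh; apply: named_ext (@named_countable unit (fun=> setT) (fun=> h) _ _) => //.
by move=> x y; split => [[_ []]//|hx]; exists tt.
Qed.

Lemma named_restrict (P : A -> Prop) (R : A -> B -> Prop) : measurable [set x | P x] ->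
  named R -> named (fun x y => P x /\ R x y).
Proof.
move=> mP [dom [h [md mh H]]].
apply: named_ext (@named_countable nat (fun i => [set x | P x /\ dom i x]) h _ mh) => x *.
- rewrite H; split => [[i [[Px di] hi]]|[Px [i [di hi]]]]; last by exists i.
  by split => //; exists i.
- exact: measurable_and mP (md _).
Qed.

Lemma named_or (R S : A -> B -> Prop) : named R -> named S -> named (fun x y => R x y \/ S x y).
Proof.
move=> nR nS; apply: named_ext (@named_exists bool (fun b => if b then R else S) _).
  by move=> x y; split => [[[]]|[]]; auto; [exists true|exists false].
by case.
Qed.

End Named.

Lemma named_id d (A : measurableType d) : named (fun x y : A => x = y).
Proof. exact: (@named_fun _ _ A A idfun (@measurable_id _ A setT)). Qed.

Section NamedComp.
Local Open Scope classical_set_scope.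
Context d1 d2 d3 (A : measurableType d1) (B : measurableType d2) (C : measurableType d3).

Lemma named_comp (R : A -> B -> Prop) (S : B -> C -> Prop) :
  named R -> named S -> named (rcomp R S).
Proof.
move=> [dR [hR [mdR mhR HR]]] [dS [hS [mdS mhS HS]]].
have mdom (p : nat * nat) : measurable [set x | dR p.1 x /\ dS p.2 (hR p.1 x)].
  exact: measurable_and (mdR _) (measurable_preim (mhR _) (mdS _)).
have mh (p : nat * nat) : measurable_fun setT (hS p.2 \o hR p.1).
  exact: measurableT_comp.
apply: named_ext (named_countable mdom mh) => x z.

split=> [[[i j] /= [[di dj] hj]]|[y /HR[i [di hi]] /HS[j [dj hj]]]].
  by exists (hR i x); [apply/HR; exists i|apply/HS; exists j].
by exists (i, j); rewrite /= hi.
Qed.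

(** The section over [x] is enumerated by names, so the quantifier over [y] becomes countable; this
    keeps projections Borel. *)
Lemma named_image (R : A -> B -> Prop) (Y : set B) : named R -> measurable Y ->
  measurable [set x | exists y, R x y /\ Y y].
Proof.
move=> [dom [h [md mh H]]] mY.
rewrite (_ : [set _ | _] = [set x | exists i, dom i x /\ Y (h i x)]).
  apply: measurable_exists => i; exact: measurable_and (md _) (measurable_preim (mh _) mY).
apply/seteqP; split => x /=.
  by move=> [y [/H[i [di hi]] Yy]]; exists i; rewrite hi.
by move=> [i [di Yi]]; exists (h i x); split => //; apply/H; exists i.
Qed.

Lemma named_graph (U : nat -> set B) (R : A -> B -> Prop) (f : A -> B) : countably_separating U ->
  named R -> measurable_fun setT f -> measurable [set x | R x (f x)].
Proof.
move=> sU [dom [h [md mh H]]] mf.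
rewrite (_ : [set _ | _] = [set x | exists i, dom i x /\ h i x = f x]).
  apply: measurable_exists => i; exact: measurable_and (md _) (measurable_eq_fun sU (mh _) mf).
by apply/seteqP; split => x /= /H.
Qed.

End NamedComp.

(** * Distance and connectivity in the line graph *)

Section Connected.
Local Open Scope nat_scope.
Variables (V E : choiceType) (p1 p2 : E -> V) (star : V -> seq E) (D mu : nat).
Hypothesis G : star_spec p1 p2 star D mu.

(** Every edge is its own neighbor: this is adjacency in the line graph together with equality of
    edges. *)
Definition line_nbr : E -> E -> Prop := rcomp (incident star) (fun v f => f \in star v).

Fixpoint line_path n : E -> E -> Prop :=
  if n is m.+1 then rcomp line_nbr (line_path m) else fun e f => e = f.

Definition line_ball r e f := exists2 n, n <= r & line_path n e f.

Definition line_conn e f := exists r, line_ball r e f.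

Lemma line_nbr_sym e f : line_nbr e f -> line_nbr f e.
Proof. by move=> [v ev fv]; exists v. Qed.

Lemma line_pathD n m e f g : line_path n e f -> line_path m f g -> line_path (n + m) e g.
Proof.
elim: n e => [e ->//|n IH e [h eh hf] fg]; exists h => //; exact: IH.
Qed.

Lemma line_path1 e f : line_nbr e f -> line_path 1 e f.
Proof. by move=> ef; exists f. Qed.

Lemma line_path_sym n e f : line_path n e f -> line_path n f e.
Proof.
elim: n e => [e ->//|n IH e [h /line_nbr_sym he /IH fh]].
by rewrite -addn1; apply: line_pathD fh (line_path1 he).
Qed.

Lemma line_ballD r s e f g : line_ball r e f -> line_ball s f g -> line_ball (r + s) e g.
Proof.
by move=> [n nr ef] [m ms fg]; exists (n + m); [exact: leq_add|exact: line_pathD ef fg].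
Qed.

Lemma line_ball_sym r e f : line_ball r e f -> line_ball r f e.
Proof. by move=> [n nr /line_path_sym]; exists n. Qed.

Lemma line_ball1 e f : line_nbr e f -> line_ball 1 e f.
Proof. by move=> /line_path1; exists 1. Qed.

Lemma line_ball_le r s e f : r <= s -> line_ball r e f -> line_ball s e f.
Proof. by move=> rs [n nr ef]; exists n => //; exact: leq_trans rs. Qed.

Lemma line_conn_sym e f : line_conn e f -> line_conn f e.
Proof. by move=> [r /line_ball_sym]; exists r. Qed.

Lemma line_conn_trans e f g : line_conn e f -> line_conn f g -> line_conn e g.
Proof. by move=> [r ef] [s fg]; exists (r + s); exact: line_ballD fg. Qed.

Lemma line_nbr_conn e f : line_nbr e f -> line_conn e f.
Proof. by exists 1; exact: line_ball1. Qed.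

Lemma line_conn0 e : line_conn e e.
Proof. by exists 0, 0. Qed.

Lemma bounded_line_nbr : bounded_preim (D * 2) line_nbr.
Proof. exact: bounded_preim_comp (bounded_incident G) (bounded_endpoint G). Qed.

Lemma line_path_finite n f : exists s : seq E, forall e, line_path n e f -> e \in s.
Proof.
elim: n f => [|n IH] f; first by exists [:: f] => e /= ->; rewrite mem_head.
have [s sP] := IH f.
have /choice [F FP] : forall g, exists l : seq E, forall e, line_nbr e g -> e \in l.
  by move=> g; have [l _ lP] := bounded_line_nbr g; exists l.
exists (flatten [seq F g | g <- s]) => e [g eg /sP gs]; apply/flatten_mapP.
by exists g => //; exact: FP.
Qed.

Lemma line_ball_finite r f : exists s : seq E, forall e, line_ball r e f -> e \in s.
Proof.
have /choice [F FP] := fun n => line_path_finite n f.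
exists (flatten [seq F n | n <- iota 0 r.+1]) => e [n nr ef]; apply/flatten_mapP.
by exists n; [rewrite mem_iota|exact: FP].
Qed.

Let joins x y := forall e f, e \in star x -> f \in star y -> line_conn e f.

Lemma joins_refl x : joins x x.
Proof. by move=> e f ex fx; apply: line_nbr_conn; exists x. Qed.

Lemma joins_nbr x y z : joins x y -> nbr p1 p2 star y z -> joins x z.
Proof.
move=> xy [g gy <-] e f ex fz; apply: line_conn_trans (xy _ _ ex gy) _.
by apply: line_nbr_conn; exists (other p1 p2 g y) => //; exact: other_star G _ _ gy.
Qed.

Lemma joins_walk c a b n x y u : joins x y -> walk p1 p2 star c a b n y = Some u -> joins x u.
Proof.
move=> xy; elim: n u => [u [<-]//|n IH u].
rewrite walkSr; case: walk IH => [v|//] IH /=; rewrite /step.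
case Ef: edge_at => [f|//] /= [<-]; have [fv _] := edge_atP Ef.
by apply: joins_nbr (IH v erefl) _; exists f.
Qed.

(** Makes [linked] admissible for mass transport, since invariance only concerns moves inside a
    component. *)
Lemma linked_conn c L e f : linked p1 p2 star D mu c L e f -> line_conn e f.
Proof.
move=> [x ex [y xy [u [a [b [n [_ _ _ _ yu]]]] [z uz [v [a' [b' [m [_ _ _ _ zv]]]] fv]]]]].
have jy := joins_nbr (@joins_refl x) xy.
have jz := joins_nbr (joins_walk jy yu) uz.
exact: (joins_walk jz zv).
Qed.

End Connected.

(** * Borel graphs given by finite stars *)

Section BorelStar.
Local Open Scope classical_set_scope.
Local Open Scope nat_scope.
Context dV dE (V : measurableType dV) (X : measurableType dE).
Variables (p1 p2 : X -> V) (star : V -> seq X) (D mu : nat).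
Hypothesis G : star_spec p1 p2 star D mu.
Hypothesis mp1 : measurable_fun setT p1.
Hypothesis mp2 : measurable_fun setT p2.
Hypothesis nstar : named (fun v e => e \in star v).
Variables (UV : nat -> set V) (UX : nat -> set X).
Hypothesis sUV : countably_separating UV.
Hypothesis sUX : countably_separating UX.
Local Notation k := (D + mu).

Definition edge_set : set X := [set e | e \in star (p1 e)].

Lemma measurable_edge_set : measurable edge_set.
Proof.
have := named_graph sUX (named_comp (named_fun mp1) nstar) (@measurable_id _ X setT).
rewrite (_ : [set _ | _] = edge_set) //; apply/seteqP; split => e /=.
  by move=> [v <-].
by move=> ev; exists (p1 e).
Qed.

Lemma named_incident : named (incident star).
Proof.
have me2 : measurable [set e | e \in star (p2 e)].
  have := named_graph sUX (named_comp (named_fun mp2) nstar) (@measurable_id _ X setT).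
  rewrite (_ : [set _ | _] = [set e | e \in star (p2 e)]) //.
  apply/seteqP; split => e /=; first by move=> [v <-].
  by move=> ev; exists (p2 e).
apply: named_ext (named_or (named_restrict measurable_edge_set (named_fun mp1))
  (named_restrict me2 (named_fun mp2))) => e v.
rewrite /incident; split => [[[ev <-]|[ev <-]]//|ev].
by have [e1|e1] := star_end G ev; [left|right]; split; rewrite /edge_set /= -?e1.
Qed.

Lemma named_line_nbr : named (line_nbr star).
Proof. exact: named_comp named_incident nstar. Qed.

Lemma named_line_path n : named (line_path star n).
Proof.
elim: n => [|n IH]; first exact: (named_id X).
exact: named_comp named_line_nbr IH.
Qed.

Lemma named_line_ball r : named (line_ball star r).
Proof.
have nb n : named (fun e f => (n <= r)%N /\ line_path star n e f).
  exact: named_restrict (measurable_cstP _ _) (named_line_path n).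
apply: named_ext (named_exists nb) => e f.
by split => [[n [nr ef]]|[n nr ef]]; exists n.
Qed.

Lemma named_line_conn : named (line_conn star).
Proof. exact: named_exists named_line_ball. Qed.

Lemma named_star_restrict (P : set X) : measurable P ->
  named (fun v e => e \in star v /\ P e).
Proof.
move=> mP; apply: named_ext (named_comp nstar (named_restrict mP (named_id X))) => v e.
by split => [[f fv [Pf <-]]|[ev Pe]]; [|exists e].
Qed.

(** For a named edge at [x], whether [x] is its [p1] or its [p2] is a Borel condition because
    equality in [V] is Borel; the other end is then named by [p2] or [p1]. *)
Lemma named_other (P : set X) : measurable P ->
  named (fun x y => exists2 f, f \in star x & other p1 p2 f x = y /\ P f).
Proof.
move=> mP.
have [dom [h [md mh H]]] := named_star_restrict mP.
have mph1 i : measurable_fun setT (p1 \o h i) by exact: measurableT_comp.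
have mph2 i : measurable_fun setT (p2 \o h i) by exact: measurableT_comp.
have md1 i : measurable [set x | dom i x /\ (p1 \o h i) x = x].
  exact: measurableI (md i) (measurable_fixed sUV (mph1 i)).
have md2 i : measurable [set x | dom i x /\ (p2 \o h i) x = x].
  exact: measurableI (md i) (measurable_fixed sUV (mph2 i)).
apply: named_ext (named_or (named_countable md1 mph2) (named_countable md2 mph1)) => x y.
split.
  move=> [] [i /= [[di ex] <-]]; have [fx Pf] : h i x \in star x /\ P (h i x) by apply/H; exists i.
    by exists (h i x) => //; rewrite /other ex eqxx.
  exists (h i x) => //; rewrite /other; case: eqP => // e1; split => //.
  by have := star_neq G fx; rewrite ex -e1 eqxx.
move=> [f fx [<- Pf]]; have /H[i [di hi]] : f \in star x /\ P f by [].
rewrite /other; case: eqP => [xp|xp]; [left|right]; exists i; rewrite /= hi //.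
by case: (star_end G fx).
Qed.

Lemma named_nbr : named (nbr p1 p2 star).
Proof.
apply: named_ext (named_other measurableT) => x y.
by split => [[f fx [? _]]|[f fx fy]]; exists f.
Qed.

Section Coloring.
Variables (c : X -> nat).
Hypothesis mc : measurable_fun setT c.
Hypothesis pc : proper_coloring star D mu c.

Lemma measurable_color (P : nat -> Prop) : measurable [set e | P (c e)].
Proof. exact: (@measurable_preim _ X _ nat c P). Qed.

Lemma measurable_miss a : measurable [set v | miss star c v a].
Proof.
have mi := named_image nstar (measurable_color (fun q => q = a)).
rewrite (_ : [set _ | _] = [set v | ~ exists e, e \in star v /\ c e = a]).
  exact: measurable_not mi.
apply/seteqP; split => v /=; first by move=> /missP m [e [ev]]; exact: m.
by move=> H; apply/missP => e ev ce; apply: H; exists e.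
Qed.

Lemma named_step a : a < k -> named (fun v w => step p1 p2 star c a v = Some w).
Proof.
move=> ak; apply: named_ext (named_other (measurable_color (fun q => q = a))) => v w.
rewrite /step; split => [[f fv [<- cf]]|].
  by rewrite (edge_at_some pc ak fv cf).
by case Ef: edge_at => [f|//] [<-]; have [fv cf] := edge_atP Ef; exists f.
Qed.

Lemma named_walk a b n : a < k -> b < k -> named (fun v w => walk p1 p2 star c a b n v = Some w).
Proof.
elim: n a b => [|n IH] a b ak bk.
  apply: named_ext (named_id V) => v w; by split => [->|[]].
apply: named_ext (named_comp (named_step ak) (IH b a bk ak)) => v w /=.
split => [[u -> //]|]; case Eu: (step _ _ _ _ _ v) => [u|//] /= uw; by exists u.
Qed.

Lemma named_alt_path L : named (alt_path p1 p2 star D mu c L).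
Proof.
have nb (q : nat * nat * nat) : named (fun y u => ([/\ q.1.1 < k, q.1.2 < k & q.2 <= L] /\
    miss star c y q.1.2) /\ ([/\ q.1.1 < k, q.1.2 < k & q.2 <= L] /\
    walk p1 p2 star c q.1.1 q.1.2 q.2 y = Some u)).
  have [ok|nok] := pselect [/\ q.1.1 < k, q.1.2 < k & q.2 <= L]; last first.
    apply: named_ext (named_restrict (measurable_cstP _ False) (named_fun (@measurable_cst _ _ V V setT point))) => y u.
    by split => [[]//|[[]]].
  case: (ok) => ak bk _; apply: named_restrict.
    exact: measurableI (measurable_cstP _ _) (measurable_miss _).
  by apply: named_restrict; [exact: measurable_cstP|exact: named_walk].
apply: named_ext (named_exists nb) => y u; split.
  by move=> [[[a b] n] /= [[[ak bk nL] my] [_ yu]]]; exists a, b, n.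
by move=> [a [b [n [ak bk nL my yu]]]]; exists (a, b, n).
Qed.

Lemma named_linked L : named (linked p1 p2 star D mu c L).
Proof.
have na := named_alt_path L.
exact: named_comp named_incident (named_comp named_nbr (named_comp na
  (named_comp named_nbr (named_comp na nstar)))).
Qed.

End Coloring.
End BorelStar.

(** * Mass transport *)

Section CountMeasure.
Import Order.TTheory GRing.Theory Num.Theory.
Local Open Scope classical_set_scope.
Local Open Scope ereal_scope.
Context (R : realType) d (X : measurableType d) (nu : probability X R).
Variables (I : Type) (r : seq I) (A : I -> set X).
Hypothesis mA : forall i, measurable (A i).

Let S x : \bar R := \sum_(i <- r) (\1_(A i) x)%:E.

Let SE x : S x = (count (fun i => x \in A i) r)%:R%:E.
Proof.
rewrite /S; elim: r => [|i s IH]; first by rewrite big_nil.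
by rewrite big_cons IH /= indicE natrD EFinD.
Qed.

Let intS : \int[nu]_x S x = \sum_(i <- r) nu (A i).
Proof.
rewrite ge0_integral_sum //.
- by apply: eq_bigr => i _; rewrite integral_indic // setIT.
- by move=> i; apply/measurable_EFinP; exact: measurable_indic.
Qed.

Let mS : measurable_fun setT S.
Proof.
by apply: emeasurable_sum => i; apply/measurable_EFinP; exact: measurable_indic.
Qed.

(** This bound and the next one integrate the function counting the sets that contain a point. *)
Lemma sum_measure_le M : (forall x, (count (fun i => x \in A i) r <= M)%N) ->
  \sum_(i <- r) nu (A i) <= M%:R%:E.
Proof.
move=> H; rewrite -intS; have -> : M%:R%:E = \int[nu]_x (cst M%:R%:E x : \bar R).
  rewrite integral_cst // -[LHS]mule1; congr (_ * _); exact/esym/probability_setT.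
by apply: ge0_le_integral => // x _; rewrite SE lee_fin ?ler0n // ler_nat.
Qed.

Lemma sum_measure_ge N W : measurable W ->
  (forall x, W x -> (N <= count (fun i => x \in A i) r)%N) ->
  N%:R%:E * nu W <= \sum_(i <- r) nu (A i).
Proof.
move=> mW H; rewrite -intS.
have -> : N%:R%:E * nu W = \int[nu]_x (N%:R * \1_W x)%:E.
  rewrite (integralZl_indic measurableT (fun=> W)) ?integral_indic ?setIT // => N0.
  by have := ltr0n R N; rewrite ltNge ler0n in N0.
apply: ge0_le_integral => //.
- by apply/measurable_EFinP/measurable_funM => //; exact: measurable_indic.
- move=> x _; rewrite SE lee_fin indicE; have [xW|xW] := boolP (x \in W).
    by rewrite mulr1 ler_nat H // -in_setE.
  by rewrite mulr0 ler0n.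
Qed.

End CountMeasure.

Section MassTransport.
Import Order.TTheory GRing.Theory Num.Theory.
Local Open Scope classical_set_scope.
Context (R : realType) d (X : measurableType d) (nu : probability X R).
Variables (UX : nat -> set X) (conn : X -> X -> Prop) (E0 : set X).
Hypothesis sUX : countably_separating UX.
Hypothesis nconn : named conn.
Hypothesis conn_sym : forall e f, conn e f -> conn f e.

Definition invariant_measure := forall (A : set X) (phi : X -> X),
  measurable A -> A `<=` E0 -> measurable_fun setT phi -> {in A &, injective phi} ->
  measurable (phi @` A) -> (forall e, A e -> conn e (phi e)) -> nu (phi @` A) = nu A.

Hypothesis nu_inv : invariant_measure.

(** A point of the image has a preimage among the countably many named points connected to it. *)
Lemma measurable_image_conn (A : set X) (g : X -> X) : measurable A ->
  measurable_fun setT g -> (forall e, A e -> conn e (g e)) -> measurable (g @` A).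
Proof.
move=> mA mg cg; have [dom [h [md mh H]]] := nconn.
rewrite (_ : _ @` _ = [set f | exists i, (dom i f /\ A (h i f)) /\ (g \o h i) f = f]).
  apply: measurable_exists => i; apply: measurableI.
    exact: measurableI (md i) (measurable_preim (mh i) mA).
  by apply: (measurable_fixed sUX); exact: measurableT_comp.
apply/seteqP; split => f /=.
  move=> [e Ae <-]; have /H[i [di hi]] := conn_sym (cg e Ae).
  by exists i; rewrite hi.
by move=> [i [[di Ai] gf]]; exists (h i f).
Qed.

(** Double counting: [S] splits on [U] into measure-preserving injections whose domains cover each
    point of [U] at least [N] times, and whose ranges cover each point at most [M] times. *)
Lemma mass_transport (S : X -> X -> Prop) (U : set X) N M : named S ->
  (forall e f, S e f -> conn e f) -> measurable U -> U `<=` E0 ->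
  (forall e, U e -> exists s : seq X, [/\ uniq s, (N <= size s)%N & forall f, f \in s -> S e f]) ->
  bounded_preim M S -> (N%:R%:E * nu U <= M%:R%:E)%E.
Proof.
move=> [dS [hS [mdS mhS HS]]] Sconn mU UE SN SM.
have [dC [hC [mdC mhC HC]]] := nconn.
(* [q.1] is the first name of the target of [e], and [q.2] the first name of the way
   back; the pairs [(e, f)] with [S e f] are thus split into graphs of injections. *)
pose A (q : nat * nat) : set X := [set e | [/\ U e,
  dS q.1 e /\ (forall i, (i < q.1)%N -> ~ (dS i e /\ hS i e = hS q.1 e)) &
  (dC q.2 (hS q.1 e) /\ hC q.2 (hS q.1 e) = e) /\
  (forall i, (i < q.2)%N -> ~ (dC i (hS q.1 e) /\ hC i (hS q.1 e) = e))]].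
have mA q : measurable (A q).
  rewrite (_ : A q = U `&` ([set e | dS q.1 e] `&`
    [set e | forall i, ~ ((i < q.1)%N /\ dS i e /\ hS i e = hS q.1 e)]) `&`
    (([set e | dC q.2 (hS q.1 e)] `&` [set e | (hC q.2 \o hS q.1) e = e]) `&`
    [set e | forall i, ~ ((i < q.2)%N /\ dC i (hS q.1 e) /\ (hC i \o hS q.1) e = e)])).
    have mhh i : measurable_fun setT (hC i \o hS q.1) by exact: measurableT_comp.
    apply: measurableI.
      apply: measurableI; first exact: mU.
      apply: measurableI; first exact: mdS.
      apply: measurable_forall => i; apply: measurable_not.
      apply: measurableI; first exact: measurable_cstP.
      exact: measurableI (mdS _) (measurable_eq_fun sUX (mhS _) (mhS _)).
    apply: measurableI; first apply: measurableI.
    - exact: measurable_preim (mhS _) (mdC _).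
    - exact: measurable_fixed sUX (mhh _).
    - apply: measurable_forall => i; apply: measurable_not.
      apply: measurableI; first exact: measurable_cstP.
      exact: measurableI (measurable_preim (mhS _) (mdC _)) (measurable_fixed sUX (mhh _)).
  apply/seteqP; split => e /=.
    move=> [Ue [d1 m1] [[d2 e2] m2]].
    split; split; [by []| |by []|by move=> i [il ?]; exact: (m2 i il)].
    by split => // i [il ?]; exact: (m1 i il).
  move=> [[Ue [d1 m1]] [[d2 e2] m2]]; split => //.
    by split => // i il ?; exact: (m1 i).
  by split => // i il ?; exact: (m2 i).
have AS q e : A q e -> S e (hS q.1 e) by move=> [_ [de _] _]; apply/HS; exists q.1.
pose B q := hS q.1 @` A q.
have Binj q : {in A q &, injective (hS q.1)}.
  move=> e e'; rewrite !in_setE => -[_ _ [[_ e1] _]] [_ _ [[_ e2] _]] e12.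
  by rewrite -e1 -e2 e12.
have mB q : measurable (B q).
  by apply: measurable_image_conn => // e /AS /Sconn.
have nuB q : nu (B q) = nu (A q).
  apply: nu_inv => //; first by move=> e [/UE].
    exact: mB.
  by move=> e /AS /Sconn.
have Aq_inj q q' e : A q e -> A q' e -> hS q.1 e = hS q'.1 e -> q = q'.
  case: q q' => [n m] [n' m'] [_ /= [dn ln] [[dm em] lm]] [_ /= [dn' ln'] [[dm' em'] lm']] e1.
  have nn : n = n'.
    apply/eqP; rewrite eqn_leq; apply/andP; split; rewrite leqNgt; apply/negP => lt.
      by apply: (ln _ lt).
    by apply: (ln' _ lt).
  subst n'; congr pair; apply/eqP; rewrite eqn_leq; apply/andP; split; rewrite leqNgt; apply/negP => lt.
    by apply: (lm _ lt).
  by apply: (lm' _ lt).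
(* The counting is done for finitely many names, both indices below [p]; then [p] tends to
   infinity. *)
pose r p := [seq (n, m) | n <- iota 0 p, m <- iota 0 p].
have ur p : uniq (r p) by rewrite allpairs_uniq ?iota_uniq // => -[? ?] [? ?] _ _ /= [-> ->].
have up p : (\sum_(q <- r p) nu (A q) <= M%:R%:E)%E.
  under eq_bigr do rewrite -nuB.
  apply: sum_measure_le => // f; have [s sM sP] := SM f.
  apply: leq_trans sM; rewrite -size_filter.
  (* The second index leads from [f] back to the source. By [Aq_inj], different pairs [q] give
     different sources, of which there are at most [M]. *)
  pose g (q : nat * nat) := hC q.2 f.
  have gP q : f \in B q -> A q (g q) /\ hS q.1 (g q) = f.
    by rewrite in_setE => -[e Ae ef]; have [_ _ [[_ e1] _]] := Ae; rewrite /g -ef e1.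
  rewrite -(size_map g); apply: uniq_leq_size; last first.
    move=> e /mapP[q]; rewrite mem_filter => /andP[/gP[Aq hq] _] ->; apply: sP.
    by have := AS _ _ Aq; rewrite hq.
  rewrite map_inj_in_uniq ?filter_uniq // => q q'; rewrite !mem_filter.
  move=> /andP[/gP[Aq hq] _] /andP[/gP[Aq' hq'] _] gq; rewrite -gq in Aq' hq'.
  by apply: Aq_inj Aq Aq' _; rewrite hq hq'.
pose W p := [set e | U e /\ (N <= count (fun q => e \in A q) (r p))%N].
have mcount p l : measurable [set e : X | (l <= count (fun q => e \in A q) (r p))%N].
  elim: (r p) l => [|q s IH] l /=; first exact: measurable_cstP.
  case: l => [|l]; first by rewrite (_ : [set _ | _] = setT) //; apply/seteqP.
  rewrite (_ : [set _ | _] = (A q `&` [set e | (l <= count (fun q => e \in A q) s)%N]) `|`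
     [set e | (l.+1 <= count (fun q => e \in A q) s)%N]).
    by apply: measurableU => //; apply: measurableI.
  apply/seteqP; split => e /=.
    have [eA|eA] := boolP (e \in A q); last by right.
    by rewrite add1n ltnS => ?; left; split=> //; rewrite -in_setE.
  move=> [[]|]; first by rewrite -in_setE => ->.
  by move=> le; apply: leq_trans le _; exact: leq_addl.
have mW p : measurable (W p) by exact: measurableI mU (mcount p N).
have Wle p : (N%:R%:E * nu (W p) <= M%:R%:E)%E.
  apply: le_trans (up p); apply: sum_measure_ge => // e [] //.
have WU : U = \bigcup_p W p.
  apply/seteqP; split => e; last by move=> [p _ []].
  move=> Ue; have [s [us sN sS]] := SN e Ue.
  have /choice [Q QP] : forall f, exists q, f \in s -> A q e /\ hS q.1 e = f.
    move=> f; have [fs|] := boolP (f \in s); last by exists (0, 0)%N.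
    have /HS exn : S e f by exact: sS.
    have exn' : exists n, `[< dS n e /\ hS n e = f >] by have [n ?] := exn; exists n; apply/asboolP.
    case: (ex_minnP exn') => n /asboolP[dn hn] nmin.
    have /HC exm : conn f e by apply: conn_sym; apply: Sconn; exact: sS.
    have exm' : exists m, `[< dC m f /\ hC m f = e >] by have [m ?] := exm; exists m; apply/asboolP.
    case: (ex_minnP exm') => m /asboolP[dm hm] mmin.
    exists (n, m) => _; split => //; split => //=.
      split => // i il [di]; rewrite hn => hi.
      by have := nmin i (asboolT (conj di hi)); rewrite leqNgt il.
    rewrite hn; split => // i il [di hi].
    by have := mmin i (asboolT (conj di hi)); rewrite leqNgt il.
  pose p := (\max_(f <- s) maxn (Q f).1 (Q f).2).+1.
  exists p => //; split => //.
  apply: leq_trans sN _; rewrite -size_filter -(size_map Q).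
  apply: uniq_leq_size.
    rewrite map_inj_in_uniq // => f f' fs f's; have [_ e1] := QP f fs; have [_ e2] := QP f' f's.
    by move=> e3; rewrite -[LHS]e1 -[RHS]e2 e3.
  move=> q /mapP[f fs ->]; have [Aq _] := QP f fs.
  rewrite mem_filter; apply/andP; split; first by rewrite in_setE.
  have lef : (maxn (Q f).1 (Q f).2 <= \max_(f <- s) maxn (Q f).1 (Q f).2)%N.
    by rewrite (big_rem f) //= leq_maxl.
  apply/allpairsP; exists (Q f); rewrite !mem_iota /= !add0n !ltnS; split; last by case: (Q f).
    exact: leq_trans (leq_maxl _ _) lef.
  exact: leq_trans (leq_maxr _ _) lef.
have ndW : {homo W : n m / (n <= m)%N >-> (n <= m)%O}.
  move=> n m nm; apply/subsetPset => e [Ue le]; split => //; apply: leq_trans le _.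
  rewrite -!size_filter; apply: uniq_leq_size; first by rewrite filter_uniq.
  move=> q; rewrite !mem_filter => /andP[-> /allpairsP[q' [+ + ->]]]; rewrite !mem_iota /= => a1 a2.
  by apply/allpairsP; exists q'; rewrite !mem_iota /= !(leq_trans _ nm).
have cvgW : (nu \o W) p @[p --> \oo] --> nu U.
  by rewrite WU; apply: nondecreasing_cvg_mu => //; rewrite -WU.
have cvgN : (N%:R%:E * nu (W p))%E @[p --> \oo] --> (N%:R%:E * nu U)%E.
  by apply: cvgeZl.
rewrite -(cvg_lim _ cvgN) //; apply: lime_le; first by apply/cvg_ex; eexists; exact: cvgN.
by apply: nearW.
Qed.

End MassTransport.

(** * Removing holes *)

Section Repair.
Import Order.TTheory GRing.Theory Num.Theory.
Local Open Scope classical_set_scope.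
Local Open Scope nat_scope.
Context (R : realType) dV dE (V : measurableType dV) (X : measurableType dE).
Variables (p1 p2 : X -> V) (star : V -> seq X) (D mu : nat).
Hypothesis G : star_spec p1 p2 star D mu.
Hypothesis mu_gt0 : 0 < mu.
Hypothesis mp1 : measurable_fun setT p1.
Hypothesis mp2 : measurable_fun setT p2.
Hypothesis nstar : named (fun v e => e \in star v).
Variables (UV : nat -> set V) (UX : nat -> set X).
Hypothesis sUV : countably_separating UV.
Hypothesis sUX : countably_separating UX.
Variable nu : probability X R.
Hypothesis nu_inv : invariant_measure nu (line_conn star) (edge_set p1 star).
Local Notation k := (D + mu).
Local Notation E0 := (edge_set p1 star).

Definition holes (c : X -> nat) := [set e | E0 e /\ k <= c e].

Lemma measurable_holes c : measurable_fun setT c -> measurable (holes c).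
Proof.
move=> mc; apply: measurableI; first exact: measurable_edge_set sUX.
exact: (measurable_color mc (fun q => k <= q)).
Qed.

(** The instruction [(i, a)] gives color [a] to the edge with name [i] seen from [e]; the first
    applicable one wins. *)
Definition recolor (phi : nat -> X -> X) (c : X -> nat) (w : seq (nat * nat)) e f :=
  foldr (fun p q => if phi p.1 e == f then p.2 else q) (c f) w.

Section Names.
Variables (c : X -> nat) (r : nat) (dom : nat -> set X) (phi : nat -> X -> X).
Hypothesis mc : measurable_fun setT c.
Hypothesis pc : proper_coloring star D mu c.
Hypothesis mdom : forall i, measurable (dom i).
Hypothesis mphi : forall i, measurable_fun setT (phi i).
Hypothesis phiP : forall e f, line_ball star r e f <-> exists i, dom i e /\ phi i e = f.
Variable w : seq (nat * nat).
Local Notation new := (recolor phi c w).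

Definition hit e f := exists2 p, p \in w & phi p.1 e = f.

(** [hit e e] makes the hole itself receive a color; the last clause tests new colors only around
    recolored edges, where properness could fail. *)
Definition repairable e := [/\ holes c e, forall p, p \in w -> dom p.1 e /\ p.2 < k, hit e e &
  forall p, p \in w -> forall g, line_nbr star (phi p.1 e) g -> g <> phi p.1 e ->
    new e g <> new e (phi p.1 e)].

Lemma measurable_recolor d (T : measurableType d) (se sf : T -> X) a :
  measurable_fun setT se -> measurable_fun setT sf ->
  measurable [set x | new (se x) (sf x) = a].
Proof.
move=> mse msf; rewrite /recolor; elim: w => [|p s IH] /=.
  have mcs : measurable_fun setT (c \o sf) by exact: measurableT_comp.
  exact: (@measurable_preim _ T _ nat (c \o sf) [set a] mcs).
have me : measurable [set x | (phi p.1 \o se) x = sf x].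
  apply: (measurable_eq_fun sUX) => //; exact: measurableT_comp.
rewrite (_ : [set _ | _] = ([set x | (phi p.1 \o se) x = sf x] `&` [set x | p.2 = a]) `|`
  (~` [set x | (phi p.1 \o se) x = sf x] `&`
   [set x | foldr (fun p q => if phi p.1 (se x) == sf x then p.2 else q) (c (sf x)) s = a])).
  apply: measurableU; apply: measurableI => //; [exact: measurable_cstP|exact: measurableC].
by apply/seteqP; split => x /=; case: eqP => e1 H; [left|right|case: H => -[]|case: H => -[]].
Qed.

Lemma measurable_hit d (T : measurableType d) (se sf : T -> X) :
  measurable_fun setT se -> measurable_fun setT sf ->
  measurable [set x | hit (se x) (sf x)].
Proof.
move=> mse msf.
rewrite (_ : [set _ | _] = [set x | exists p, p \in w /\ (phi p.1 \o se) x = sf x]).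
  apply: measurable_exists => p; apply: measurableI; first exact: measurable_cstP.
  apply: (measurable_eq_fun sUX) => //; exact: measurableT_comp.
by apply/seteqP; split => x /= [p]; [exists p|move=> []; exists p].
Qed.

Lemma measurable_repairable : measurable repairable.
Proof.
have [dN [hN [mdN mhN HN]]] := named_line_nbr G mp1 mp2 nstar sUX.
pose Q (p : nat * nat) := [set e | dom p.1 e] `&` [set e | p.2 < k].
pose B (p : nat * nat) j := [set e | dN j (phi p.1 e)] `&`
  (~` [set e | (hN j \o phi p.1) e = phi p.1 e] `&`
  [set e | exists a, new e ((hN j \o phi p.1) e) = a /\ new e (phi p.1 e) = a]).
have mid : measurable_fun setT (idfun : X -> X) by exact: (@measurable_id _ X setT).
have mQ p : measurable (Q p) by apply: measurableI; [exact: mdom|exact: measurable_cstP].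
have mB p j : measurable (B p j).
  have mhp : measurable_fun setT (hN j \o phi p.1) by exact: measurableT_comp.
  apply: measurableI; first exact: measurable_preim (mphi _) (mdN _).
  apply: measurableI; first exact: measurableC (measurable_eq_fun sUX mhp (mphi _)).
  apply: measurable_exists => a; apply: measurableI.
    exact: (measurable_recolor (se := idfun)).
  exact: (measurable_recolor (se := idfun)).
rewrite (_ : repairable = (holes c `&` [set e | forall p, p \in w -> Q p e]) `&`
   ([set e | hit (idfun e) (idfun e)] `&`
   [set e | forall p, p \in w -> ~ exists j, B p j e])).
  apply: measurableI; apply: measurableI.
  - exact: measurable_holes.
  - by apply: measurable_forall => p; apply: measurable_imp; [exact: measurable_cstP|exact: mQ].
  - exact: measurable_hit.
  - apply: measurable_forall => p; apply: measurable_imp; first exact: measurable_cstP.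
    by apply: measurable_not; apply: measurable_exists => j; exact: mB.
apply/seteqP; split => e /=.
  move=> [he dw ee ne]; split; split => // p pw [j [dj [hj [a [a1 a2]]]]].
  by apply: (ne p pw (hN j (phi p.1 e))) => //; [apply/HN; exists j|rewrite a1 a2].
move=> [[he dw] [ee ne]]; split => // p pw g /HN[j [dj hj]] gp e1.
apply: (ne p pw); exists j; split => //; split; first by move=> /= e2; apply: gp; rewrite -hj.
by exists (new e (phi p.1 e)); rewrite /= hj.
Qed.

Lemma recolor_miss e f : ~ hit e f -> new e f = c f.
Proof.
rewrite /hit /recolor; elim: w => //= p s IH nh; case: eqP => [e1|_].
  by case: nh; exists p; rewrite ?mem_head.
by apply: IH => -[q qs e1]; apply: nh; exists q; rewrite ?inE ?qs ?orbT.
Qed.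

Lemma recolor_hit e f : (forall p, p \in w -> dom p.1 e /\ p.2 < k) -> hit e f -> new e f < k.
Proof.
rewrite /hit /recolor; elim: w => [_ [//]|p s IH] H /= [q]; rewrite inE => qs e1.
case: eqP => [_|ne]; first by have [] := H p (mem_head _ _).
apply: IH; first by move=> q' q's; apply: H; rewrite inE q's orbT.
by exists q => //; case/orP: qs => // /eqP qp; case: ne; rewrite -qp.
Qed.

Variable A : set X.
Hypothesis mA : measurable A.
Hypothesis AR : A `<=` repairable.
(** The extra 1 keeps edges recolored from different holes from being adjacent, not only from
    coinciding. *)
Hypothesis Asep : forall e e', A e -> A e' -> line_ball star (r + r).+1 e e' -> e = e'.

Let hit_ball e f : A e -> hit e f -> line_ball star r e f.
Proof.
by move=> /AR[_ dw _ _] [p pw e1]; apply/phiP; exists p.1; have [? _] := dw p pw.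
Qed.

Let hit_uniq e e' f : A e -> A e' -> hit e f -> hit e' f -> e = e'.
Proof.
move=> Ae Ae' /(hit_ball Ae) ef /(hit_ball Ae') e'f; apply: Asep => //.
by apply: line_ball_le (leqnSn _) _; apply: line_ballD ef (line_ball_sym e'f).
Qed.

Definition repaired f :=
  if pselect (exists e, A e /\ hit e f) is left H then new (projT1 (cid H)) f else c f.

Lemma repaired_hit e f : A e -> hit e f -> repaired f = new e f.
Proof.
move=> Ae ef; rewrite /repaired; case: pselect => [H|[]]; last by exists e.
by case: (cid H) => e' /= [Ae' e'f]; rewrite (hit_uniq Ae Ae' ef e'f).
Qed.

Lemma repaired_miss f : ~ (exists e, A e /\ hit e f) -> repaired f = c f.
Proof. by rewrite /repaired; case: pselect. Qed.

Lemma measurable_repaired : measurable_fun setT repaired.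
Proof.
have mid : measurable_fun setT (idfun : X -> X) by exact: (@measurable_id _ X setT).
pose H i := [set f | dom i f] `&` ([set f | A (phi i f)] `&` [set f | hit (phi i f) (idfun f)]).
have mH i : measurable (H i).
  apply: measurableI; first exact: mdom.
  by apply: measurableI; [exact: measurable_preim|exact: measurable_hit].
have HP f : (exists e, A e /\ hit e f) <-> exists i, H i f.
  split=> [[e [Ae ef]]|[i [di [Ai hi]]]]; last by exists (phi i f).
  have /line_ball_sym/phiP[i [di hi]] := hit_ball Ae ef.
  by exists i; rewrite /H /= hi.
apply: measurable_preim_fun => Y _.
rewrite (_ : [set _ | _] = [set f | exists i, H i f /\ exists a, Y a /\ new (phi i f) (idfun f) = a] `|`
   (~` [set f | exists i, H i f] `&` [set f | Y (c f)])).
  apply: measurableU.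
    apply: measurable_exists => i; apply: measurableI; first exact: mH.
    apply: measurable_exists => a; apply: measurableI; first exact: measurable_cstP.
    exact: measurable_recolor.
  apply: measurableI; last exact: measurable_color.
  by apply: measurableC; apply: measurable_exists => i; exact: mH.
apply/seteqP; split => f /=.
  have [/HP[i Hi] Yf|nH] := pselect (exists e, A e /\ hit e f).
    left; exists i; split => //; have [_ [Ai hi]] := Hi.
    by exists (repaired f); split => //; rewrite (repaired_hit Ai hi).
  by rewrite repaired_miss // => Yf; right; split => // /HP.
move=> [[i [[_ [Ai hi]] [a [Ya e1]]]]|[nH Yf]].
  by rewrite (repaired_hit Ai hi) e1.
by rewrite repaired_miss // => /HP.
Qed.

Lemma repaired_proper : proper_coloring star D mu repaired.
Proof.
have key e f g v : A e -> hit e f -> f \in star v -> g \in star v -> g <> f -> repaired g <> new e f.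
  move=> Ae ef fv gv gf.
  have fg : line_nbr star f g.
    by exists v.
  have nef : new e g <> new e f.
    by have [_ _ _ ne] := AR Ae; case: ef => p pw e1; rewrite -e1; apply: ne; rewrite ?e1.
  have [[e' [Ae' e'g]]|nH] := pselect (exists e', A e' /\ hit e' g); last first.
    by rewrite repaired_miss // -(@recolor_miss e) // => eg; apply: nH; exists e.
  have ee' : e = e'.
    apply: Asep => //; have := line_ballD (hit_ball Ae ef) (line_ball1 fg).
    move=> /line_ballD /(_ (line_ball_sym (hit_ball Ae' e'g))).
    by rewrite addn1 addSn.
  by rewrite (repaired_hit Ae') // -ee'.
move=> v f g fv gv.
have [[e [Ae ef]]|nf] := pselect (exists e, A e /\ hit e f).
  have [//|/eqP fg] := eqVneq f g.
  by rewrite (repaired_hit Ae ef) => /esym /(key _ _ _ _ Ae ef fv gv) []; exact/nesym.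
have [[e [Ae eg]]|ng] := pselect (exists e, A e /\ hit e g).
  have [//|/eqP fg] := eqVneq f g.
  by rewrite (repaired_hit Ae eg) => /(key _ _ _ _ Ae eg gv fv) [].
by rewrite !repaired_miss //; exact: (pc fv gv).
Qed.

Lemma measurable_hit_image i : (exists a, (i, a) \in w) -> measurable (phi i @` A).
Proof.
move=> [a iw]; apply: (measurable_image_conn sUX (named_line_conn G mp1 mp2 nstar sUX)) => //.
  exact: line_conn_sym.
by move=> e /AR[_ /(_ _ iw) [di _] _ _]; exists r; apply/phiP; exists i.
Qed.

Lemma measure_hit_image i : (exists a, (i, a) \in w) -> nu (phi i @` A) = nu A.
Proof.
move=> iw; have mi := measurable_hit_image iw; case: iw => a iw.
apply: nu_inv => //.
- by move=> e /AR[[]].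
- move=> e e'; rewrite !in_setE => Ae Ae' e1; apply: (hit_uniq (f := phi i e) Ae Ae').
    by exists (i, a).
  by exists (i, a).
- by move=> e /AR[_ /(_ _ iw) [di _] _ _]; exists r; apply/phiP; exists i.
Qed.

(** The changed edges lie in the union of [size w] injective images of [A], each of measure [nu A]
    by invariance. *)
Lemma measure_repaired : (nu [set f | c f <> repaired f] <= (size w)%:R%:E * nu A)%E.
Proof.
pose F := [set f | exists2 p, p \in w & (phi p.1 @` A) f].
have mneq : measurable [set f | c f <> repaired f].
  rewrite (_ : [set _ | _] = ~` [set f | exists a, c f = a /\ repaired f = a]).
    apply/measurableC/measurable_exists => a.
    by apply: measurableI; [exact: (measurable_color mc (fun q => q = a))|
      exact: (measurable_color measurable_repaired (fun q => q = a))].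
  apply/seteqP; split => f /=; first by move=> ne [a [e0 e1]]; apply: ne; rewrite e0 e1.
  by move=> ne e1; apply: ne; exists (c f).
suff [mF leF] : measurable F /\ (nu F <= (size w)%:R%:E * nu A)%E.
  apply: le_trans leF; apply: le_measure; rewrite ?inE // => f /= ne.
  have [[e [Ae [p pw e1]]]|nH] := pselect (exists e, A e /\ hit e f).
    by exists p => //; exists e.
  by case: ne; rewrite repaired_miss.
have : forall p, p \in w -> exists a, (p.1, a) \in w by move=> [i a] ?; exists a.
rewrite /F; elim: {1 3 4 5}w => [|p s IH] H /=.
  rewrite (_ : [set _ | _] = set0); first by rewrite measure0 mul0e.
  by apply/seteqP; split => f //= -[].
have [mF leF] := IH (fun q qs => H q (@mem_behead _ (p :: s) q qs)).
have pw := H p (mem_head _ _).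
rewrite (_ : [set _ | _] = (phi p.1 @` A) `|` [set f | exists2 p, p \in s & (phi p.1 @` A) f]).
  split; first exact: measurableU (measurable_hit_image pw) mF.
  apply: le_trans (measureU2 nu (measurable_hit_image pw) mF) _.
  have le1 : (nu (phi p.1 @` A) <= nu A)%E by rewrite measure_hit_image.
  apply: le_trans (leeD le1 leF) _.
  by rewrite -add1n natrD EFinD ge0_muleDl ?lee_fin ?ler0n // mul1e.
apply/seteqP; split => f /=.
  by move=> [q]; rewrite inE => /orP[/eqP -> ?|qs ?]; [left|right; exists q].
move=> [pf|[q qs qf]]; first by exists p; rewrite ?mem_head.
by exists q; rewrite ?inE ?qs ?orbT.
Qed.

Lemma holes_repaired : (nu (holes repaired) + nu A <= nu (holes c))%E.
Proof.
have mh := measurable_holes measurable_repaired.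
rewrite -measureU //; last first.
  apply/seteqP; split => // e [[_ ke] Ae]; have [_ dw ee _] := AR Ae.
  by move: ke; rewrite (repaired_hit Ae ee) leqNgt (recolor_hit dw ee).
apply: le_measure; rewrite ?inE; [exact: measurableU|exact: measurable_holes|].
move=> e [[Ee ke]|/AR[]//]; split => //.
have [[e' [Ae' e'e]]|nH] := pselect (exists e', A e' /\ hit e' e).
  have [_ dw _ _] := AR Ae'.
  by move: ke; rewrite (repaired_hit Ae' e'e) leqNgt (recolor_hit dw e'e).
by rewrite -repaired_miss.
Qed.

End Names.
Lemma recolor_names (phi : nat -> X -> X) (c d : X -> nat) (idx : X -> nat) e (s : seq X) :
  (forall f, f \in s -> phi (idx f) e = f) -> forall f,
  recolor phi c [seq (idx f, d f) | f <- s] e f = if f \in s then d f else c f.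
Proof.
rewrite /recolor; elim: s => // g s IH H f /=; rewrite H ?mem_head // inE eq_sym.
case: eqP => [->//|_]; apply: IH => h hs; by rewrite H // inE hs orbT.
Qed.

Lemma augments_repairable c e m (dB : nat -> nat -> set X) (pB : nat -> nat -> X -> X) :
  proper_coloring star D mu c -> holes c e ->
  (forall r e f, line_ball star r e f <-> exists i, dB r i e /\ pB r i e = f) ->
  augments star D mu c e m ->
  exists r w, size w <= m /\ repairable c (dB r) (pB r) w e.
Proof.
move=> pc he HB [d [s [pd de cd sm ds]]].
(* Only entries in the component of [e] that receive an actual color become instructions. Dropping
   the others is safe: colors interact only inside a component, and an edge left uncolored by [d]
   was a hole already. *)
pose s' := [seq f <- undup s | `[< line_conn star e f >] && (d f < k)].
have s'P f : f \in s' <-> [/\ f \in s, line_conn star e f & d f < k].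
  rewrite mem_filter mem_undup; split => [/andP[/andP[/asboolP]]//|[fs ef df]].
  by rewrite fs df /= !andbT; apply/asboolP.
have /choice [rad radP] : forall f, exists r, f \in s' -> line_ball star r e f.
  move=> f; have [fs|] := boolP (f \in s'); last by exists 0.
  by have [_ [r er] _] := (s'P f).1 fs; exists r.
pose r := \max_(f <- s') rad f.
have /choice [idx idxP] : forall f, exists i, f \in s' -> dB r i e /\ pB r i e = f.
  move=> f; have [fs|] := boolP (f \in s'); last by exists 0.
  have /HB[i ?] : line_ball star r e f.
    by apply: line_ball_le (radP f fs); rewrite /r (big_rem f) //= leq_maxl.
  by exists i.
have idxE f : f \in s' -> pB r (idx f) e = f by move=> /idxP[].
exists r, [seq (idx f, d f) | f <- s']; split.
  by rewrite size_map size_filter (leq_trans (count_size _ _)) // (leq_trans (size_undup _)).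
have es : e \in s'.
  apply/s'P; split => //; last exact: line_conn0.
  by apply/negPn/negP => /ds e1; case: he => _; rewrite leqNgt -e1 de.
split => //.
- by move=> p /mapP[f fs ->] /=; have [df _] := idxP f fs; have [_ _ ?] := (s'P f).1 fs.
- by exists (idx e, d e); [apply: map_f|exact: idxE].
- move=> p /mapP[f fs ->] /= g; rewrite idxE // => -[v fv gv] gf.
  have [_ ef df] := (s'P f).1 fs.
  rewrite !(recolor_names _ _ idxE) fs; case: ifPn => gs e1.
    by apply: gf; apply: (pd v) => //; rewrite e1.
  have gk : d g < k by apply: cd; rewrite e1.
  have gns : g \notin s.
    apply: contra gs => gs; apply/s'P; split => //; apply: line_conn_trans ef _.
    by apply: line_nbr_conn; exists v.
  by apply: gf; apply: (pd v) => //; rewrite ds.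
Qed.

(** There are countably many triples of a radius, a separating set and an instruction list. If one
    of them applies to a set of positive measure, all holes of that set are repaired at once;
    otherwise the holes handled by some triple form a null set. *)
Lemma improve c m : measurable_fun setT c -> proper_coloring star D mu c ->
  (exists c' (t : R), [/\ measurable_fun setT c', proper_coloring star D mu c', (0 < t)%R,
    (nu [set f | c f <> c' f] <= (m%:R * t)%:E)%E &
    (nu (holes c') + t%:E <= nu (holes c))%E]) \/
  exists U, [/\ measurable U, U `<=` holes c, nu U = nu (holes c) &
    forall e, U e -> ~ augments star D mu c e m].
Proof.
move=> mc pc; have nb r := named_line_ball G mp1 mp2 nstar sUX r.
have /choice[dB /choice[pB HB]] := nb.
have mdB r i : measurable (dB r i) by have [? _ _] := HB r.
have mpB r i : measurable_fun setT (pB r i) by have [_ ? _] := HB r.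
have {}HB r e f : line_ball star r e f <-> exists i, dB r i e /\ pB r i e = f.
  by have [_ _ ?] := HB r.
(* Points isolated by [UX n] from the rest of their ball of radius [(r + r).+1], so that distinct
   points of this set are far apart. *)
pose Sep (r n : nat) : set X := [set e | UX n e] `&`
  ~` [set e | exists j, (([set e | dB (r + r).+1 j e] `&` ~` [set e | pB (r + r).+1 j e = e]) `&`
    [set e | UX n (pB (r + r).+1 j e)]) e].
have mSep r n : measurable (Sep r n).
  apply: measurableI; first exact: sUX.1.
  apply/measurableC/measurable_exists => j; apply: measurableI; last exact: measurable_preim (mpB _ _) (sUX.1 n).
  exact: measurableI (mdB _ _) (measurableC (measurable_fixed sUX (mpB _ _))).
pose A (q : nat * nat * seq (nat * nat)) : set X :=
  if size q.2 <= m then repairable c (dB q.1.1) (pB q.1.1) q.2 `&` Sep q.1.1 q.1.2 else set0.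
have mA q : measurable (A q).
  rewrite /A; case: ifP => // _; apply: measurableI => //; exact: measurable_repairable.
have [[q Aq]|A0] := pselect (exists q, nu (A q) != 0%E).
  left; case: q Aq => -[r n] w; move: (mA (r, n, w)); rewrite /A /=.
  case: ifPn => [wm|]; last by rewrite measure0 eqxx.
  set B := _ `&` _ => mB nB.
  have BR : B `<=` repairable c (dB r) (pB r) w by move=> e [].
  have Bsep e e' : B e -> B e' -> line_ball star (r + r).+1 e e' -> e = e'.
    move=> [_ [_ nj]] [_ [Ue' _]] /HB[j [dj ej]].
    apply: contrapT => ee'; apply: nj; exists j; split; last by rewrite /= ej.
    by split => //= e1; apply: ee'; rewrite -e1.
  have Bfin : nu B \is a fin_num by rewrite fin_num_measure.
  exists (repaired c (pB r) w B), (fine (nu B)); split.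
  - exact: (measurable_repaired mc (mdB r) (mpB r) (HB r) mB BR Bsep).
  - exact: (repaired_proper pc (HB r) BR Bsep).
  - by rewrite fine_gt0 // lt0e nB measure_ge0 /= ltey_eq Bfin.
  - rewrite EFinM fineK //.
    apply: le_trans (measure_repaired mc (mdB r) (mpB r) (HB r) mB BR Bsep) _.
    by rewrite lee_wpmul2r // lee_fin ler_nat.
  - rewrite fineK //; exact: (holes_repaired mc (mdB r) (mpB r) (HB r) mB BR Bsep).
right; pose N := \bigcup_n A (odflt ((0, 0), [::]) (unpickle n)).
have mN : measurable N by apply: bigcupT_measurable => n; exact: mA.
have N0 : nu N = 0%E.
  apply/negligibleP => //; apply: negligible_bigcup => n; apply/negligibleP; first exact: mA.
  by apply: contrapT => /eqP nz; apply: A0; exists (odflt ((0, 0), [::]) (unpickle n)).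
have mh : measurable (holes c) by exact: measurable_holes.
exists (holes c `\` N); split.
- exact: measurableD.
- by move=> e [].
- rewrite (measureDI nu mh mN) -[LHS]adde0; congr (_ + _)%E; apply/esym.
  by apply: (subset_measure0 (B := N)) => //; exact: measurableI.
- move=> e [he Ne] aug; apply: Ne.
  have [r [w [wm rw]]] := augments_repairable pc he HB aug.
  have [l lP] := line_ball_finite G (r + r).+1 e.
  have [|n Une Unl] := sUX.2 e [seq x <- l | x != e]; first by rewrite mem_filter eqxx.
  exists (pickle (r, n, w)) => //; rewrite pickleK /A /= wm; split => //; split => //=.
  move=> [j [[dj /eqP pj] Uj]]; apply: Unl Uj; rewrite mem_filter pj /=.
  by apply/lP/line_ball_sym/HB; exists j.
Qed.

(** If almost no hole can be corrected, almost every hole is linked to at least [N] edges, and each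
    edge to at most [multiplicity_bound D mu] holes; mass transport compares the two. *)
Lemma improve_or_small c L N : (0 < D)%N -> measurable_fun setT c ->
  proper_coloring star D mu c ->
  (N * (D * (k * k * 2)) <= (L.-1 - D * (k * k * D.+1)) * L)%N ->
  (exists c' (t : R), [/\ measurable_fun setT c', proper_coloring star D mu c', (0 < t)%R,
    (nu [set f | c f <> c' f] <= ((D + D + L + L).+1%:R * t)%:E)%E &
    (nu (holes c') + t%:E <= nu (holes c))%E]) \/
  (N%:R%:E * nu (holes c) <= (multiplicity_bound D mu)%:R%:E)%E.
Proof.
move=> D0 mc pc NL; have [|[U [mU Uh nU aug]]] := improve (D + D + L + L).+1 mc pc; first by left.
right; rewrite -nU.
have nl := named_linked G mp1 mp2 nstar sUV sUX mc pc L.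
apply: (mass_transport sUX (named_line_conn G mp1 mp2 nstar sUX) _ nu_inv nl _ mU).
- exact: line_conn_sym.
- by move=> e f; exact: linked_conn.
- by move=> e /Uh[].
- move=> e Ue; have [Ee ke] := Uh _ Ue.
  have [/(aug _ Ue)//|[s [us sl sz]]] := augment_or_linked G mu_gt0 L pc Ee ke.
  exists s; split => //; move: (leq_trans NL sz); rewrite leq_pmul2r // !muln_gt0 D0 /=.
  by rewrite addn_gt0 D0.
- exact: bounded_linked.
Qed.

End Repair.

(** * The limit coloring *)

Section Ekeland.
Import Order.TTheory GRing.Theory Num.Theory.
Local Open Scope classical_set_scope.
Local Open Scope ring_scope.
Context (R : realType) (C : Type) (S : C -> C -> Prop) (Phi : C -> R).
Hypothesis S_refl : forall c, S c c.
Hypothesis S_trans : forall a b c, S a b -> S b c -> S a c.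
Hypothesis S_le : forall a b, S a b -> Phi b <= Phi a.
Hypothesis Phi_ge0 : forall c, 0 <= Phi c.
Hypothesis S_complete : forall s : nat -> C, (forall n, S (s n) (s n.+1)) ->
  exists c, forall n, S (s n) c.

(** Each step of a greedy sequence realizes at least half of the possible decrease. A strictly
    better element beyond the limit would have been available at every step, forcing a fixed
    decrease each time, against [Phi >= 0]. *)
Lemma ekeland (c0 : C) : exists c, forall c', S c c' -> Phi c <= Phi c'.
Proof.
have half c : exists c', S c c' /\ forall c'', S c c'' -> Phi c - Phi c'' <= 2 * (Phi c - Phi c').
  pose A := [set Phi c - Phi c' | c' in S c].
  have hsA : has_sup A.
    split; first by exists (Phi c - Phi c), c.
    by exists (Phi c) => _ [c' _ <-]; rewrite lerBlDr lerDl.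
  have Aub c'' : S c c'' -> Phi c - Phi c'' <= sup A.
    by move=> cc; apply: ub_le_sup; [exact: hsA.2|exists c''].
  have [sA0|sA0] := leP (sup A) 0.
    by exists c; split => // c'' /Aub le; rewrite subrr mulr0 (le_trans le).
  have s2 : 0 < sup A / 2 by rewrite divr_gt0.
  have [_ [c' cc' <-] lt] := sup_adherent s2 hsA.
  exists c'; split => // c'' /Aub le; apply: le_trans le _; lra.
have /choice[f fP] := half.
pose s n := iter n f c0.
have Ss n : S (s n) (s n.+1) by have [] := fP (s n).
have [c cP] := S_complete Ss.
exists c => c' cc'; rewrite leNgt; apply/negP => lt.
have drop n : Phi (s n.+1) <= Phi (s n) - (Phi c - Phi c') / 2.
  have [_ /(_ c' (S_trans (cP n) cc'))] := fP (s n).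
  have := S_le (cP n); rewrite -/(s n.+1) /=; lra.
have lin n : Phi (s n) <= Phi c0 - n%:R * ((Phi c - Phi c') / 2).
  elim: n => [|n IH]; first by rewrite mul0r subr0.
  have := drop n; move: (_ / 2) IH => x IH.
  have -> : n.+1%:R * x = n%:R * x + x by rewrite -natr1 mulrDl mul1r.
  lra.
have d0 : 0 < (Phi c - Phi c') / 2 by rewrite divr_gt0 // subr_gt0.
pose n := (Num.truncn (Phi c0 / ((Phi c - Phi c') / 2))).+1.
have : Phi c0 / ((Phi c - Phi c') / 2) < n%:R by exact: truncnS_gt.
rewrite ltr_pdivrMr // => lt'.
by have := lin n; have := Phi_ge0 (s n); lra.
Qed.

End Ekeland.

(** * The potential argument on Borel colorings *)

Section Vizing.
Import Order.TTheory GRing.Theory Num.Theory.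
Local Open Scope classical_set_scope.
Local Open Scope ring_scope.
Context (R : realType) dV dE (V : measurableType dV) (X : measurableType dE).
Variables (p1 p2 : X -> V) (star : V -> seq X) (D mu : nat).
Hypothesis G : star_spec p1 p2 star D mu.
Hypothesis D_gt0 : (0 < D)%N.
Hypothesis mu_gt0 : (0 < mu)%N.
Hypothesis mp1 : measurable_fun setT p1.
Hypothesis mp2 : measurable_fun setT p2.
Hypothesis nstar : named (fun v e => e \in star v).
Variables (UV : nat -> set V) (UX : nat -> set X).
Hypothesis sUV : countably_separating UV.
Hypothesis sUX : countably_separating UX.
Variable nu : probability X R.
Hypothesis nu_inv : invariant_measure nu (line_conn star) (edge_set p1 star).
Local Notation k := (D + mu)%N.
Local Notation holes := (holes p1 star D mu).

Let P (A : set X) : R := fine (nu A).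

Let nuP A : measurable A -> nu A = (P A)%:E.
Proof. by move=> mA; rewrite fineK // fin_num_measure. Qed.

Let P_ge0 A : 0 <= P A.
Proof. by rewrite fine_ge0. Qed.

Let P_le A B : measurable A -> measurable B -> A `<=` B -> P A <= P B.
Proof. by move=> mA mB AB; rewrite -lee_fin -!nuP // le_measure ?inE. Qed.

Let P_U A B : measurable A -> measurable B -> P (A `|` B) <= P A + P B.
Proof.
move=> mA mB; rewrite -lee_fin EFinD -!nuP //; [exact: measureU2|exact: measurableU].
Qed.

Let col := {c : X -> nat | measurable_fun setT c /\ proper_coloring star D mu c}.

Let differ (c c' : X -> nat) : set X := [set f | c f <> c' f].

Let mdiffer c c' : measurable_fun setT c -> measurable_fun setT c' -> measurable (differ c c').
Proof.
move=> mc mc'.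
rewrite (_ : differ c c' = ~` [set f | exists a, c f = a /\ c' f = a]).
  apply/measurableC/measurable_exists => a; apply: measurableI.
    exact: (measurable_color mc (fun q => q = a)).
  exact: (measurable_color mc' (fun q => q = a)).
apply/seteqP; split => f /=; first by move=> ne [a [e0 e1]]; apply: ne; rewrite e0 e1.
by move=> ne e1; apply: ne; exists (c f).
Qed.

Let mcol (c : col) : measurable_fun setT (sval c). Proof. exact: (svalP c).1. Qed.
Let pcol (c : col) : proper_coloring star D mu (sval c). Proof. exact: (svalP c).2. Qed.
Let mholes (c : col) : measurable (holes (sval c)).
Proof. by apply: (measurable_holes D mu mp1 nstar sUX); exact: mcol. Qed.

Let u (c : col) := P (holes (sval c)).
Let Phi (c : col) := Num.sqrt (u c).
Let dist (c c' : col) := P (differ (sval c) (sval c')).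

Let u_le1 c : u c <= 1.
Proof. by rewrite -lee_fin -nuP //; exact: probability_le1. Qed.

Let dist_triangle a b c : dist a c <= dist a b + dist b c.
Proof.
apply: le_trans (P_U (mdiffer _ _) (mdiffer _ _)); try exact: mcol.
apply: P_le; [exact: mdiffer|apply: measurableU; exact: mdiffer|].
move=> f ne; have [e1|] := pselect (sval a f = sval b f); last by left.
by right => e2; apply: ne; rewrite e1.
Qed.

(* If [u c] is the measure of the holes, then [u c = O(L ^- 2)] when no hole can be
   removed by recoloring [O(L)] edges. Hence some holes can be removed at the price of
   [O(u c ^- (1 / 2))] recolored edges each. *)
Let sqrt_drop : exists2 eps : R, 0 < eps & forall c, 0 < u c ->
  exists c', Phi c' < Phi c /\ eps * dist c c' <= Phi c - Phi c'.
Proof.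
(* [K] and [C1] are the multiplicity and the number of discarded places in [augment_or_linked]; [l]
   is such that the length [l * n] leaves at least [n * n] linked edges. *)
pose K := (D * (k * k * 2))%N; pose C1 := (D * (k * k * D.+1))%N.
pose M := multiplicity_bound D mu; pose l := (2 * K * (C1 + 2))%N.
pose m1 := (D + D + l + l).+1; pose B : R := m1%:R * (Num.sqrt M%:R + 1).
have K0 : (0 < K)%N by rewrite /K !muln_gt0 D_gt0 /= addn_gt0 D_gt0.
have B0 : 0 < B by rewrite mulr_gt0 ?ltr0n // ltr_pwDr // sqrtr_ge0.
exists (2 * B)^-1; first by rewrite invr_gt0 mulr_gt0.
move=> c u0; pose s := Phi c.
have s0 : 0 < s by rewrite sqrtr_gt0.
have ss : s * s = u c by rewrite -expr2 sqr_sqrtr // ltW.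
have s1 : s <= 1 by rewrite -sqrtr1 ler_wsqrtr.
(* Just above the square root of [M / u c]: then [n * n * u c > M] excludes the small case, while
   [n * s] stays bounded. *)
pose n := (Num.truncn (Num.sqrt M%:R / s)).+1.
have nM : Num.sqrt M%:R / s < n%:R by exact: truncnS_gt.
have nle : n%:R * s <= Num.sqrt M%:R + 1.
  have : n%:R <= Num.sqrt M%:R / s + 1.
    rewrite -natr1 lerD2r truncn_le // divr_ge0 ?sqrtr_ge0 // ltW.
  move=> h; have := ler_wpM2r (ltW s0) h; rewrite mulrDl mul1r divfK ?gt_eqF // => h'.
  by apply: le_trans h' _; rewrite lerD2l.
have n2 : M%:R < (n * n)%:R * u c.
  move: nM; rewrite ltr_pdivrMr // => nM.
  have := ltr_pM (sqrtr_ge0 _) (sqrtr_ge0 _) nM nM.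
  rewrite -expr2 sqr_sqrtr ?ler0n // natrM -ss mulrACA //.
have NL : (n * n * K <= ((l * n).-1 - C1) * (l * n))%N.
  have h1 : (n <= (l * n).-1 - C1)%N.
    suff : (n + C1 + 1 <= l * n)%N by clear; lia.
    have n0 : (0 < n)%N by [].
    rewrite /l; move: K0 n0; clear; move: K C1 n => a b n a0 n0.
    by nia.
  have h2 : (n * K <= l * n)%N.
    by rewrite mulnC leq_pmul2r // /l -mulnA mulnCA leq_pmulr // muln_gt0 addn_gt0 orbT.
  by rewrite -mulnA leq_mul.
have [[c' [t [mc' pc' t0 dle hle]]]|small] :=
    improve_or_small G mu_gt0 mp1 mp2 nstar sUV sUX nu_inv D_gt0 (mcol c) (@pcol c) NL; last first.
  exfalso; move: small; rewrite nuP // -EFinM lee_fin leNgt; move/negP; apply; exact: n2.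
pose c'' : col := exist _ c' (conj mc' pc').
have u'le : u c'' + t <= u c.
  by rewrite -lee_fin EFinD /u -!nuP //; exact: mholes.
have dle' : dist c c'' <= (D + D + l * n + l * n).+1%:R * t.
  by rewrite -lee_fin /dist -nuP //; apply: mdiffer => //; exact: mcol.
exists c''; have Pc : Phi c'' < Phi c.
  by rewrite ltr_sqrt // (lt_le_trans _ u'le) // ltrDl.
split => //; rewrite mulrC ler_pdivrMr ?mulr_gt0 //.
have mn : ((D + D + l * n + l * n).+1%:R <= m1%:R * n%:R :> R).
  rewrite -natrM ler_nat /m1; have n0 : (0 < n)%N by []. 
  by move: n0; clear; move: l n => a n n0; nia.
have s'0 : 0 <= Phi c'' by exact: sqrtr_ge0.
have s's' : Phi c'' * Phi c'' = u c'' by rewrite -expr2 sqr_sqrtr //; exact: P_ge0.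
(* The factor [s] gained from the difference of squares absorbs the cost [n], which is of order
   [1 / s]. *)
have tle : t <= (s - Phi c'') * (2 * s).
  have : t <= (s - Phi c'') * (s + Phi c'') by rewrite -subr_sqr !expr2 ss s's'; lra.
  move=> h; apply: le_trans h _; apply: ler_wpM2l; first by rewrite subr_ge0 ltW.
  by rewrite mulr_natl mulr2n lerD2l ltW.
apply: le_trans dle' _.
apply: (@le_trans _ _ (m1%:R * n%:R * ((s - Phi c'') * (2 * s)))).
  by apply: ler_pM => //; rewrite ltW.
have -> : m1%:R * n%:R * ((s - Phi c'') * (2 * s)) = (s - Phi c'') * (2 * (m1%:R * (n%:R * s))).
  by rewrite -!mulrA; lra.
apply: ler_wpM2l; first by rewrite subr_ge0 ltW.
by apply: ler_wpM2l => //; apply: ler_wpM2l => //.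
Qed.

(** An edge whose color never settles becomes a hole. A limit color below [k] is thus the color at
    all late stages, and properness passes to the limit. *)
Let limit_coloring (s : nat -> col) f : nat :=
  if pselect (exists n, forall m, (n <= m)%N -> sval (s m) f = sval (s n) f) is left H
  then sval (s (projT1 (cid H))) f else k.

Let limit_coloringE s f n : (forall m, (n <= m)%N -> sval (s m) f = sval (s n) f) ->
  limit_coloring s f = sval (s n) f.
Proof.
move=> H; rewrite /limit_coloring; case: pselect => [H'|[]]; last by exists n.
case: (cid H') => m /= Hm.
by rewrite -(H (maxn n m)) ?leq_maxl // -(Hm (maxn n m)) // leq_maxr.
Qed.

Let limit_coloring_lt s f : (limit_coloring s f < k)%N ->
  exists n, forall m, (n <= m)%N -> sval (s m) f = sval (s n) f.
Proof. by rewrite /limit_coloring; case: pselect => //; rewrite ltnn. Qed.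

Let limit_proper s : proper_coloring star D mu (limit_coloring s).
Proof.
move=> v f g fv gv e1 fk; have gk : (limit_coloring s g < k)%N by rewrite -e1.
have [n Hn] := limit_coloring_lt fk; have [m Hm] := limit_coloring_lt gk.
have e2 := limit_coloringE Hn; have e3 := limit_coloringE Hm.
apply: (@pcol (s (maxn n m)) v) => //.
  by rewrite Hn ?leq_maxl // Hm ?leq_maxr // -e2 -e3.
by rewrite Hn ?leq_maxl // -e2.
Qed.

Let limit_measurable s : measurable_fun setT (limit_coloring s).
Proof.
pose A n : set X := [set f | forall m, (n <= m)%N -> ~ differ (sval (s m)) (sval (s n)) f].
have AE n f : A n f <-> forall m, (n <= m)%N -> sval (s m) f = sval (s n) f.
  split=> H m nm; first by apply: contrapT; exact: H.
  by rewrite /differ /= (H m nm).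
have mA n : measurable (A n).
  apply: measurable_forall => m; apply: measurable_imp; first exact: measurable_cstP.
  by apply: measurableC; apply: mdiffer; exact: mcol.
apply: measurable_preim_fun => Y _.
rewrite (_ : [set _ | _] = [set f | exists n, A n f /\ Y (sval (s n) f)] `|`
    (~` [set f | exists n, A n f] `&` [set f | Y k])).
  apply: measurableU.
    apply: measurable_exists => n; apply: measurableI; first exact: mA.
    exact: measurable_color (mcol _) Y.
  apply: measurableI; last exact: measurable_cstP.
  by apply/measurableC/measurable_exists.
apply/seteqP; split => f /=.
  have [[n An]|nA] := pselect (exists n, A n f).
    by move=> Yf; left; exists n; split => //; rewrite -limit_coloringE //; apply/AE.
  rewrite /limit_coloring; case: pselect => [H|_ Yk]; last by right.
  by have [n /AE An] := H; case: nA; exists n.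
move=> [[n [/AE An Yf]]|[nA Yk]]; first by rewrite (limit_coloringE An).
rewrite /limit_coloring; case: pselect => [H|_ //].
by have [n /AE An] := H; case: nA; exists n.
Qed.

(** [S] weighs the drop of [Phi] against the measure of recolored edges. Along an [S]-chain the
    total recolored measure is finite, so colors settle almost everywhere and the limit is a bound;
    by [sqrt_drop] a minimal coloring has a null set of holes. *)
Lemma measurable_vizing : exists c, [/\ measurable_fun setT c,
  proper_coloring star D mu c & nu (holes c) = 0%E].
Proof.
have [eps eps0 drop] := sqrt_drop.
pose S c c' := eps * dist c c' <= Phi c - Phi c'.
have dist_ge0 c c' : 0 <= dist c c' by exact: P_ge0.
have S_le a b : S a b -> Phi b <= Phi a.
  by rewrite /S => h; rewrite -subr_ge0 (le_trans _ h) // mulr_ge0 // ltW.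
have S_trans a b c : S a b -> S b c -> S a c.
  rewrite /S => h1 h2; have := dist_triangle a b c.
  rewrite -(ler_pM2l eps0) mulrDr; lra.
have S_refl c : S c c.
  rewrite /S subrr (_ : dist c c = 0) ?mulr0 // /dist (_ : differ _ _ = set0) ?/P ?measure0 //.
  by apply/seteqP; split => f //= [].
have S_complete (s : nat -> col) : (forall n, S (s n) (s n.+1)) -> exists c, forall n, S (s n) c.
  move=> Ss; pose c : col := exist _ _ (conj (limit_measurable s) (@limit_proper s)).
  exists c.
  have ndPhi : nonincreasing_seq (Phi \o s).
    by apply/nonincreasing_seqP => n; apply: S_le; exact: Ss.
  have cvPhi : (Phi \o s) n @[n --> \oo] --> inf (range (Phi \o s)).
    apply: nonincreasing_cvgn => //; exists 0 => _ [n _ <-]; exact: sqrtr_ge0.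
  pose l := inf (range (Phi \o s)).
  have l_le n : l <= Phi (s n).
    apply: ge_inf; last by exists n.
    by exists 0 => _ [m _ <-]; exact: sqrtr_ge0.
  (* Off the union of these sets over [p], the color is settled from stage [n] on. *)
  pose T n p : set X := [set f | exists m, (n <= m)%N /\ (m < n + p)%N /\
    differ (sval (s m)) (sval (s m.+1)) f].
  have md m : measurable (differ (sval (s m)) (sval (s m.+1))) by apply: mdiffer; exact: mcol.
  have mT n p : measurable (T n p).
    apply: measurable_exists => m; apply: measurableI; first exact: measurable_cstP.
    by apply: measurableI; first exact: measurable_cstP.
  have PT n p : eps * P (T n p) <= Phi (s n) - Phi (s (n + p)%N).
    elim: p => [|p IH].
      rewrite addn0 subrr (_ : T n 0%N = set0) ?/P ?measure0 ?mulr0 //.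
      apply/seteqP; split => f //= [m [nm [mn _]]]; move: nm mn; rewrite addn0; clear; lia.
    have : P (T n p.+1) <= P (T n p) + dist (s (n + p)%N) (s (n + p).+1).
      apply: le_trans (P_U (mT n p) (md _)); apply: P_le => //; first exact: measurableU.
      move=> f [m [nm [mn df]]]; have [mp|mp] := ltnP m (n + p); first by left; exists m.
      by right; have -> : (n + p = m)%N by move: mn mp; clear; lia.
    move=> /(ler_wpM2l (ltW eps0)); rewrite mulrDr addnS => h.
    by have := Ss (n + p)%N; rewrite /S => h'; lra.
  have mTn n : measurable (\bigcup_p T n p) by exact: bigcupT_measurable.
  have PTn n : eps * P (\bigcup_p T n p) <= Phi (s n) - l.
    have ndT : {homo (T n) : a b / (a <= b)%N >-> (a <= b)%O}.
      move=> a b ab; apply/subsetPset => f [m [nm [mn df]]]; exists m; split => //; split => //.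
      by apply: leq_trans mn _; rewrite leq_add2l.
    have cvT : (nu \o T n) p @[p --> \oo] --> nu (\bigcup_p T n p) by exact: nondecreasing_cvg_mu.
    rewrite mulrC -ler_pdivlMr // -lee_fin -nuP // -(cvg_lim _ cvT) //.
    apply: lime_le; first by apply/cvg_ex; eexists; exact: cvT.
    apply: nearW => p; rewrite /= nuP // lee_fin ler_pdivlMr // mulrC.
    by apply: le_trans (PT n p) _; rewrite lerD2l lerN2.
  have dc n : eps * dist (s n) c <= Phi (s n) - l.
    apply: le_trans (PTn n); rewrite ler_pM2l //; apply: P_le => //.
      by apply: mdiffer; exact: mcol.
    move=> f /= df; apply: contrapT => nT; apply: df.
    have st p : sval (s (n + p)%N) f = sval (s n) f.
      elim: p => [|p IH]; first by rewrite addn0.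
      rewrite addnS -IH; apply: contrapT => ne; apply: nT; exists p.+1 => //.
      by exists (n + p)%N; rewrite leq_addr addnS ltnSn; split => //; split => // /esym.
    by rewrite (@limit_coloringE s f n) // => m nm; rewrite -(subnKC nm).
  (* A hole of the limit is a hole at stage [n] or changes color afterwards; as [n] grows this gives
     [u c <= l * l]. *)
  have uc n : u c <= Phi (s n) * Phi (s n) + (Phi (s n) - l) / eps.
    have -> : Phi (s n) * Phi (s n) = u (s n) by rewrite -expr2 sqr_sqrtr // P_ge0.
    have dn : dist (s n) c <= (Phi (s n) - l) / eps by rewrite ler_pdivlMr // mulrC.
    apply: le_trans (lerD (lexx _) dn).
    apply: le_trans (P_U (mholes _) (mdiffer (mcol _) (mcol _))).
    apply: P_le; [exact: mholes|apply: measurableU; [exact: mholes|by apply: mdiffer; exact: mcol]|].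
    move=> f [Ef kf]; have [e1|] := pselect (sval (s n) f = sval c f); last by right.
    by left; split => //; rewrite e1.
  have ul : u c <= l * l.
    have cv : (Phi (s n) * Phi (s n) + (Phi (s n) - l) / eps) @[n --> \oo] --> l * l + (l - l) / eps.
      apply: cvgD; first exact: cvgM.
      by apply: cvgMr_tmp; apply: cvgB => //; exact: cvg_cst.
    rewrite subrr mul0r addr0 in cv; rewrite -(cvg_lim _ cv) //.
    by apply: limr_ge; [exact: cvgP cv|exact: nearW].
  have l0 : 0 <= l by apply: lb_le_inf; [exists (Phi (s 0%N)), 0%N|move=> _ [n _ <-]; exact: sqrtr_ge0].
  have Pl : Phi c <= l.
    by rewrite -(ger0_norm l0) -sqrtr_sqr ler_wsqrtr // expr2.
  by move=> n; apply: le_trans (dc n) _; rewrite lerD2l lerN2.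
(* Start with everything uncolored, which is proper because holes never conflict. *)
have c0 : col.
  exists (fun=> k); split; first exact: measurable_cst.
  by move=> v f g _ _ _; rewrite ltnn.
have [c cP] := ekeland S_refl S_trans S_le (fun c => sqrtr_ge0 _) S_complete c0.
exists (sval c); split; [exact: mcol|exact: pcol|].
rewrite nuP //; congr EFin; apply/eqP; rewrite eq_le P_ge0 andbT leNgt; apply/negP => u0.
have [c' [lt /cP]] := drop c u0.
by rewrite leNgt lt.
Qed.

End Vizing.

(** * Inner regularity *)

Section SmallSets.
Import Order.TTheory GRing.Theory Num.Theory.
Local Open Scope classical_set_scope.
Local Open Scope ereal_scope.
Context (R : realType) d (X : measurableType d) (nu : probability X R).

Lemma small_bigcup (B : nat -> set X) (e : R) : (0 < e)%R -> (forall n, measurable (B n)) ->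
  (forall n, nu (B n) <= (e / (2 ^ n.+1)%:R)%:E) -> nu (\bigcup_n B n) <= e%:E.
Proof.
move=> e0 mB leB; apply: le_trans (epsilon_trick0 xpredT (ltW e0)).
apply: (@le_trans _ _ (\sum_(i <oo) nu (B i))).
  by apply: generalized_Boole_inequality => //; exact: bigcupT_measurable.
by apply: lee_nneseries.
Qed.

(** The parts not covered by the first [N] sets decrease to the empty set. *)
Lemma small_tail (F : nat -> set X) (e : R) : (0 < e)%R -> (forall n, measurable (F n)) ->
  exists N, nu [set x | (exists n, F n x) /\ ~ exists n, (n < N)%N /\ F n x] <= e%:E.
Proof.
move=> e0 mF; apply: contrapT => /forallNP large.
pose H N := [set x | (exists n, F n x) /\ ~ exists n, (n < N)%N /\ F n x].
have mH N : measurable (H N).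
  apply: measurableI; first exact: measurable_exists.
  apply/measurableC/measurable_exists => n; apply: measurableI (mF n); exact: measurable_cstP.
have H0 : \bigcap_n H n = set0.
  apply/seteqP; split => // x Hx; have [[n Fn] _] := Hx 0%N I.
  by have [_] := Hx n.+1 I; apply; exists n.
have niH : nonincreasing_seq H.
  move=> n m nm; apply/subsetPset => x [xF nx]; split => // -[i [im Fi]].
  by apply: nx; exists i; split => //; exact: leq_trans im nm.
have cv : nu \o H @ \oo --> nu (\bigcap_n H n).
  apply: nonincreasing_cvg_mu => //; last by rewrite H0.
  by rewrite (le_lt_trans (probability_le1 nu (mH 0%N))) // ltry.
rewrite H0 measure0 in cv.
have : e%:E <= lim (nu \o H @ \oo).
  apply: lime_ge; first by apply/cvg_ex; eexists; exact: cv.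
  by apply: nearW => N; rewrite /= ltW // ltNge; apply/negP; exact: large.
by rewrite (cvg_lim _ cv) // lee_fin leNgt e0.
Qed.

Lemma measure_le_sum3 (A B C D : set X) (a b c : R) : measurable A -> measurable B ->
  measurable C -> measurable D -> A `<=` B `|` C `|` D -> nu B <= a%:E -> nu C <= b%:E ->
  nu D <= c%:E -> nu A <= (a + b + c)%:E.
Proof.
move=> mA mB mC mD ABCD Ba Cb Dc.
have mBC : measurable (B `|` C) by exact: measurableU.
apply: le_trans (le_measure _ _ _ ABCD) _; rewrite ?inE //; first exact: measurableU.
apply: le_trans (measureU2 _ mBC mD) _; rewrite !EFinD; apply: leeD => //.
by apply: le_trans (measureU2 _ mB mC) _; exact: leeD.
Qed.

End SmallSets.

Section Approximation.
Import Order.TTheory GRing.Theory Num.Theory.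
Local Open Scope classical_set_scope.
Context (R : realType) d (X : measurableType d) (nu : probability X R).
Context (Y : topologicalType) (q : X -> Y).

(** Closedness is listed because [Y] is not assumed Hausdorff, measurability of the preimage because
    the image measure is only accessed through [q]. *)
Definition inner_compact (K A : set Y) :=
  [/\ compact K, closed K, measurable (q @^-1` K) & K `<=` A].

(** Approximating a set and its complement together makes the class closed under complements by
    symmetry. *)
Definition compact_approx (A : set Y) := measurable (q @^-1` A) /\
  forall e : R, (0 < e)%R -> exists K1 K2, [/\ inner_compact K1 A, inner_compact K2 (~` A)
    & (nu (~` (q @^-1` (K1 `|` K2))) <= e%:E)%E].

Lemma compact_approxC A : compact_approx A -> compact_approx (~` A).
Proof.
move=> [mA HA]; split; first by rewrite preimage_setC; exact: measurableC.
move=> e e0; have [K1 [K2 [i1 i2 le]]] := HA e e0.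
by exists K2, K1; rewrite setCK setUC.
Qed.

Lemma compact_approx_bigcup (A : nat -> set Y) : (forall n, compact_approx (A n)) ->
  compact_approx (\bigcup_n A n).
Proof.
move=> HA; split; first by rewrite preimage_bigcup; apply: bigcupT_measurable => n; case: (HA n).
move=> e e0.
have pos n : (0 < e / 3 / (2 ^ n.+1)%:R)%R by rewrite !divr_gt0 // ltr0n expn_gt0.
have /choice [K1 /choice [K2 HK]] := fun n => (HA n).2 _ (pos n).
have c1 n : compact (K1 n) by have [[]] := HK n.
have c2 n : compact (K2 n) by have [_ []] := HK n.
have cl1 n : closed (K1 n) by have [[]] := HK n.
have cl2 n : closed (K2 n) by have [_ []] := HK n.
have m1 n : measurable (q @^-1` K1 n) by have [[]] := HK n.
have m2 n : measurable (q @^-1` K2 n) by have [_ []] := HK n.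
have s1 n : K1 n `<=` A n by have [[]] := HK n.
have s2 n : K2 n `<=` ~` A n by have [_ []] := HK n.
have e30 : (0 < e / 3)%R by rewrite divr_gt0.
have [N leN] := small_tail nu e30 m1.
(* Inside the union, finitely many [K1 n] suffice up to a small error; the complement needs all the
   [K2 n], whose intersection is still compact. *)
pose L1 := \big[setU/set0]_(n < N) K1 n; pose L2 := \bigcap_n K2 n.
have L1E y : L1 y <-> exists n, (n < N)%N /\ K1 n y.
  rewrite /L1 -bigcup_mkord; split => [[n nN Kn]|[n [nN Kn]]]; by exists n.
have mL1 : measurable (q @^-1` L1).
  rewrite (_ : _ @^-1` _ = [set x | exists n, (n < N)%N /\ (q @^-1` K1 n) x]).
    by apply: measurable_exists => n; apply: measurableI (m1 n); exact: measurable_cstP.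
  by apply/seteqP; split => x /= /L1E.
have mL2 : measurable (q @^-1` L2).
  by rewrite preimage_bigcap; apply: bigcapT_measurable.
exists L1, L2; split.
- split => //.
  + by apply: bigsetU_compact => i _.
  + by rewrite /L1 -bigcup_mkord; apply: closed_bigcup => //; exact: finite_II.
  + by move=> y /L1E[n [_ /s1]]; exists n.
- split => //.
  + apply: (subclosed_compact _ (c2 0%N)); last by move=> y /(_ 0%N I).
    by apply: closed_bigI => n _.
  + by apply: closed_bigI => n _.
  + by move=> y Ky [n _ An]; have /s2 := Ky n I; apply.
- pose B n := ~` (q @^-1` (K1 n `|` K2 n)).
  have mB n : measurable (B n) by apply: measurableC; rewrite preimage_setU; exact: measurableU.
  have leB : (nu (\bigcup_n B n) <= (e / 3)%:E)%E.
    by apply: small_bigcup => // n; have [_ _] := HK n.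
  rewrite (_ : e = e / 3 + e / 3 + e / 3)%R; last by lra.
  apply: (measure_le_sum3 _ _ _ _ _ leB leN (D := set0)) => //.
  + by apply: measurableC; rewrite preimage_setU; exact: measurableU.
  + exact: bigcupT_measurable.
  + apply: measurableI; first exact: measurable_exists.
    by apply/measurableC/measurable_exists => n; apply: measurableI (m1 n); exact: measurable_cstP.
  + move=> x nL; left.
    have [[n Bn]|nB] := pselect (exists n, B n x); [by left; exists n|right].
    have K12 n : K1 n (q x) \/ K2 n (q x).
      by apply: contrapT => nK; apply: nB; exists n.
    split.
      apply: contrapT => nK1; apply: nL; right => n _.
      by have [K1n|//] := K12 n; case: nK1; exists n.
    by move=> [n [nN Kn]]; apply: nL; left; apply/L1E; exists n.
  + by rewrite measure0 lee_fin ltW.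
Qed.

Lemma compact_approx_sigma (A : set Y) : compact_approx A ->
  exists2 K : nat -> set Y, (forall n, inner_compact (K n) A) &
    measurable (q @^-1` (A `\` \bigcup_n K n)) /\ nu (q @^-1` (A `\` \bigcup_n K n)) = 0%E.
Proof.
move=> [mA HA].
have pos n : (0 < n.+1%:R^-1 :> R)%R by rewrite invr_gt0.
have /choice [K1 /choice [K2 HK]] := fun n => HA _ (pos n).
have i1 n : inner_compact (K1 n) A by have [] := HK n.
exists K1 => //.
have m1 n : measurable (q @^-1` K1 n) by have [] := i1 n.
have m2 n : measurable (q @^-1` K2 n) by have [_ []] := HK n.
have mD : measurable (q @^-1` (A `\` \bigcup_n K1 n)).
  apply: (measurableD mA (B := \bigcup_n (q @^-1` K1 n))); exact: bigcupT_measurable.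
split => //; apply/eqP; rewrite eq_le measure_ge0 andbT; apply/lee_addgt0Pr => e e0; rewrite add0e.
pose n := Num.truncn e^-1.
have ne : (n.+1%:R^-1 <= e)%R.
  by rewrite invf_ple ?posrE // ltW // truncnS_gt.
have [_ [_ _ _ s2] le] := HK n.
apply: le_trans (le_trans le _); last by rewrite lee_fin.
apply: le_measure; rewrite ?inE //.
  by apply: measurableC; rewrite preimage_setU; exact: measurableU.
move=> x [Ax nK] [K1x|/s2]; last exact.
by apply: nK; exists n.
Qed.

End Approximation.

Definition open_base (T : topologicalType) (U : nat -> set T) :=
  (forall i, open (U i)) /\
  forall (x : T) O, open O -> O x -> exists2 i, U i x & (U i `<=` O)%classic.

(** * Tightness in Polish spaces *)

Section Polish.
Import Order.TTheory GRing.Theory Num.Theory.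
Local Open Scope classical_set_scope.

Lemma second_countable_base (T : topologicalType) : @second_countable T ->
  exists U, @open_base T U.
Proof.
move=> [B /countable_injP[g ginj] [Bo Bb]].
pose S n : set (set T) := [set b | B b /\ g b = n].
(* As [g] is injective on the base, this is the basic set with code [n], or the empty set if there
   is none. *)
exists (fun n => [set x | exists2 b, S n b & b x]); split.
  move=> n; rewrite (_ : [set _ | _] = \bigcup_(b in S n) b); last by apply/seteqP; split.
  by apply: bigcup_open => b [Bb' _]; exact: Bo.
move=> x O oO Ox; have [b [Bb' bx] bO] := Bb x O (open_nbhs_nbhs (conj oO Ox)).
exists (g b); first by exists b.
move=> y [b' [Bb'' gb'] b'y]; apply: bO => /=.
by rewrite (_ : b = b') //; apply: ginj; rewrite ?in_setE // gb'.
Qed.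

Context (R : realType) (T : completePseudoMetricType R) (U : nat -> set T).
Hypothesis bU : open_base U.

Lemma open_closure_base (x : T) O : open O -> O x ->
  exists2 i, U i x & closure (U i) `<=` O.
Proof.
move=> oO Ox; have [A nA AO] := uniform_regular (open_nbhs_nbhs (conj oO Ox)).
move: nA; rewrite nbhsE => -[B [oB Bx] BA].
have [i Ui UB] := bU.2 x B oB Bx; exists i => //.
by apply: subset_trans AO; apply: closure_subset; exact: subset_trans BA.
Qed.

Lemma open_Fsigma O : open O -> exists2 F : nat -> set T, forall i, closed (F i) &
  O = \bigcup_i F i.
Proof.
move=> oO; exists (fun i => if pselect (closure (U i) `<=` O) is left _ then closure (U i) else set0).
  by move=> i; case: pselect => _; [exact: closed_closure|exact: closed0].
apply/seteqP; split => x.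
  move=> Ox; have [i Ui UO] := open_closure_base oO Ox.
  by exists i => //; case: pselect => // _; exact: (@subset_closure _ (U i) x Ui).
by move=> [i _]; case: pselect => // UO; exact: UO.
Qed.

Section Tight.
Context d (X : measurableType d) (nu : probability X R) (q : X -> T).
Hypothesis mq : forall O, open O -> measurable (q @^-1` O).

Let mqC F : closed F -> measurable (q @^-1` F).
Proof.
move=> cF; rewrite -[F]setCK preimage_setC; apply: measurableC; exact: mq (closed_openC cF).
Qed.

(** Ulam's theorem: for every [m], finitely many closed sets inside balls of radius [1 / m.+1] carry
    almost all the mass. The intersection of these finite unions is closed and totally bounded,
    hence compact by completeness. *)
Lemma tight (e : R) : (0 < e)%R -> exists K, [/\ compact K, closed K & (nu (~` (q @^-1` K)) <= e%:E)%E].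
Proof.
move=> e0.
pose small m i := exists x : T, closure (U i) `<=` ball x (m.+1%:R^-1)%R.
pose F m i : set T := [set y | small m i /\ closure (U i) y].
have cF m i : closed (F m i).
  have [Im|nI] := pselect (small m i).
    rewrite (_ : F m i = closure (U i)); first exact: closed_closure.
    by apply/seteqP; split => y //; case.
  rewrite (_ : F m i = set0); first exact: closed0.
  by apply/seteqP; split => y //; case.
have Fcover m y : exists i, F m i y.
  have rm : (0 < m.+1%:R^-1 :> R)%R by rewrite invr_gt0.
  have oB := open_interior (ball y (m.+1%:R^-1)%R : set T).
  have [i Ui UB] := open_closure_base oB (nbhsx_ballx y _ rm).
  exists i; split; last exact: (@subset_closure _ (U i) y Ui).
  by exists y; apply: subset_trans UB _; exact: interior_subset.
have mF m i : measurable (q @^-1` F m i) by exact: mqC.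
have pos m : (0 < e / (2 ^ m.+1)%:R)%R by rewrite divr_gt0 // ltr0n expn_gt0.
have /choice [N HN] := fun m => small_tail nu (pos m) (mF m).
pose L m := \big[setU/set0]_(i < N m) F m i.
have LE m y : L m y <-> exists i, (i < N m)%N /\ F m i y.
  rewrite /L -bigcup_mkord; split => [[n nN Kn]|[n [nN Kn]]]; by exists n.
have cL m : closed (L m).
  by rewrite /L -bigcup_mkord; apply: closed_bigcup => //; exact: finite_II.
exists (\bigcap_m L m); split.
- rewrite compact_ultra => G UG GK.
  have Gc : cauchy G.
    apply: cauchy_exP => r r0; pose m := Num.truncn r^-1.
    have mr : (m.+1%:R^-1 <= r)%R by rewrite invf_ple ?posrE // ltW // truncnS_gt.
    have GL : G (L m) by apply: filterS GK => y /(_ m I).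
    (* An ultrafilter containing a finite union contains one of its members; small members for all
       [m] make it Cauchy. *)
    have [i GF] : exists i, G (F m i).
      move: GL; rewrite /L; elim: (N m) => [|n IH].
        by rewrite big_ord0 => /filter_ex[].
      rewrite big_ord_recr /= => GU.
      have [//|nG] := in_ultra_setVsetC (F m n) UG; first by exists n.
      apply: IH; apply: filterS (filterI GU nG) => y [[//|Fy] nFy]; by case: nFy.
    have [y [[x Ix] _]] := filter_ex GF.
    exists x; apply: filterS GF => z [_ /Ix]; exact: le_ball.
  have /cvg_ex [y Gy] : cvg G by exact/cauchy_cvgP.
  exists y; split => // m _.
  have GL : G (L m) by apply: filterS GK => z /(_ m I).
  apply: cL => B nB; have := Gy _ nB => GB; exact: filter_ex (filterI GL GB).
- by apply: closed_bigI => m _; exact: cL.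
- rewrite preimage_bigcap setC_bigcap.
  apply: small_bigcup => // m.
    by apply: measurableC; exact: mqC.
  apply: le_trans (HN m); apply: le_measure; rewrite ?inE.
  + by apply: measurableC; exact: mqC.
  + apply: measurableI; first exact: measurable_exists (mF m).
    by apply/measurableC/measurable_exists => n; apply: measurableI (mF m n); exact: measurable_cstP.
  + move=> x nL; split; first exact: Fcover.
    by move=> [i [iN Fi]]; apply: nL; apply/LE; exists i.
Qed.

Lemma compact_approx_open O : open O -> compact_approx nu q O.
Proof.
move=> oO; split; first exact: mq.
move=> e e0; have e20 : (0 < e / 2)%R by rewrite divr_gt0.
have [K [cK clK Ke]] := tight e20.
have [F cF OE] := open_Fsigma oO.
have mF i : measurable (q @^-1` F i) by exact: mqC.
have [N HN] := small_tail nu e20 mF.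
pose L := \big[setU/set0]_(i < N) F i.
have LE y : L y <-> exists i, (i < N)%N /\ F i y.
  rewrite /L -bigcup_mkord; split => [[n nN Kn]|[n [nN Kn]]]; by exists n.
have cL : closed L.
  by rewrite /L -bigcup_mkord; apply: closed_bigcup => //; exact: finite_II.
have cO : closed (~` O) by exact: open_closedC.
exists (L `&` K), (~` O `&` K); split.
- split; [|exact: closedI|by apply: mqC; exact: closedI|].
    by apply: (subclosed_compact _ cK); [exact: closedI|exact: subIsetr].
  by move=> y [/LE[i [_ Fi]] _]; rewrite OE; exists i.
- split; [|exact: closedI|by apply: mqC; exact: closedI|exact: subIsetl].
  by apply: (subclosed_compact _ cK); [exact: closedI|exact: subIsetr].
- rewrite (_ : e = e / 2 + e / 2 + 0)%R; last by lra.
  apply: (measure_le_sum3 _ _ _ _ _ Ke HN (D := set0)) => //.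
  + by apply: measurableC; apply: mqC; apply: closedU; exact: closedI.
  + by apply: measurableC; exact: mqC.
  + apply: measurableI; first exact: measurable_exists mF.
    by apply/measurableC/measurable_exists => n; apply: measurableI (mF n); exact: measurable_cstP.
  + move=> x nx; left; have [Kx|nK] := pselect (K (q x)); [right|by left].
    have Ox : O (q x) by apply: contrapT => nO; apply: nx; right.
    split; first by move: Ox; rewrite OE => -[i _ Fi]; exists i.
    by move=> [i [iN Fi]]; apply: nx; left; split => //; apply/LE; exists i.
  + by rewrite measure0.
Qed.

Lemma compact_approx_borel A : <<s @open T >> A -> compact_approx nu q A.
Proof.
apply: smallest_sub => [|O]; last exact: compact_approx_open.
split.
- by apply: compact_approx_open; exact: open0.
- by move=> B HB; rewrite setTD; exact: compact_approxC.
- by move=> B HB; exact: compact_approx_bigcup.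
Qed.

End Tight.

Section Square.
Context d (X : measurableType d) (nu : probability X R) (q1 q2 : X -> T).
Hypothesis mq1 : forall O, open O -> measurable (q1 @^-1` O).
Hypothesis mq2 : forall O, open O -> measurable (q2 @^-1` O).

Definition pair_map x := (q1 x, q2 x).

Lemma closed_rectangle (A B : set T) : closed A -> closed B -> closed (A `*` B).
Proof.
move=> cA cB; rewrite (_ : A `*` B = (@fst T T) @^-1` A `&` (@snd T T) @^-1` B); last first.
  by apply/seteqP; split.
by apply: closedI; apply: closed_comp => // x _; [exact: cvg_fst|exact: cvg_snd].
Qed.


(** A cylinder over a compact set need not be compact, so tightness confines the free coordinate to
    a compact set of almost full measure. *)
Lemma compact_approx_fst A : compact_approx nu q1 A -> compact_approx nu pair_map (A `*` setT).
Proof.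
move=> [mA HA]; split; first by rewrite (_ : _ @^-1` _ = q1 @^-1` A) //; apply/seteqP; split => x // [].
move=> e e0; have e20 : (0 < e / 2)%R by rewrite divr_gt0.
have [K1 [K2 [[c1 cl1 m1 s1] [c2 cl2 m2 s2] le12]]] := HA _ e20.
have [K [cK clK Ke]] := tight nu mq2 e20.
have mK : measurable (q2 @^-1` K).
  rewrite -[K]setCK preimage_setC; apply: measurableC; exact: mq2 (closed_openC clK).
exists (K1 `*` K), (K2 `*` K); split.
- split; [exact: compact_setX|exact: closed_rectangle|exact: measurableI m1 mK|].
  by move=> y [/s1].
- split; [exact: compact_setX|exact: closed_rectangle|exact: measurableI m2 mK|].
  by move=> y [/s2 nA _] [].
- rewrite (_ : e = e / 2 + e / 2 + 0)%R; last by lra.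
  apply: (measure_le_sum3 _ _ _ _ _ le12 Ke (D := set0)) => //.
  + by apply: measurableC; rewrite preimage_setU;
    apply: measurableU; [exact: measurableI m1 mK|exact: measurableI m2 mK].
  + by apply: measurableC; rewrite preimage_setU; exact: measurableU.
  + exact: measurableC.
  + move=> x nx; left; have [Kx|nK] := pselect (K (q2 x)); [left|by right].
    by move=> [K1x|K2x]; apply: nx; [left|right].
  + by rewrite measure0.
Qed.

Lemma compact_approx_snd A : compact_approx nu q2 A -> compact_approx nu pair_map (setT `*` A).
Proof.
move=> [mA HA]; split; first by rewrite (_ : _ @^-1` _ = q2 @^-1` A) //; apply/seteqP; split => x // [].
move=> e e0; have e20 : (0 < e / 2)%R by rewrite divr_gt0.
have [K1 [K2 [[c1 cl1 m1 s1] [c2 cl2 m2 s2] le12]]] := HA _ e20.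
have [K [cK clK Ke]] := tight nu mq1 e20.
have mK : measurable (q1 @^-1` K).
  rewrite -[K]setCK preimage_setC; apply: measurableC; exact: mq1 (closed_openC clK).
exists (K `*` K1), (K `*` K2); split.
- split; [exact: compact_setX|exact: closed_rectangle|exact: measurableI mK m1|].
  by move=> y [_ /s1].
- split; [exact: compact_setX|exact: closed_rectangle|exact: measurableI mK m2|].
  by move=> y [_ /s2 nA] [].
- rewrite (_ : e = e / 2 + e / 2 + 0)%R; last by lra.
  apply: (measure_le_sum3 _ _ _ _ _ le12 Ke (D := set0)) => //.
  + by apply: measurableC; rewrite preimage_setU;
    apply: measurableU; [exact: measurableI mK m1|exact: measurableI mK m2].
  + by apply: measurableC; rewrite preimage_setU; exact: measurableU.
  + exact: measurableC.
  + move=> x nx; left; have [Kx|nK] := pselect (K (q1 x)); [left|by right].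
    by move=> [K1x|K2x]; apply: nx; [left|right].
  + by rewrite measure0.
Qed.

End Square.
End Polish.

(** * Borel names for sigma-compact relations with finite sections *)

Section StandardBorel.
Import Order.TTheory GRing.Theory Num.Theory.
Local Open Scope classical_set_scope.
Context (R : realType) d (V : measurableType d) (T : completePseudoMetricType R).
Variables (f : V -> T) (g : T -> V) (U : nat -> set T).
Hypothesis hT : hausdorff_space T.
Hypothesis bU : open_base U.
Hypothesis fK : cancel f g.
Hypothesis gK : cancel g f.
Hypothesis mV : @measurable d V = preimage_set_system setT f <<s @open T >>.

Lemma measurable_preim_open O : open O -> measurable (f @^-1` O).
Proof.
by move=> oO; rewrite mV; exists O; [exact: sub_sigma_algebra|rewrite setTI].
Qed.

Lemma measurable_preim_closed F : closed F -> measurable (f @^-1` F).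
Proof.
move=> cF; rewrite -[F]setCK preimage_setC; apply: measurableC.
exact: measurable_preim_open (closed_openC cF).
Qed.

Lemma separating_base (x : T) (s : seq T) : x \notin s ->
  exists2 i, U i x & forall y, y \in s -> ~ U i y.
Proof.
move=> xs; have cs : closed [set y | y \in s].
  by apply: (accessible_finite_set_closed.1 (hausdorff_accessible hT)); exact: finite_seq.
have [|i Ui Us] := bU.2 x _ (closed_openC cs); first by move=> /= xs'; rewrite xs' in xs.
by exists i => // y ys /Us; apply.
Qed.

Lemma separating_preim : countably_separating (fun i => f @^-1` U i).
Proof.
split; first by move=> i; apply: measurable_preim_open; exact: bU.1.
move=> x s xs; have [|i Ui Us] := @separating_base (f x) [seq f y | y <- s].
  by rewrite mem_map //; exact: can_inj fK.
by exists i => // y ys; apply: Us; exact: map_f.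
Qed.

Lemma measurable_fun_base d' (X : measurableType d') (h : X -> V) :
  (forall O, open O -> measurable (h @^-1` (f @^-1` O))) -> measurable_fun setT h.
Proof.
move=> H; apply: measurable_preim_fun => Y; rewrite mV => -[B HB <-]; rewrite setTI.
move: B HB; apply: smallest_sub => [|O /H//].
split.
- by rewrite /= (_ : [set _ | _] = set0).
- move=> B HB; rewrite setTD; exact: measurableC HB.
- move=> B HB; rewrite (_ : [set _ | _] = \bigcup_n [set x | B n (f (h x))]); last by [].
  exact: bigcupT_measurable.
Qed.

Section Uniformization.
Variables (K : nat -> set (T * T)).
Hypothesis cK : forall n, compact (K n).
Let S := \bigcup_n K n.
Hypothesis Sfin : forall v, exists s : seq V, forall y, S (f v, f y) -> y \in s.

(** An open set is a countable union of closed sets, which cut a compact set in compact pieces;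
    these have compact, hence closed, projections. *)
Lemma measurable_proj O : open O -> measurable [set v | exists y, S (f v, f y) /\ O (f y)].
Proof.
move=> oO; have [F cF OE] := open_Fsigma bU oO.
pose A n i := (@fst T T) @` (K n `&` (setT `*` F i)).
have cA n i : closed (A n i).
  apply: (compact_closed hT); apply: continuous_compact.
    by apply: continuous_subspaceT => x; exact: cvg_fst.
  apply: compact_closedI => //; apply: closed_rectangle => //; exact: closedT.
rewrite (_ : [set _ | _] = [set v | exists q : nat * nat, (f @^-1` A q.1 q.2) v]).
  by apply: measurable_exists => q; exact: measurable_preim_closed.
apply/seteqP; split => v /=.
  move=> [y [[n _ Kn]]]; rewrite OE => -[i _ Fi]; exists (n, i) => /=.
  by exists (f v, f y).
move=> [[n i] /= [[x y] /= [Kn [_ Fi]] xv]]; exists (g y); rewrite gK; split.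
  by exists n => //; rewrite -xv.
by rewrite OE; exists i.
Qed.

(** Name [i] picks the point of the section lying in [U i] when there is exactly one. As sections
    are finite, each point is isolated in its section by some basic set. *)
Lemma named_sigma_compact : named (fun v y => S (f v, f y)).
Proof.
pose pr O := [set v | exists y, S (f v, f y) /\ O (f y)].
(* Uniqueness in terms of countably many projections: no two disjoint basic sets both meet the
   section inside [U i]. *)
pose dom i := pr (U i) `&` ~` [set v | exists ab : nat * nat,
  (U ab.1 `&` U ab.2 = set0) /\ pr (U i `&` U ab.1) v /\ pr (U i `&` U ab.2) v].
have oU i : open (U i) by exact: bU.1.
have mpr O : open O -> measurable (pr O) by exact: measurable_proj.
have mdom i : measurable (dom i).
  apply: measurableI; first exact: mpr.
  apply/measurableC/measurable_exists => ab; apply: measurableI; first exact: measurable_cstP.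
  by apply: measurableI; apply: mpr; exact: openI.
have uniq_dom i v y y' : dom i v -> S (f v, f y) -> S (f v, f y') -> U i (f y) -> U i (f y') -> y = y'.
  move=> [_ nab] Sy Sy' Uy Uy'; apply: contrapT => /eqP yy'; apply: nab.
  have fyy' : f y != f y' by rewrite (can_eq fK).
  move: (hT); rewrite open_hausdorff => /(_ _ _ fyy')[[A B] /= [+ +] [oA oB /eqP AB]].
  rewrite !in_setE => Ay By'.
  have [a Ua UA] := bU.2 _ _ oA Ay; have [b Ub UB] := bU.2 _ _ oB By'.
  exists (a, b) => /=; split; last by split; [exists y|exists y'].
  by apply/seteqP; split => // x [/UA Ax /UB Bx]; rewrite -AB.
pose h i v := get [set y | dom i v /\ S (f v, f y) /\ U i (f y)].
have hP i v : dom i v -> S (f v, f (h i v)) /\ U i (f (h i v)).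
  move=> dv; have [[y [Sy Uy]] _] := dv.
  by have [] := @getI V [set y | dom i v /\ S (f v, f y) /\ U i (f y)] y (conj dv (conj Sy Uy)).
have h0 i v : ~ dom i v -> h i v = point.
  by move=> nd; apply: xgetPN => y [].
exists dom, h; split => //.
  move=> i; apply: measurable_fun_base => O oO.
  rewrite (_ : _ @^-1` _ = (dom i `&` pr (U i `&` O)) `|` (~` dom i `&` [set v | O (f point)])).
    apply: measurableU; first by apply: measurableI => //; apply: mpr; exact: openI.
    by apply: measurableI; [exact: measurableC|exact: measurable_cstP].
  apply/seteqP; split => v /=.
    have [dv Oh|nd] := pselect (dom i v); last by rewrite h0 //; right.
    by left; split => //; exists (h i v); have [] := hP i v dv.
  move=> [[dv [y [Sy [Uy Oy]]]]|[nd]]; last by rewrite h0.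
  by have [Sh Uh] := hP i v dv; rewrite (uniq_dom i v (h i v) y).
move=> v y; split => [Sy|[i [dv <-]]]; last by have [] := hP i v dv.
have [s sP] := Sfin v.
have [|i Ui Us] := @separating_base (f y) [seq f y' | y' <- s & y' != y].
  by apply/mapP => -[y' +]; rewrite mem_filter => /andP[/eqP yy' _] /(can_inj fK) /esym.
have only y' : S (f v, f y') -> U i (f y') -> y' = y.
  move=> Sy' Uy'; apply: contrapT => /eqP yy'; apply: (Us _ _ Uy').
  by apply: map_f; rewrite mem_filter yy' sP.
have dv : dom i v.
  split; first by exists y.
  move=> [[a b] /= [ab [[y1 [S1 [U1 A1]]] [y2 [S2 [U2 B2]]]]]].
  rewrite (only y1) // in A1; rewrite (only y2) // in B2.
  by have : (U a `&` U b) (f y) by []; rewrite ab.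
by exists i; split => //; have [Sh Uh] := hP i v dv; exact: only.
Qed.

End Uniformization.

Section Product.
Context d' (X : measurableType d') (nu : probability X R) (p1 p2 : X -> V).
Hypothesis mp1 : measurable_fun setT p1.
Hypothesis mp2 : measurable_fun setT p2.

(** Cylinders over Borel sets are approximable and generate the Borel sets of the product. *)
Lemma compact_approx_product (W : set (V * V)) : measurable W ->
  compact_approx nu (pair_map (f \o p1) (f \o p2)) [set t | W (g t.1, g t.2)].
Proof.
have mq1 O : open O -> measurable ((f \o p1) @^-1` O).
  by move=> oO; exact: measurable_preim mp1 (measurable_preim_open oO).
have mq2 O : open O -> measurable ((f \o p2) @^-1` O).
  by move=> oO; exact: measurable_preim mp2 (measurable_preim_open oO).
have gf (B : set T) : (g @^-1` (f @^-1` B)) = B.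
  by apply/seteqP; split => t /=; rewrite gK.
have a1 B : measurable B -> compact_approx nu (f \o p1) (g @^-1` B).
  by rewrite mV => -[C HC <-]; rewrite setTI gf; exact: (compact_approx_borel bU).
have a2 B : measurable B -> compact_approx nu (f \o p2) (g @^-1` B).
  by rewrite mV => -[C HC <-]; rewrite setTI gf; exact: (compact_approx_borel bU).
move: W; apply: smallest_sub => [|W].
  split.
  - rewrite /= (_ : [set _ | _] = ~` (setT `*` (g @^-1` setT))).
      by apply: compact_approxC; apply: (compact_approx_snd bU) => //; exact: a2.
    by apply/seteqP; split => // t; apply; split.
  - by move=> W HW; rewrite setTD; exact: compact_approxC HW.
  - move=> W HW; rewrite /= (_ : [set _ | _] = \bigcup_n [set t | W n (g t.1, g t.2)]) //.
    exact: compact_approx_bigcup.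
case=> -[B mB <-]; rewrite setTI.
  rewrite /= (_ : [set _ | _] = (g @^-1` B) `*` setT); last by apply/seteqP; split => t // [].
  by apply: (compact_approx_fst bU) => //; exact: a1.
rewrite /= (_ : [set _ | _] = setT `*` (g @^-1` B)); last by apply/seteqP; split => t // [].
by apply: (compact_approx_snd bU) => //; exact: a2.
Qed.

End Product.
End StandardBorel.

(** * Unordered pairs and counting *)

Section Upair.
Local Open Scope classical_set_scope.
Context d (V : measurableType d) (U : nat -> set V).
Hypothesis sU : countably_separating U.

(* Lexicographic comparison of the codes [(U n x)_n] and [(U n y)_n]: a Borel
   orientation of the unordered pairs. *)
Definition prec (x y : V) := exists n, [/\ U n x, ~ U n y & forall m, (m < n)%N -> U m x <-> U m y].

Lemma prec_total x y : x <> y -> prec x y \/ prec y x.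
Proof.
move=> xy.
have ex : exists n, `[< ~ (U n x <-> U n y) >].
  have [|n Ux Uy] := sU.2 x [:: y]; first by rewrite inE; apply/eqP.
  by exists n; apply/asboolP => -[/(_ Ux) Uy' _]; apply: (Uy y) => //; rewrite inE.
case: (ex_minnP ex) => n /asboolP nxy nmin.
have low m : (m < n)%N -> U m x <-> U m y.
  move=> mn; apply: contrapT => /asboolT /nmin; by rewrite leqNgt mn.
have [Ux|nUx] := pselect (U n x); [left|right]; exists n; split => //.
- by move=> Uy; apply: nxy.
- by apply: contrapT => nUy; apply: nxy.
- by move=> m /low[].
Qed.

Lemma prec_asym x y : prec x y -> ~ prec y x.
Proof.
move=> [n [Unx Uny ln]] [m [Umy Umx lm]].
have [nm|mn|nm] := ltngtP n m.
- by apply: Uny; apply/(lm n nm).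
- by apply: Umx; apply/(ln m mn).
- by apply: Uny; rewrite nm.
Qed.

Lemma measurable_prec : measurable [set t : V * V | prec t.1 t.2].
Proof.
have m1 n : measurable [set t : V * V | U n t.1].
  apply: (@measurable_preim _ (V * V)%type _ V fst); [exact: measurable_fst|exact: sU.1].
have m2 n : measurable [set t : V * V | U n t.2].
  apply: (@measurable_preim _ (V * V)%type _ V snd); [exact: measurable_snd|exact: sU.1].
rewrite (_ : [set _ | _] = [set t : V * V | exists n, U n t.1 /\ ~ U n t.2 /\
    forall m, ~ ((m < n)%N /\ ~ ((U m t.1 /\ U m t.2) \/ (~ U m t.1 /\ ~ U m t.2)))]).
  apply: measurable_exists => n; apply: measurableI (m1 n) _.
  apply: measurableI; first exact: measurableC (m2 n).
  apply: measurable_forall => m; apply: measurable_not; apply: measurableI; first exact: measurable_cstP.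
  apply: measurableC; apply: measurableU; first exact: measurableI (m1 m) (m2 m).
  exact: measurableI (measurableC (m1 m)) (measurableC (m2 m)).
apply/seteqP; split => t /= [n].
  move=> [Ux Uy low]; exists n; split => //; split => // m [mn]; apply.
  have [l1 l2] := low m mn.
  by have [Ux'|nUx] := pselect (U m t.1); [left; split=> //; exact: l1|right; split=> // /l2].
move=> [Ux [Uy low]]; exists n; split => // m mn.
apply: contrapT => ne; apply: (low m); split => // -[[Ux' Uy']|[nUx nUy]]; exact: ne.
Qed.

Lemma set2_eq (a b x y : V) : [set a; b] = [set x; y] -> (a = x /\ b = y) \/ (a = y /\ b = x).
Proof.
move=> E.
have h1 : [set x; y] a by rewrite -E; left.
have h2 : [set x; y] b by rewrite -E; right.
have h3 : [set a; b] x by rewrite E; left.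
have h4 : [set a; b] y by rewrite E; right.
by case: h1 h2 h3 h4 => -> [] -> [] e1 [] e2; rewrite -?e1 -?e2; auto.
Qed.

Lemma upair_inj (e e' : upair V) : sval e = sval e' -> e = e'.
Proof. by case: e e' => [s p] [s' p'] /= E; subst s'; congr exist; exact: Prop_irrelevance. Qed.

Lemma mk_upairC (x y : V) : mk_upair (x, y) = mk_upair (y, x).
Proof. by apply: upair_inj; rewrite /= setUC. Qed.

(** The negated form also covers degenerate pairs, which [prec] does not order. *)
Lemma ends_ex (e : upair V) : exists t : V * V, e = mk_upair t /\ ~ prec t.2 t.1.
Proof.
have [x [y E]] := svalP e.
have [xy|nxy] := pselect (prec y x); last by exists (x, y); split => //; exact: upair_inj.
exists (y, x); split; last exact: prec_asym.
by apply: upair_inj; rewrite E /= setUC.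
Qed.

Definition ends (e : upair V) : V * V := projT1 (cid (ends_ex e)).

Lemma endsK e : mk_upair (ends e) = e.
Proof. by rewrite /ends; case: cid => t /= []. Qed.

Lemma ends_prec e : ~ prec (ends e).2 (ends e).1.
Proof. by rewrite /ends; case: cid => t /= []. Qed.

Lemma ends_mk x y : ~ prec y x -> ends (mk_upair (x, y)) = (x, y).
Proof.
move=> nyx; have := endsK (mk_upair (x, y)); have := @ends_prec (mk_upair (x, y)).
case: (ends _) => a b /= nba /(congr1 sval) /= /set2_eq[[-> ->]//|[ay bx]].
have [xy|xy] := pselect (x = y); first by rewrite ay bx xy.
by rewrite ay bx in nba; case: (prec_total xy).
Qed.

Lemma ends_or x y : ends (mk_upair (x, y)) = (x, y) \/ ends (mk_upair (x, y)) = (y, x).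
Proof.
have [yx|nyx] := pselect (prec y x); last by left; exact: ends_mk.
by right; rewrite mk_upairC; apply: ends_mk; exact: prec_asym.
Qed.

Lemma measurable_mk : measurable_fun setT (@mk_upair V).
Proof. by move=> _ Y; exact. Qed.

(** In the quotient structure a set is tested on ordered pairs, where [ends] is the swap or the
    identity according to the Borel relation [prec]. *)
Lemma measurable_ends (P : V * V -> Prop) : measurable [set t | P t] ->
  measurable [set t : V * V | P (t.2, t.1)] -> measurable [set e | P (ends e)].
Proof.
move=> mP mP'.
suff : measurable (setT `&` (@mk_upair V) @^-1` [set e | P (ends e)]) by [].
rewrite setTI (_ : _ @^-1` _ = ([set t : V * V | prec t.2 t.1] `&` [set t | P (t.2, t.1)]) `|`
    (~` [set t : V * V | prec t.2 t.1] `&` [set t | P t])).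
  have mp : measurable [set t : V * V | prec t.2 t.1].
    apply: (@measurable_preim _ (V * V)%type _ (V * V)%type (fun t => (t.2, t.1))
      [set t : V * V | prec t.1 t.2] _ measurable_prec).
    exact: measurable_fun_pair measurable_snd measurable_fst.
  by apply: measurableU; apply: measurableI => //; exact: measurableC.
apply/seteqP; split => -[x y] /=.
  have [yx|nyx] := pselect (prec y x); last by rewrite ends_mk //; right.
  by rewrite mk_upairC ends_mk; [left|exact: prec_asym].
move=> [[yx Pyx]|[nyx Pxy]]; last by rewrite ends_mk.
by rewrite mk_upairC ends_mk //; exact: prec_asym.
Qed.

Definition end1 (e : upair V * nat) : V := (ends e.1).1.
Definition end2 (e : upair V * nat) : V := (ends e.1).2.

Lemma measurable_end1 : measurable_fun setT end1.
Proof.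
apply: measurable_preim_fun => Y mY.
apply: (@measurable_preim _ (upair V * nat)%type _ (upair V) fst [set e | Y (ends e).1] measurable_fst).
apply: (@measurable_ends (fun t => Y t.1)).
  apply: (@measurable_preim _ (V * V)%type _ V fst); [exact: measurable_fst|exact: mY].
apply: (@measurable_preim _ (V * V)%type _ V snd); [exact: measurable_snd|exact: mY].
Qed.

Lemma measurable_end2 : measurable_fun setT end2.
Proof.
apply: measurable_preim_fun => Y mY.
apply: (@measurable_preim _ (upair V * nat)%type _ (upair V) fst [set e | Y (ends e).2] measurable_fst).
apply: (@measurable_ends (fun t => Y t.2)).
  apply: (@measurable_preim _ (V * V)%type _ V snd); [exact: measurable_snd|exact: mY].
apply: (@measurable_preim _ (V * V)%type _ V fst); [exact: measurable_fst|exact: mY].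
Qed.

Lemma end_eq (e e' : upair V * nat) : end1 e = end1 e' -> end2 e = end2 e' -> e.2 = e'.2 -> e = e'.
Proof.
case: e e' => [e i] [e' i']; rewrite /end1 /end2 /= => h1 h2 ->; congr pair.
rewrite -(endsK e) -(endsK e'); congr mk_upair.
by rewrite [LHS]surjective_pairing h1 h2 -surjective_pairing.
Qed.

Lemma mem_ends (e : upair V * nat) v : sval e.1 v <-> v = end1 e \/ v = end2 e.
Proof. by rewrite /end1 /end2 -{1}(endsK e.1). Qed.

(** An edge is determined by its oriented ends and its index, so boxes in these three coordinates
    suffice. *)
Lemma separating_edges : exists W : nat -> set (upair V * nat), countably_separating W.
Proof.
pose W (q : nat * nat * nat) : set (upair V * nat) :=
  ([set e | U q.1.1 (end1 e)] `&` [set e | U q.1.2 (end2 e)]) `&` [set e | e.2 = q.2].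
have mW q : measurable (W q).
  apply: measurableI; first apply: measurableI.
  - exact: measurable_preim measurable_end1 (sU.1 _).
  - exact: measurable_preim measurable_end2 (sU.1 _).
  - by apply: (@measurable_preim _ (upair V * nat)%type _ nat snd [set q.2] measurable_snd).
exists (fun n => W (odflt (0, 0, 0)%N (unpickle n))); split => // e s es.
have [|a Ua nUa] := sU.2 (end1 e) [seq end1 e' | e' <- s & end1 e' != end1 e].
  by apply/mapP => -[e' +]; rewrite mem_filter => /andP[/eqP ne _] /esym.
have [|b Ub nUb] := sU.2 (end2 e) [seq end2 e' | e' <- s & end2 e' != end2 e].
  by apply/mapP => -[e' +]; rewrite mem_filter => /andP[/eqP ne _] /esym.
exists (pickle (a, b, e.2)); rewrite pickleK //= => e' e's [[Ua' Ub'] ee].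
have h1 : end1 e' = end1 e.
  by apply: contrapT => /eqP ne; apply: (nUa _ _ Ua'); apply: map_f; rewrite mem_filter ne.
have h2 : end2 e' = end2 e.
  by apply: contrapT => /eqP ne; apply: (nUb _ _ Ub'); apply: map_f; rewrite mem_filter ne.
by move: es; rewrite -(end_eq h1 h2 ee) e's.
Qed.

End Upair.

(** * Finite suprema of cardinalities *)

Section Counting.
Import finmap.
Import Order.TTheory GRing.Theory Num.Theory.
Local Open Scope classical_set_scope.
Local Open Scope ereal_scope.

Lemma counting_seq (R : realType) (T : choiceType) (A : set T) : (counting A : \bar R) < +oo ->
  exists s : seq T, [/\ uniq s, forall x, x \in s <-> A x & counting A = (size s)%:R%:E :> \bar R].
Proof.
rewrite /counting; case: asboolP => // fA _; exists (fset_set A); split => //.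
by move=> x; rewrite in_fset_set // in_setE.
Qed.

(** A finite supremum of integers is attained. The natural number [n] serves in the combinatorics,
    and its comparison with the supremum leads back to the extended reals. *)
Lemma sup_counting (R : realType) (I : Type) (i0 : I) (T : choiceType) (F : I -> set T) :
  ereal_sup (range (fun i => counting (F i) : \bar R)) < +oo ->
  exists n : nat, [/\ n%:R%:E <= ereal_sup (range (fun i => counting (F i) : \bar R)) &
   forall i, exists s : seq T, [/\ uniq s, forall x, x \in s <-> F i x & (size s <= n)%N]].
Proof.
set M := ereal_sup _ => M_lt.
have leM i : counting (F i) <= M by apply: ereal_sup_ubound; exists i.
have HF i : exists s : seq T, [/\ uniq s, forall x, x \in s <-> F i x &
    counting (F i) = (size s)%:R%:E :> \bar R].
  by apply: counting_seq; exact: le_lt_trans M_lt.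
have M_ge0 : 0 <= M.
  have [s [_ _ e]] := HF i0; apply: le_trans (leM i0); by rewrite e lee_fin.
have M_fin : M \is a fin_num by rewrite ge0_fin_numE.
pose P n := `[< exists i, counting (F i) = n%:R%:E :> \bar R >].
have exP : exists n, P n by have [s [_ _ e]] := HF i0; exists (size s); apply/asboolP; exists i0.
have ubP n : P n -> (n <= Num.truncn (fine M))%N.
  move=> /asboolP[i e]; rewrite truncn_ge_nat ?fine_ge0 //.
  by rewrite -lee_fin fineK // -e.
case: (ex_maxnP exP ubP) => n /asboolP[i e] nmax.
exists n; split; first by rewrite -e.
move=> j; have [s [us sP es]] := HF j; exists s; split => //.
by apply: nmax; apply/asboolP; exists j.
Qed.

End Counting.

(** * From the multigraph to stars *)

Section Assembly.
Import Order.TTheory GRing.Theory Num.Theory.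
Local Open Scope classical_set_scope.
Context (R : realType) (d : measure_display) (V : measurableType d).
Context (T : completePseudoMetricType R) (f : V -> T) (g : T -> V) (U : nat -> set T).
Hypothesis hT : hausdorff_space T.
Hypothesis bU : open_base U.
Hypothesis fK : cancel f g.
Hypothesis gK : cancel g f.
Hypothesis mV : @measurable d V = preimage_set_system setT f <<s @open T >>.
Variable G : borel_multigraph V.
Variable nu : probability (upair V * nat)%type R.
Hypothesis hinv : line_invariant G nu.
Variables (D mu : nat).
Hypothesis mu_gt0 : (0 < mu)%N.
Hypothesis D_gt0 : (0 < D)%N.
Hypothesis degD : forall x, exists s : seq (upair V * nat),
  [/\ uniq s, forall e, e \in s <-> edges G e /\ sval e.1 x & (size s <= D)%N].
Hypothesis multmu : forall p, exists s : seq nat,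
  [/\ uniq s, forall i, i \in s <-> edges G (p, i) & (size s <= mu)%N].

Let sV := separating_preim hT bU fK mV.
Let p1 : upair V * nat -> V := end1 (fun i => f @^-1` U i).
Let p2 : upair V * nat -> V := end2 (fun i => f @^-1` U i).
Let mp1 : measurable_fun setT p1 := measurable_end1 sV.
Let mp2 : measurable_fun setT p2 := measurable_end2 sV.
Let Q := pair_map (f \o p1) (f \o p2).

Let Z i : set (V * V) := [set t | edges G (mk_upair t, i)].

Let mZ i : measurable (Z i).
Proof.
apply: (@measurable_preim _ (V * V)%type _ (upair V * nat)%type (fun t => (mk_upair t, i)) (edges G)).
  exact: measurable_fun_pair (@measurable_mk _ V) (measurable_cst i).
exact: edges_measurable.
Qed.

Let AZ i : set (T * T) := [set t | Z i (g t.1, g t.2)].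

(** Inner regularity is applied to each index [i] separately. Adding the swapped sets keeps
    compactness and lets an edge be seen from both of its ends. *)
Lemma sigma_compact_edges : exists K : nat -> nat -> set (T * T),
  [/\ forall i n, compact (K i n), forall i n x y, K i n (x, y) -> K i n (y, x),
      forall i n x y, K i n (x, y) -> edges G (mk_upair (g x, g y), i) &
      nu.-negligible (edges G `\` [set e | exists n, K e.2 n (Q e)])].
Proof.
have /choice[K HK] : forall i, exists K : nat -> set (T * T),
    (forall n, inner_compact Q (K n) (AZ i)) /\ nu.-negligible (Q @^-1` (AZ i `\` \bigcup_n K n)).
  move=> i; have [K K1 [K2 K3]] := compact_approx_sigma
    (compact_approx_product bU gK mV nu mp1 mp2 (mZ i)).
  by exists K; split => //; apply/negligibleP.
pose swap (t : T * T) := (t.2, t.1).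
exists (fun i n => K i n `|` swap @` K i n); split.
- move=> i n; have [/(_ n)[cK _ _ _] _] := HK i.
  apply: compactU => //; apply: continuous_compact => //.
  apply: continuous_subspaceT => t; apply: cvg_pair; [exact: cvg_snd|exact: cvg_fst].
- move=> i n x y [Kxy|[[a b] Kab [<- <-]]]; last by left.
  by right; exists (x, y).
- move=> i n x y; have [/(_ n)[_ _ _ sK] _] := HK i.
  by case=> [/sK//|[[a b] /sK Kab [<- <-]]]; rewrite mk_upairC.
- apply: (@negligibleS _ _ _ nu (\bigcup_i Q @^-1` (AZ i `\` \bigcup_n K i n))).
    move=> e [Ee nK]; exists e.2 => //; split.
      by rewrite /AZ /Z /= !fK /p1 /p2 /end1 /end2 -surjective_pairing endsK -surjective_pairing.
    by move=> [n _ Kn]; apply: nK; exists n; left.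
  by apply: negligible_bigcup => i; have [] := HK i.
Qed.

Lemma ae_edge_colorable_add : ae_edge_colorable G nu (D + mu).
Proof.
have [K [cK Ksym KE nullE]] := sigma_compact_edges.
pose S i := \bigcup_n K i n.
have Ssym i x y : S i (x, y) -> S i (y, x) by move=> [n _ /Ksym]; exists n.
(* Only edges in the sigma-compact part enter the stars; the others form a null set and stay outside
   [C]. *)
pose inc v (e : upair V * nat) := exists y, S e.2 (f v, f y) /\ e.1 = mk_upair (v, y).
have incE v e : inc v e -> edges G e /\ sval e.1 v.
  case: e => e i [y /= [[n _ /KE]]]; rewrite !fK => E ->; split => //; by left.
have inc_ends v e : inc v e <-> S e.2 (Q e) /\ (v = p1 e \/ v = p2 e).
  case: e => e i; rewrite /inc /Q /pair_map /p1 /p2 /end1 /end2 /=; split.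
    move=> [y [Sy ->]]; case: (ends_or sV v y) => -> /=; first by split => //; left.
    by split; [exact: Ssym|right].
  have := endsK (fun i => f @^-1` U i) e; case: (ends _ e) => x y /= <- [Sxy [->|->]]; first by exists y.
  by exists x; rewrite mk_upairC; split => //; exact: Ssym.
have /choice[star starP] : forall v, exists s : seq (upair V * nat),
    [/\ uniq s, forall e, e \in s <-> inc v e & (size s <= D)%N].
  move=> v; have [s [us sP sD]] := degD v.
  exists [seq e <- s | `[< inc v e >]]; split; first by rewrite filter_uniq.
    move=> e; rewrite mem_filter; split => [/andP[/asboolP]//|ie].
    by apply/andP; split; [exact/asboolP|apply/sP; exact: incE].
  by rewrite size_filter (leq_trans (count_size _ _)).
have stE v e : e \in star v <-> inc v e by have [_ ? _] := starP v.
have st_ends v e : e \in star v <-> S e.2 (Q e) /\ (v = p1 e \/ v = p2 e).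
  by rewrite stE; exact: inc_ends.
have st_edge v e : e \in star v -> edges G e by move=> /stE /incE[].
have neq v e : e \in star v -> p1 e != p2 e.
  move=> ev; have [x [y [xy exy]]] := edges_proper (st_edge _ _ ev); apply/eqP => e12.
  apply: xy; have /(mem_ends (fun i => f @^-1` U i))[xe|xe] : sval e.1 x by rewrite exy; left.
    have /(mem_ends (fun i => f @^-1` U i))[ye|ye] : sval e.1 y by rewrite exy; right.
      by rewrite xe ye.
    by rewrite xe ye.
  have /(mem_ends (fun i => f @^-1` U i))[ye|ye] : sval e.1 y by rewrite exy; right.
    by rewrite xe ye.
  by rewrite xe ye.
have H : star_spec p1 p2 star D mu.
  split.
  - by move=> v; have [] := starP v.
  - by move=> v e /st_ends[].
  - by move=> v e /st_ends[Se _]; apply/st_ends; split => //; left.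
  - by move=> v e /st_ends[Se _]; apply/st_ends; split => //; right.
  - exact: neq.
  - by move=> v; have [] := starP v.
  - move=> v w; rewrite -size_filter.
    have [s [us sP smu]] := multmu (mk_upair (v, w)).
    have wP e : e \in [seq e <- star v | other p1 p2 e v == w] -> edges G e /\ e.1 = mk_upair (v, w).
      rewrite mem_filter => /andP[/eqP ow ev]; split; first exact: st_edge ev.
      have /st_ends[_ ve] := ev; rewrite -(endsK (fun i => f @^-1` U i) e.1).
      have -> : ends (fun i => f @^-1` U i) e.1 = (p1 e, p2 e) by rewrite -surjective_pairing.
      move: ow; rewrite /other; case: eqP => [-> ->//|ne <-].
      by case: ve ne => // -> _; rewrite mk_upairC.
    apply: leq_trans smu; rewrite -(size_map snd); apply: uniq_leq_size.
      rewrite map_inj_in_uniq; first by rewrite filter_uniq //; have [] := starP v.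
      by move=> [e i] [e' i'] /wP[_ /= ->] /wP[_ /= ->] ->.
    move=> i /mapP[[e j] /wP[Ee /= e1] ->]; apply/sP; by rewrite -e1.
(* Finite degrees provide the finite sections required for naming. *)
have nS i : named (fun v y => S i (f v, f y)).
  apply: (named_sigma_compact hT bU fK gK mV (cK i)) => v.
  exists (flatten [seq [:: p1 e; p2 e] | e <- star v]) => y Sy.
  apply/flatten_mapP; exists (mk_upair (v, y), i); first by apply/stE; exists y.
  by rewrite !inE /p1 /p2 /end1 /end2 /=; case: (ends_or sV v y) => -> /=; rewrite eqxx ?orbT.
have nst : named (fun v e => e \in star v).
  have n1 i : named (fun v e => exists y, S i (f v, f y) /\ (mk_upair (v, y), i) = e).
    have [dom [h [md mh HS]]] := nS i.
    have mh' j : measurable_fun setT (fun v => (mk_upair (v, h j v), i)).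
      apply: measurable_fun_pair; last exact: measurable_cst.
      apply: (measurableT_comp (@measurable_mk _ V)).
      apply: measurable_fun_pair; [exact: measurable_id|exact: mh].
    apply: named_ext (named_countable md mh') => v e; split.
      by move=> [j [dj <-]]; exists (h j v); split => //; apply/HS; exists j.
    by move=> [y [/HS[j [dj hj]] <-]]; exists j; rewrite hj.
  apply: named_ext (named_exists n1) => v [e i]; split.
    by move=> [j [y [Sy [<- <-]]]]; apply/stE; exists y.
  by move=> /stE[y /= [Sy ->]]; exists i, y.
have [W sW] := separating_edges sV.
have E0E e : edge_set p1 star e <-> S e.2 (Q e).
  by split => [/st_ends[]//|Se]; apply/st_ends; split => //; left.
have line_adjP e e' : line_nbr star e e' -> e = e' \/ line_adj G e e'.
  move=> [v ev e'v]; have [->|ne] := pselect (e = e'); [by left|right].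
  split => //; [exact: st_edge ev|exact: st_edge e'v|].
  by exists v; have /stE/incE[_ ?] := ev; have /stE/incE[_ ?] := e'v.
have connP e e' : edge_set p1 star e -> line_conn star e e' ->
    edge_set p1 star e' /\ line_connected G e e'.
  move=> Ee [r [n _ ee']]; suff [Ee' ce] : edge_set p1 star e' /\ clos_refl_trans _ (line_adj G) e e'.
    by split => //; split => //; [exact: st_edge Ee|exact: st_edge Ee'].
  elim: n e Ee ee' => [e Ee <-|n IH e Ee [h eh he']]; first by split => //; exact: rt_refl.
  have Eh : edge_set p1 star h.
    by have [v _ /st_ends[Sh _]] := eh; apply/E0E.
  have [Ee' ch] := IH h Eh he'; split => //; apply: rt_trans ch.
  by have [<-|ad] := line_adjP _ _ eh; [exact: rt_refl|exact: rt_step].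
have ninv : invariant_measure nu (line_conn star) (edge_set p1 star).
  move=> A phi mA AE mphi inj mB cA; apply/esym; refine (hinv (phi := phi) mA mB _ _ _ _ _) => //.
  - by move=> e /AE /st_edge.
  - by move=> _ [e Ae <-]; have [/st_edge] := connP _ _ (AE _ Ae) (cA _ Ae).
  - exact: measurable_funTS.
  - by split => // e e' Ae Ae'; apply: inj; rewrite ?inE.
  - by move=> e Ae; have [] := connP _ _ (AE _ Ae) (cA _ Ae).
have [c [mc pc c0]] := measurable_vizing H D_gt0 mu_gt0 mp1 mp2 nst sV sW ninv.
have mE0 : measurable (edge_set p1 star) by exact: (measurable_edge_set mp1 nst sW).
pose C := edge_set p1 star `&` [set e | (c e < D + mu)%N].
have mC : measurable C.
  by apply: measurableI => //; exact: (measurable_color mc (fun q => (q < D + mu)%N)).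
exists C, c; split => //.
- by move=> e [/st_edge].
- have mEC : measurable (edges G `\` C) by apply: measurableD => //; exact: edges_measurable.
  apply/negligibleP => //.
  (* An edge outside [C] is either outside the sigma-compact part or a hole of [c]. *)
  apply: (@negligibleS _ _ _ nu ((edges G `\` [set e | exists n, K e.2 n (Q e)]) `|`
     holes p1 star D mu c)).
    move=> e [Ee nC]; have [Se|nS'] := pselect (edge_set p1 star e); [right|left]; split => //.
      by rewrite leqNgt; apply/negP => ck; apply: nC.
    by move=> [n Kn]; apply: nS'; apply/E0E; exists n.
  apply: negligibleU => //; apply/negligibleP => //.
  exact: (measurable_holes D mu mp1 nst sW mc).
- exact: measurable_funTS.
- split; first by move=> e [].
  move=> e e' [Ee ce] [Ee' ce'] [_ _ ee' [x [ex e'x]]] cee; apply: ee'.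
  have ix : e \in star x by apply/st_ends; split; [exact/E0E|exact/mem_ends].
  have ix' : e' \in star x by apply/st_ends; split; [exact/E0E|exact/mem_ends].
  exact: (pc x).
Qed.

End Assembly.

Local Open Scope classical_set_scope.
Local Open Scope ereal_scope.

Theorem theorem4p3 (R : realType) (d : measure_display) (V : measurableType d)
  (hV : standard_borel R V) (G : borel_multigraph V)
  (hdeg : max_degree R G < +oo)
  (nu : probability (upair V * nat)%type R)
  (hnu : nu (~` edges G) = 0)
  (hinv : line_invariant G nu) :
  ae_chromatic_index G nu <= max_degree R G + max_multiplicity R G.
Proof.
have [T [f [hT sT fbij mV]]] := hV.
have [U bU] := second_countable_base sT.
have [g fK gK] := fbij.
have [D [D_le degD]] := sup_counting (point : V) hdeg.
have mult_lt : max_multiplicity R G < +oo.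
  apply: (@Order.POrderTheory.le_lt_trans _ _ (mult_bound G)%:R%:E); last exact: ltry.
  apply: ub_ereal_sup => _ [p _ <-].
  have sub : [set i | edges G (p, i)] `<=` [set` iota 0 (mult_bound G)].
    by move=> i /= /edges_index /=; rewrite mem_iota.
  have : counting [set i | edges G (p, i)] < +oo :> \bar R.
    by rewrite /counting asboolT ?ltry //; exact: sub_finite_set sub (finite_seq _).
  move=> /counting_seq[s [us sP]]; rewrite /multiplicity => ->.
  rewrite lee_fin Num.Theory.ler_nat -(size_iota 0 (mult_bound G)); apply: uniq_leq_size => //.
  by move=> i /sP; exact: sub.
have [mu [mu_le multmu]] := sup_counting ((mk_upair (point, point)) : upair V) mult_lt.
(* A probability measure carried by the edges forces an edge to exist, which makes [D] and [mu]
   positive. *)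
have [e Ee] : exists e, edges G e.
  apply: contrapT => nE; have E0 : ~` edges G = setT.
    by apply/seteqP; split => // e _ Ee; apply: nE; exists e.
  have := probability_setT nu; rewrite -E0 hnu => e01.
  by have := @lte01 R; rewrite -e01 Order.POrderTheory.ltxx.
have D_gt0 : (0 < D)%N.
  have [x ex] : exists x, sval e.1 x by have [x [y [_ ->]]] := edges_proper Ee; exists x; left.
  have [s [_ sP sD]] := degD x; apply: leq_trans sD.
  have : e \in s by apply/sP.
  by case: s {sP}.
have mu_gt0 : (0 < mu)%N.
  have [s [_ sP sm]] := multmu e.1; apply: leq_trans sm.
  have : e.2 \in s by apply/sP; rewrite /= -surjective_pairing.
  by case: s {sP}.
have col := @ae_edge_colorable_add R d V T f g U hT bU fK gK mV G nu hinv D mu mu_gt0 D_gt0 degD multmu.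
apply: (@Order.POrderTheory.le_trans _ _ ((D + mu)%:R%:E)).
  by apply: ereal_inf_lbound; exists (D + mu)%N.
by rewrite GRing.natrD EFinD; apply: leeD.
Qed.
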